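(* Suppose $g\in H^t(\mathbb U)$, $t\ge1$, with $\min_{z\in\mathbb U}|g(z)|>0$, and assume the Riemann--Hilbert problem with jump $g$ has a unique solution of the form $\phi=1+\mathcal Cu$ with $u\in H^t(\mathbb U)$. Then for every $s\in\{0\}\cup(1/2,\infty)$ with $0\le2s<t$, there exists $N_0>0$ such that for $N>N_0$ the operator $\mathcal C^+-\mathcal M_N(g)\mathcal C^-$ is invertible on $\operatorname{ran}\mathcal P_N$, and the unique solution $u_N\in\operatorname{ran}\mathcal P_N$ of $$(\mathcal C^+-\mathcal M_N(g)\mathcal C^-)u_N=\mathcal P_N(g-1)$$ satisfies $\|u-u_N\|_s\le C_{s,t}N^{s-t}$ for a constant $C_{s,t}$ independent of $N$.
   Context: $\mathbb U=\{|z|=1\}$, positively oriented. $u\in L^2(\mathbb U)$ has Laurent coefficients $u_j$, $u(z)=\sum_ju_jz^j$; $H^s(\mathbb U)$ has norm $\|u\|_s^2=c_{|s|}\sum_j|u_j|^2\max\{1,|j|\}^{2s}$ with fixed normalization constants $c_{|s|}>0$. Cauchy operator $\mathcal Cu(z)=\frac1{2\pi i}\oint_{\mathbb U}\frac{u(z')}{z'-z}dz'$, boundary values $\mathcal C^\pm u(z)=\lim_{\epsilon\to0^+}\mathcal Cu(z(1\mp\epsilon))$, i.e. $\mathcal C^+u=\sum_{j\ge0}u_jz^j$, $\mathcal C^-u=-\sum_{j<0}u_jz^j$. The Riemann--Hilbert problem with jump $g$: find $\phi$ analytic on $\mathbb C\setminus\mathbb U$ of the form $\phi=1+\mathcal Cu$,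 $u\in L^2(\mathbb U)$, with $\phi^+=\phi^-g$ a.e. on $\mathbb U$, where $\phi^\pm(z)=\lim_{\epsilon\to0^+}\phi(z(1\mp\epsilon))$ (equivalently $\mathcal C^+u-(\mathcal C^-u)g=g-1$). $\mathcal M(g)u=gu$. For $N\ge1$, $N_-=\lfloor N/2\rfloor$, $N_+=\lfloor(N-1)/2\rfloor$, $\mathcal P_Nu=\sum_{j=-N_-}^{N_+}u_jz^j$, and $\mathcal M_N(g)=\mathcal P_N\mathcal M(g)\mathcal P_N$. *)

(* Defs.v *)
From Stdlib Require Import Reals ZArith.
From Coquelicot Require Import Coquelicot.
Open Scope R_scope.

(* An element u of L^2(U) is represented by its Laurent coefficients
   u : Z -> C  (u(z) = sum_j u_j z^j). *)
Definition lseq := Z -> C.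

Definition zterms (a : Z -> R) (n : nat) : R :=
  a (Z.of_nat n) + a (- Z.of_nat n - 1)%Z.
Definition zsumR (a : Z -> R) : R := Series (zterms a).
Definition zsumC (a : Z -> C) : C :=
  (zsumR (fun j => Re (a j)), zsumR (fun j => Im (a j))).

Definition hweight (s : R) (j : Z) : R :=
  Rpower (Rmax 1 (IZR (Z.abs j))) (2 * s).

Definition hs_terms (s : R) (u : lseq) : Z -> R :=
  fun j => (Cmod (u j))^2 * hweight s j.

Definition in_Hs (s : R) (u : lseq) : Prop := ex_series (zterms (hs_terms s u)).

(* ||u||_s with normalization constants c_{|s|} *)
Definition Hs_norm (c : R -> R) (s : R) (u : lseq) : R :=
  sqrt (c (Rabs s) * zsumR (hs_terms s u)).

Definition circ_val (g : lseq) (theta : R) : C :=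
  zsumC (fun j => Cmult (g j) (cos (IZR j * theta), sin (IZR j * theta))).

(* Boundary values of the Cauchy operator *)
Definition Cauchy_plus (u : lseq) : lseq :=
  fun j => if (0 <=? j)%Z then u j else 0%C.
Definition Cauchy_minus (u : lseq) : lseq :=
  fun j => if (j <? 0)%Z then Copp (u j) else 0%C.

(* Multiplication operator M(g): coefficients of the product g v (convolution) *)
Definition mult_op (g v : lseq) : lseq :=
  fun j => zsumC (fun k => Cmult (g k) (v (j - k)%Z)).

Definition lsub (u v : lseq) : lseq := fun j => Cminus (u j) (v j).
Definition delta0 : lseq := fun j => if (j =? 0)%Z then 1%C else 0%C.

Definition RHP_sol (g u : lseq) : Prop :=
  in_Hs 0 u /\
  forall j, lsub (Cauchy_plus u) (mult_op g (Cauchy_minus u)) j = lsub g delta0 j.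

Definition Nminus (N : nat) : Z := Z.of_nat (Nat.div N 2).
Definition Nplus (N : nat) : Z := Z.of_nat (Nat.div (N - 1) 2).
Definition in_window (N : nat) (j : Z) : bool :=
  ((- Nminus N <=? j)%Z && (j <=? Nplus N)%Z)%bool.
Definition PN (N : nat) (u : lseq) : lseq :=
  fun j => if in_window N j then u j else 0%C.
Definition in_ranPN (N : nat) (u : lseq) : Prop :=
  forall j, in_window N j = false -> u j = 0%C.

Definition MN (N : nat) (g v : lseq) : lseq := PN N (mult_op g (PN N v)).

Definition trunc_op (N : nat) (g v : lseq) : lseq :=
  lsub (Cauchy_plus v) (MN N g (Cauchy_minus v)).

Definition invertible_on_ranPN (N : nat) (g : lseq) : Prop :=
  (forall w, in_ranPN N w ->
     exists v, in_ranPN N v /\ forall j, trunc_op N g v j = w j) /\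
  (forall v1 v2, in_ranPN N v1 -> in_ranPN N v2 ->
     (forall j, trunc_op N g v1 j = trunc_op N g v2 j) -> forall j, v1 j = v2 j).

(* Main.v *)
Require Import Defs.
From Stdlib Require Import Reals ZArith Lra Lia FunctionalExtensionality.
From Stdlib Require Import Classical IndefiniteDescription.
From Coquelicot Require Import Coquelicot.
Open Scope R_scope.

(** Write [T_N v = v_+ + P_N (g v_-)]. On the range of [P_N] the norm of [H^s] is at most [N^s]
    times the norm of [L^2], so the error estimate follows from the stability of [T_N] in [L^2],
    which is stability of the finite Toeplitz sections of [g] on [z^(-n), ..., z^(-1)].
    Since [g] has no zeros on the circle, it has approximate inverses [q] in the Wiener algebra:
    [q g = 1 + e] with [q] a Laurent polynomial and [e] small. Hence a sequence of unit vectors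
    violating stability must concentrate at one of the two ends of the sections, and its weak limit
    there is a nonzero [w], on one half-line, with [g w] on the complementary half-line. At one end,
    [q] shows that [w] lies in [H^t] and contradicts uniqueness. At the other end, multiply
    [g w] by [phi^-]: as [phi^- g = phi^+], the result is supported on two disjoint half-lines
    and vanishes. *)


(** For the splitting into indices [j >= 0] and [j < 0], [T_N] is triangular with the identity as
    one diagonal block, so only the Toeplitz block needs a bound uniform in [N]. Since [P_N g P_N]
    approaches [g] only strongly, perturbation gives no such bound; compactness does, without an
    explicit constant. Two obstacles shape the argument. Mass could escape into the middle of long
    sections: this is excluded because [q] has finite support, so that [q (g v)] inside the section
    involves [g v] only on the section, where it is small, and at boundedly many places beyond its
    ends. Moreover uniqueness is assumed in [H^t] only, while a weak limit is merely square
    summable. Smallness of [e] is needed in [l1], but the symbol of [r = 1 - |g|^2/A^2] is small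
    only in the sup norm. The [l1] norm of [r^k] is therefore controlled by the [L^2] norms of [r^k]
    and of its derivative, through [H^1] in [l1]. Multiplier bounds in [L^2] come from a discrete
    Parseval identity, so no integral appears. Consistency is the identity [T_N (u_N - P_N u) = P_N
    (g (u - P_N u)_-)], whose right side has [L^2] size [N^(-t)]. *)

Definition Cv (s : nat -> C) (l : C) : Prop :=
  forall eps, 0 < eps -> exists n0, forall n, (n0 <= n)%nat -> Cmod (s n - l) <= eps.

Lemma Cmod_eq0_eps (z : C) : (forall eps, 0 < eps -> Cmod z <= eps) -> z = 0%C.
Proof.
  intros H. apply Cmod_eq_0. destruct (Cmod_ge_0 z) as [h|h]; [|auto].
  specialize (H (Cmod z / 2)). lra.
Qed.

Lemma Cmod_sub_sym (a b : C) : Cmod (a - b) = Cmod (b - a).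
Proof. rewrite <- Cmod_opp. f_equal. ring. Qed.

Lemma Cmod_sub_le (a b : C) : Cmod (a - b) <= Cmod a + Cmod b.
Proof. unfold Cminus. rewrite <- (Cmod_opp b). apply Cmod_triangle. Qed.

Lemma Cmod_le_sub (a b : C) : Cmod a <= Cmod b + Cmod (a - b).
Proof. replace a with (b + (a - b))%C at 1 by ring. apply Cmod_triangle. Qed.

Lemma Cv_unique s l l' : Cv s l -> Cv s l' -> l = l'.
Proof.
  intros H H'. cut (l - l' = 0)%C.
  { intros E. replace l with (l - l' + l')%C by ring. rewrite E. ring. }
  apply Cmod_eq0_eps. intros eps he.
  destruct (H (eps/2)) as [n1 h1]; [lra|]. destruct (H' (eps/2)) as [n2 h2]; [lra|].
  specialize (h1 (n1+n2)%nat ltac:(lia)). specialize (h2 (n1+n2)%nat ltac:(lia)).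
  replace (l - l')%C with ((s (n1+n2)%nat - l') - (s (n1+n2)%nat - l))%C by ring.
  eapply Rle_trans; [apply Cmod_sub_le|lra].
Qed.

Lemma Cv_const l : Cv (fun _ => l) l.
Proof.
  intros eps he. exists 0%nat. intros. replace (l - l)%C with (RtoC 0) by ring.
  rewrite Cmod_0. lra.
Qed.

Lemma Cv_ext s s' l : (forall n, s n = s' n) -> Cv s l -> Cv s' l.
Proof.
  intros E H eps he. destruct (H eps he) as [n0 h]. exists n0. intros n hn.
  rewrite <- E. auto.
Qed.

Lemma Cv_eventually s l n1 : (forall n, (n1 <= n)%nat -> s n = l) -> Cv s l.
Proof.
  intros E eps he. exists n1. intros n hn. rewrite E by auto.
  replace (l - l)%C with (RtoC 0) by ring. rewrite Cmod_0. lra.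
Qed.

Lemma Cv_plus s t l m : Cv s l -> Cv t m -> Cv (fun n => s n + t n)%C (l + m)%C.
Proof.
  intros H H' eps he.
  destruct (H (eps/2)) as [n1 h1]; [lra|]. destruct (H' (eps/2)) as [n2 h2]; [lra|].
  exists (n1+n2)%nat. intros n hn.
  specialize (h1 n ltac:(lia)). specialize (h2 n ltac:(lia)).
  replace (s n + t n - (l + m))%C with ((s n - l) + (t n - m))%C by ring.
  eapply Rle_trans; [apply Cmod_triangle|lra].
Qed.

Lemma Cv_scale c s l : Cv s l -> Cv (fun n => c * s n)%C (c * l)%C.
Proof.
  intros H eps he. pose proof (Cmod_ge_0 c).
  destruct (H (eps / (Cmod c + 1))) as [n1 h1]; [apply Rdiv_lt_0_compat; lra|].
  exists n1. intros n hn. specialize (h1 n hn).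
  replace (c * s n - c * l)%C with (c * (s n - l))%C by ring. rewrite Cmod_mult.
  apply Rle_trans with (Cmod c * (eps / (Cmod c + 1))).
  - apply Rmult_le_compat_l; auto.
  - replace eps with ((Cmod c + 1) * (eps / (Cmod c + 1))) at 2 by (field; lra).
    apply Rmult_le_compat_r; [|lra]. apply Rlt_le, Rdiv_lt_0_compat; lra.
Qed.

Lemma Cv_minus s t l m : Cv s l -> Cv t m -> Cv (fun n => s n - t n)%C (l - m)%C.
Proof.
  intros H H'. apply Cv_ext with (fun n => s n + (-(1)) * t n)%C; [intros; ring|].
  replace (l - m)%C with (l + (-(1)) * m)%C by ring.
  apply Cv_plus; auto. now apply Cv_scale.
Qed.

Lemma Cv_subseq s l phi : (forall k, (k <= phi k)%nat) -> Cv s l -> Cv (fun k => s (phi k)) l.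
Proof.
  intros hp H eps he. destruct (H eps he) as [n0 h]. exists n0. intros n hn. apply h.
  specialize (hp n). lia.
Qed.

Lemma Cv_is_lim_seq_Cmod s l : Cv s l -> is_lim_seq (fun n => Cmod (s n)) (Cmod l).
Proof.
  intros H. apply is_lim_seq_spec. intros [eps he]. simpl.
  destruct (H (eps/2)) as [n0 h]; [lra|]. exists n0. intros n hn. specialize (h n hn).
  pose proof (Cmod_le_sub (s n) l). pose proof (Cmod_le_sub l (s n)).
  rewrite Cmod_sub_sym in H1. apply Rabs_def1; lra.
Qed.

Lemma Cv_Cmod_le s l B : Cv s l -> (forall n, Cmod (s n) <= B) -> Cmod l <= B.
Proof.
  intros H hB. apply Cv_is_lim_seq_Cmod in H.
  apply (is_lim_seq_le _ _ _ _ hB H (is_lim_seq_const B)).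
Qed.

Lemma Cv_of_components (s : nat -> C) (a b : R) :
  is_lim_seq (fun n => Re (s n)) a -> is_lim_seq (fun n => Im (s n)) b -> Cv s (a, b).
Proof.
  intros Ha Hb eps he.
  apply is_lim_seq_spec in Ha, Hb.
  destruct (Ha (mkposreal (eps/2) ltac:(lra))) as [n1 h1].
  destruct (Hb (mkposreal (eps/2) ltac:(lra))) as [n2 h2]. simpl in *.
  exists (n1+n2)%nat. intros n hn.
  specialize (h1 n ltac:(lia)). specialize (h2 n ltac:(lia)).
  destruct (s n) as [x y]. simpl in *.
  replace ((x, y) - (a, b))%C with (RtoC (x - a) + Ci * RtoC (y - b))%C
    by (unfold Ci, RtoC, Cminus, Cplus, Cmult, Copp; simpl; f_equal; ring).
  eapply Rle_trans; [apply Cmod_triangle|].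
  rewrite Cmod_mult, Cmod_Ci, !Cmod_R. lra.
Qed.

(** * Sums over the windows [-n, n) *)

Fixpoint wsum (f : Z -> R) (n : nat) : R :=
  match n with
  | O => 0
  | S k => wsum f k + (f (Z.of_nat k) + f (- Z.of_nat k - 1)%Z)
  end.

Fixpoint csum (f : Z -> C) (n : nat) : C :=
  match n with
  | O => 0%C
  | S k => (csum f k + (f (Z.of_nat k) + f (- Z.of_nat k - 1)%Z))%C
  end.

(** [zterms] pairs [k] with [-k-1], which is why all windows are half open and why the natural
    reflection below is [j -> -j-1]. The successor appears because [sum_n] includes its last
    index. *)
Lemma sum_n_zterms a n : sum_n (zterms a) n = wsum a (S n).
Proof.
  induction n.
  - rewrite sum_O. unfold zterms. simpl. ring.
  - rewrite sum_Sn, IHn. reflexivity.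
Qed.

Lemma csum_components f n :
  csum f n = (wsum (fun j => Re (f j)) n, wsum (fun j => Im (f j)) n).
Proof.
  induction n; simpl; [reflexivity|]. rewrite IHn. reflexivity.
Qed.

Lemma wsum_le f f' n :
  (forall j, (- Z.of_nat n <= j < Z.of_nat n)%Z -> f j <= f' j) -> wsum f n <= wsum f' n.
Proof.
  intros H. induction n; simpl; [lra|].
  assert (wsum f n <= wsum f' n) by (apply IHn; intros; apply H; lia).
  pose proof (H (Z.of_nat n) ltac:(lia)). pose proof (H (- Z.of_nat n - 1)%Z ltac:(lia)). lra.
Qed.

Lemma wsum_ext f f' n :
  (forall j, (- Z.of_nat n <= j < Z.of_nat n)%Z -> f j = f' j) -> wsum f n = wsum f' n.
Proof. intros H. apply Rle_antisym; apply wsum_le; intros j hj; rewrite H; auto; lra. Qed.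

Lemma wsum_plus f f' n : wsum (fun j => f j + f' j) n = wsum f n + wsum f' n.
Proof. induction n; simpl; [lra|]. rewrite IHn. lra. Qed.

Lemma wsum_scal c f n : wsum (fun j => c * f j) n = c * wsum f n.
Proof. induction n; simpl; [lra|]. rewrite IHn. lra. Qed.

Lemma wsum_nonneg f n : (forall j, 0 <= f j) -> 0 <= wsum f n.
Proof.
  intros H. induction n; simpl; [lra|].
  pose proof (H (Z.of_nat n)). pose proof (H (- Z.of_nat n - 1)%Z). lra.
Qed.

Lemma wsum_mono f n m : (forall j, 0 <= f j) -> (n <= m)%nat -> wsum f n <= wsum f m.
Proof.
  intros H. induction 1; simpl; [lra|].
  pose proof (H (Z.of_nat m)). pose proof (H (- Z.of_nat m - 1)%Z). lra.
Qed.

Lemma wsum_term_le f j :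
  (forall i, 0 <= f i) -> exists n, f j <= wsum f n.
Proof.
  intros H. exists (S (Z.to_nat (Z.max j (- j - 1)))). simpl.
  pose proof (wsum_nonneg f (Z.to_nat (Z.max j (- j - 1))) H).
  rewrite Z2Nat.id by lia.
  destruct (Z.max_spec j (-j-1)) as [[h E]|[h E]]; rewrite E in *.
  - replace (- (- j - 1) - 1)%Z with j by lia. pose proof (H (-j-1)%Z). lra.
  - pose proof (H (-j-1)%Z). lra.
Qed.

Lemma csum_ext f f' n :
  (forall j, (- Z.of_nat n <= j < Z.of_nat n)%Z -> f j = f' j) -> csum f n = csum f' n.
Proof.
  intros H. induction n; simpl; [auto|].
  rewrite IHn by (intros; apply H; lia). rewrite !H by lia. reflexivity.
Qed.

Lemma csum_plus f f' n : csum (fun j => f j + f' j)%C n = (csum f n + csum f' n)%C.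
Proof. induction n; simpl; [ring|]. rewrite IHn. ring. Qed.

Lemma csum_scal c f n : csum (fun j => c * f j)%C n = (c * csum f n)%C.
Proof. induction n; simpl; [ring|]. rewrite IHn. ring. Qed.

Lemma csum_zero n : csum (fun _ => 0%C) n = 0%C.
Proof. induction n; simpl; [auto|]. rewrite IHn. ring. Qed.

Lemma Cmod_csum_le f n : Cmod (csum f n) <= wsum (fun j => Cmod (f j)) n.
Proof.
  induction n; simpl; [rewrite Cmod_0; lra|].
  eapply Rle_trans; [apply Cmod_triangle|].
  pose proof (Cmod_triangle (f (Z.of_nat n)) (f (- Z.of_nat n - 1)%Z)). lra.
Qed.

Lemma csum_single (f : Z -> C) j n :
  (- Z.of_nat n <= j < Z.of_nat n)%Z ->
  (forall i, (- Z.of_nat n <= i < Z.of_nat n)%Z -> i <> j -> f i = 0%C) -> csum f n = f j.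
Proof.
  intros hj H. induction n; [lia|]. simpl.
  destruct (Z.eq_dec j (Z.of_nat n)) as [->|h1].
  - rewrite (H (- Z.of_nat n - 1)%Z) by lia.
    rewrite (csum_ext f (fun _ => 0%C)) by (intros; apply H; lia).
    rewrite csum_zero. ring.
  - destruct (Z.eq_dec j (- Z.of_nat n - 1)) as [E|h2].
    + rewrite <- E. rewrite (H (Z.of_nat n)) by lia.
      rewrite (csum_ext f (fun _ => 0%C)) by (intros; apply H; lia).
      rewrite csum_zero. ring.
    + rewrite IHn by (try lia; intros; apply H; lia).
      rewrite (H (Z.of_nat n)), (H (- Z.of_nat n - 1)%Z) by lia. ring.
Qed.

Lemma wsum_shift1 f n :
  wsum (fun j => f (j - 1)%Z) n = wsum f n + f (- Z.of_nat n - 1)%Z - f (Z.of_nat n - 1)%Z.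
Proof.
  induction n; simpl wsum; [simpl; ring|]. rewrite IHn.
  replace (- Z.of_nat n - 1 - 1)%Z with (- Z.of_nat (S n) - 1)%Z by lia.
  replace (Z.of_nat (S n) - 1)%Z with (Z.of_nat n) by lia. ring.
Qed.

Lemma wsum_shift1' f n :
  wsum (fun j => f (j + 1)%Z) n = wsum f n + f (Z.of_nat n) - f (- Z.of_nat n)%Z.
Proof.
  induction n; simpl wsum; [simpl; ring|]. rewrite IHn.
  replace (- Z.of_nat n - 1 + 1)%Z with (- Z.of_nat n)%Z by lia.
  replace (Z.of_nat n + 1)%Z with (Z.of_nat (S n)) by lia.
  replace (- Z.of_nat (S n))%Z with (- Z.of_nat n - 1)%Z by lia. ring.
Qed.

Lemma csum_shift1 f n :
  csum (fun j => f (j - 1)%Z) n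
  = (csum f n + f (- Z.of_nat n - 1)%Z - f (Z.of_nat n - 1)%Z)%C.
Proof.
  induction n; simpl csum; [simpl; ring|]. rewrite IHn.
  replace (- Z.of_nat n - 1 - 1)%Z with (- Z.of_nat (S n) - 1)%Z by lia.
  replace (Z.of_nat (S n) - 1)%Z with (Z.of_nat n) by lia. ring.
Qed.

Lemma csum_reflect f n : csum (fun j => f (- j - 1)%Z) n = csum f n.
Proof.
  induction n; simpl; [auto|]. rewrite IHn.
  replace (- (- Z.of_nat n - 1) - 1)%Z with (Z.of_nat n) by lia. ring.
Qed.

Lemma wsum_shift1_le f n : (forall j, 0 <= f j) ->
  wsum (fun j => f (j - 1)%Z) n <= wsum f (S n).
Proof.
  intros H. rewrite wsum_shift1. simpl.
  pose proof (H (Z.of_nat n)). pose proof (H (Z.of_nat n - 1)%Z). lra.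
Qed.

Lemma wsum_shift1'_le f n : (forall j, 0 <= f j) ->
  wsum (fun j => f (j + 1)%Z) n <= wsum f (S n).
Proof.
  intros H. rewrite wsum_shift1'. simpl.
  pose proof (H (- Z.of_nat n)%Z). pose proof (H (-Z.of_nat n - 1)%Z). lra.
Qed.

(** * Balls of translation invariant norms *)

Definition ladd (x y : lseq) : lseq := fun j => (x j + y j)%C.
Definition lscal (c : C) (x : lseq) : lseq := fun j => (c * x j)%C.
Definition lzero : lseq := fun _ => 0%C.
Definition lshift (k : Z) (x : lseq) : lseq := fun j => x (j - k)%Z.

(** Closed balls stated through partial sums take the place of norms: membership contains
    summability, and it survives pointwise limits. [l2] asks for [0 <= B] explicitly because [B^2]
    forgets the sign; for the other two it is automatic. *)
Definition l1 (B : R) (x : lseq) : Prop := forall n, wsum (fun j => Cmod (x j)) n <= B.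
Definition l2 (B : R) (x : lseq) : Prop :=
  0 <= B /\ forall n, wsum (fun j => (Cmod (x j))^2) n <= B^2.
Definition linf (B : R) (x : lseq) : Prop := forall j, Cmod (x j) <= B.

(** What Young's inequality uses of a norm: subadditivity, homogeneity, translation invariance,
    monotonicity and lower semicontinuity under pointwise limits. One proof then serves [l1], [l2]
    and [linf]. *)
Record ball_family (P : R -> lseq -> Prop) : Prop := {
  ball_zero : P 0 lzero;
  ball_add : forall a b x y, P a x -> P b y -> P (a + b) (ladd x y);
  ball_scal : forall a c x, P a x -> P (Cmod c * a) (lscal c x);
  ball_shift1 : forall a x, P a x -> P a (fun j => x (j - 1)%Z);
  ball_shift1' : forall a x, P a x -> P a (fun j => x (j + 1)%Z);
  ball_dom : forall a x y, (forall j, Cmod (x j) <= Cmod (y j)) -> P a y -> P a x;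
  ball_weaken : forall a b x, a <= b -> P a x -> P b x;
  ball_lim : forall a (x : nat -> lseq) y,
    (forall n, P a (x n)) -> (forall j, Cv (fun n => x n j) (y j)) -> P a y;
  ball_point : forall a x j, P a x -> Cmod (x j) <= a }.

Lemma wsum_lim (f : nat -> Z -> R) (g : Z -> R) m :
  (forall j, is_lim_seq (fun n => f n j) (g j)) -> is_lim_seq (fun n => wsum (f n) m) (wsum g m).
Proof.
  intros H. induction m; simpl; [apply is_lim_seq_const|].
  apply is_lim_seq_plus'; auto. apply is_lim_seq_plus'; auto.
Qed.

Lemma l1_ball : ball_family l1.
Proof.
  split.
  - intros n. unfold lzero. rewrite (wsum_ext _ (fun _ => 0 * 0)), wsum_scal; [lra|].
    intros. rewrite Cmod_0. ring.
  - intros a b x y Hx Hy n. eapply Rle_trans; [|apply Rplus_le_compat; [apply Hx|apply Hy]].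
    rewrite <- wsum_plus. apply wsum_le. intros. apply Cmod_triangle.
  - intros a c x Hx n. unfold lscal. rewrite (wsum_ext _ (fun j => Cmod c * Cmod (x j))), wsum_scal.
    + apply Rmult_le_compat_l; [apply Cmod_ge_0|apply Hx].
    + intros; apply Cmod_mult.
  - intros a x H n. eapply Rle_trans; [apply (wsum_shift1_le (fun j => Cmod (x j)))|apply H].
    intros; apply Cmod_ge_0.
  - intros a x H n. eapply Rle_trans; [apply (wsum_shift1'_le (fun j => Cmod (x j)))|apply H].
    intros; apply Cmod_ge_0.
  - intros a x y H Hy n. eapply Rle_trans; [|apply (Hy n)]. apply wsum_le; auto.
  - intros a b x h H n. eapply Rle_trans; eauto.
  - intros a x y H L n.
    assert (E : is_lim_seq (fun k => wsum (fun j => Cmod (x k j)) n) (wsum (fun j => Cmod (y j)) n)).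
    { apply (wsum_lim (fun k j => Cmod (x k j))). intros j. apply Cv_is_lim_seq_Cmod, L. }
    apply (is_lim_seq_le _ _ _ _ (fun k => H k n) E (is_lim_seq_const a)).
  - intros a x j H. destruct (wsum_term_le (fun j => Cmod (x j)) j) as [n h].
    + intros; apply Cmod_ge_0.
    + eapply Rle_trans; [apply h|apply H].
Qed.

Lemma wsum_cauchy_schwarz f g n a b :
  0 <= a -> 0 <= b -> wsum (fun j => (f j)^2) n <= a^2 -> wsum (fun j => (g j)^2) n <= b^2 ->
  wsum (fun j => f j * g j) n <= a * b.
Proof.
  intros ha hb Hf Hg.
  assert (F0 : 0 <= wsum (fun j => (f j)^2) n) by (apply wsum_nonneg; intros; apply pow2_ge_0).
  assert (G0 : 0 <= wsum (fun j => (g j)^2) n) by (apply wsum_nonneg; intros; apply pow2_ge_0).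
  (* Weighted arithmetic-geometric mean inequality, from the square of [q f - p g]. The optimal
     weights are [p = a], [q = b]. *)
  assert (Q : forall p q, 0 < p -> 0 < q ->
    wsum (fun j => f j * g j) n <= (q / p * a^2 + p / q * b^2) / 2).
  { intros p q hp hq.
    apply Rle_trans with (wsum (fun j => (q/p/2) * (f j)^2 + (p/q/2) * (g j)^2) n).
    - apply wsum_le. intros j _.
      assert (0 <= (q * f j - p * g j)^2 / (2 * p * q)).
      { apply Rmult_le_pos; [apply pow2_ge_0|]. apply Rlt_le, Rinv_0_lt_compat.
        repeat apply Rmult_lt_0_compat; lra. }
      replace ((q * f j - p * g j)^2 / (2 * p * q))
        with (q/p/2 * f j ^2 + p/q/2 * g j ^2 - f j * g j) in H by (field; lra). lra.
    - rewrite wsum_plus, !wsum_scal.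
      assert (0 < q/p/2) by (repeat apply Rmult_lt_0_compat; try apply Rinv_0_lt_compat; lra).
      assert (0 < p/q/2) by (repeat apply Rmult_lt_0_compat; try apply Rinv_0_lt_compat; lra).
      apply Rle_trans with (q/p/2 * a^2 + p/q/2*b^2); [nra|]. lra. }
  apply le_epsilon. intros eps he.
  (* Either of [a], [b] may vanish, so both weights are moved up by [d]. The resulting bound
     [(a+d)(b+d)] exceeds [a b] by at most [d (a+b+1)], as [d <= 1]. *)
  pose (d := Rmin 1 (eps / (a + b + 1))).
  assert (hd : 0 < d) by (apply Rmin_glb_lt; [lra|apply Rdiv_lt_0_compat; lra]).
  assert (hd1 : d <= 1) by apply Rmin_l.
  assert (hd2 : d * (a + b + 1) <= eps).
  { replace eps with (eps / (a+b+1) * (a+b+1)) by (field; lra).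
    apply Rmult_le_compat_r; [lra|apply Rmin_r]. }
  eapply Rle_trans; [apply (Q (a+d) (b+d)); lra|].
  assert ((b+d)/(a+d) * a^2 <= (b+d)*(a+d)).
  { replace ((b+d)*(a+d)) with ((b+d)/(a+d) * (a+d)^2) by (field; lra).
    apply Rmult_le_compat_l; [apply Rlt_le, Rdiv_lt_0_compat; lra|]. nra. }
  assert ((a+d)/(b+d) * b^2 <= (b+d)*(a+d)).
  { replace ((b+d)*(a+d)) with ((a+d)/(b+d) * (b+d)^2) by (field; lra).
    apply Rmult_le_compat_l; [apply Rlt_le, Rdiv_lt_0_compat; lra|]. nra. }
  nra.
Qed.

Lemma l2_ball : ball_family l2.
Proof.
  split.
  - split; [lra|]. intros n. unfold lzero. rewrite (wsum_ext _ (fun _ => 0 * 0)), wsum_scal; [lra|].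
    intros. rewrite Cmod_0. ring.
  - intros a b x y [ha Hx] [hb Hy]. split; [lra|]. intros n.
    pose proof (wsum_cauchy_schwarz _ _ n a b ha hb (Hx n) (Hy n)) as CS.
    apply Rle_trans with (wsum (fun j => (Cmod (x j))^2 + (2 * (Cmod (x j) * Cmod (y j)) + (Cmod (y j))^2)) n).
    + apply wsum_le. intros j _. unfold ladd.
      pose proof (Cmod_triangle (x j) (y j)). pose proof (Cmod_ge_0 (x j + y j)).
      apply Rle_trans with ((Cmod (x j) + Cmod (y j))^2); [apply pow_incr; lra|]. right; ring.
    + rewrite !wsum_plus, wsum_scal. specialize (Hx n). specialize (Hy n).
      replace ((a+b)^2) with (a^2 + (2 * (a * b) + b^2)) by ring. lra.
  - intros a c x [ha Hx]. split; [apply Rmult_le_pos; [apply Cmod_ge_0|auto]|]. intros n. unfold lscal.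
    rewrite (wsum_ext _ (fun j => (Cmod c)^2 * (Cmod (x j))^2)), wsum_scal.
    + rewrite Rpow_mult_distr. apply Rmult_le_compat_l; [apply pow2_ge_0|apply Hx].
    + intros; rewrite Cmod_mult; ring.
  - intros a x [ha H]. split; auto. intros n.
    eapply Rle_trans; [apply (wsum_shift1_le (fun j => (Cmod (x j))^2))|apply H].
    intros; apply pow2_ge_0.
  - intros a x [ha H]. split; auto. intros n.
    eapply Rle_trans; [apply (wsum_shift1'_le (fun j => (Cmod (x j))^2))|apply H].
    intros; apply pow2_ge_0.
  - intros a x y H [ha Hy]. split; auto. intros n. eapply Rle_trans; [|apply (Hy n)].
    apply wsum_le. intros j _. apply pow_incr. split; [apply Cmod_ge_0|auto].
  - intros a b x h [ha H]. split; [lra|]. intros n. eapply Rle_trans; [apply H|].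
    apply pow_incr. lra.
  - intros a x y H L. split; [apply (H 0%nat)|]. intros n.
    assert (E : is_lim_seq (fun k => wsum (fun j => (Cmod (x k j))^2) n) (wsum (fun j => (Cmod (y j))^2) n)).
    { apply (wsum_lim (fun k j => (Cmod (x k j))^2)). intros j.
      pose proof (Cv_is_lim_seq_Cmod _ _ (L j)) as E.
      apply is_lim_seq_ext with (fun k => Cmod (x k j) * Cmod (x k j)); [intros; ring|].
      replace ((Cmod (y j))^2) with (Cmod (y j) * Cmod (y j)) by ring.
      apply is_lim_seq_mult'; auto. }
    apply (is_lim_seq_le _ _ _ _ (fun k => proj2 (H k) n) E (is_lim_seq_const (a^2))).
  - intros a x j [ha H]. destruct (wsum_term_le (fun j => (Cmod (x j))^2) j) as [n h].
    + intros; apply pow2_ge_0.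
    + specialize (H n). pose proof (Cmod_ge_0 (x j)). apply Rsqr_incr_0_var; auto.
      unfold Rsqr. simpl in *. lra.
Qed.

Lemma linf_ball : ball_family linf.
Proof.
  split.
  - intros j. unfold lzero. rewrite Cmod_0. lra.
  - intros a b x y Hx Hy j. unfold ladd. pose proof (Cmod_triangle (x j) (y j)).
    specialize (Hx j). specialize (Hy j). lra.
  - intros a c x H j. unfold lscal. rewrite Cmod_mult. apply Rmult_le_compat_l; [apply Cmod_ge_0|auto].
  - intros a x H j. apply H.
  - intros a x H j. apply H.
  - intros a x y H Hy j. eapply Rle_trans; eauto.
  - intros a b x h H j. specialize (H j). lra.
  - intros a x y H L j. apply (Cv_Cmod_le _ _ _ (L j)). intros; apply H.
  - auto.
Qed.

Lemma ball_linf P a x : ball_family P -> P a x -> linf a x.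
Proof. intros HP H j. apply (ball_point P HP); auto. Qed.

Lemma ball_nonneg P a x : ball_family P -> P a x -> 0 <= a.
Proof. intros HP H. eapply Rle_trans; [apply Cmod_ge_0|apply (ball_point P HP a x 0%Z H)]. Qed.

Lemma ball_lshift P k a x : ball_family P -> P a x -> P a (lshift k x).
Proof.
  intros HP H. revert k. apply Z.bi_induction.
  - intros ? ? ->. tauto.
  - apply (ball_dom P HP a _ x); auto. intros j. unfold lshift.
    replace (j - 0)%Z with j by lia. lra.
  - intros k. split; intros Hk.
    + apply (ball_dom P HP a _ (fun j => lshift k x (j - 1)%Z)); [|apply (ball_shift1 P HP); auto].
      intros j. unfold lshift. replace (j - Z.succ k)%Z with (j - 1 - k)%Z by lia. lra.
    + apply (ball_dom P HP a _ (fun j => lshift (Z.succ k) x (j + 1)%Z)); [|apply (ball_shift1' P HP); auto].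
      intros j. unfold lshift. replace (j + 1 - Z.succ k)%Z with (j - k)%Z by lia. lra.
Qed.

Lemma ball_sub P a b x y : ball_family P -> P a x -> P b y -> P (a + b) (lsub x y).
Proof.
  intros HP Hx Hy.
  replace (lsub x y) with (ladd x (lscal (-(1)) y)).
  - apply (ball_add P HP); auto.
    replace b with (Cmod (-(1)) * b) by (rewrite Cmod_m1; ring). apply (ball_scal P HP); auto.
  - unfold ladd, lsub, lscal. apply functional_extensionality. intros; ring.
Qed.


(** * Absolutely convergent two-sided series *)

(** [Series] is a total function, so [zsumR] is known to be a sum only once convergence is proved;
    here it follows by comparison with the bounded increasing partial sums of the absolute
    values. *)
Lemma abs_summable_wsum_lim a B :
  (forall n, wsum (fun j => Rabs (a j)) n <= B) -> is_lim_seq (wsum a) (zsumR a).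
Proof.
  intros H. apply is_lim_seq_incr_1.
  apply is_lim_seq_ext with (sum_n (zterms a)); [apply sum_n_zterms|].
  apply Series_correct.
  apply (@ex_series_le R_AbsRing R_CompleteNormedModule _ (zterms (fun j => Rabs (a j)))).
  - intros n. apply Rabs_triang.
  - destruct (ex_finite_lim_seq_incr (sum_n (zterms (fun j => Rabs (a j)))) B) as [l hl].
    + intros n. rewrite !sum_n_zterms. apply wsum_mono; [intros; apply Rabs_pos|lia].
    + intros n. rewrite sum_n_zterms. apply H.
    + exists l. exact hl.
Qed.

Lemma im_le_Cmod (c : C) : Rabs (Im c) <= Cmod c.
Proof. eapply Rle_trans; [apply Rmax_r|apply (Rmax_Cmod c)]. Qed.

Lemma l1_Cv B f : l1 B f -> Cv (csum f) (zsumC f).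
Proof.
  intros H. apply Cv_of_components.
  - apply is_lim_seq_ext with (wsum (fun j => Re (f j))).
    { intros n. rewrite csum_components. reflexivity. }
    apply abs_summable_wsum_lim with B. intros n. eapply Rle_trans; [|apply (H n)].
    apply wsum_le. intros. apply re_le_Cmod.
  - apply is_lim_seq_ext with (wsum (fun j => Im (f j))).
    { intros n. rewrite csum_components. reflexivity. }
    apply abs_summable_wsum_lim with B. intros n. eapply Rle_trans; [|apply (H n)].
    apply wsum_le. intros. apply im_le_Cmod.
Qed.

Lemma zsumC_eq B f l : l1 B f -> Cv (csum f) l -> zsumC f = l.
Proof. intros H Hl. eapply Cv_unique; eauto. eapply l1_Cv; eauto. Qed.

Definition in_win (n : nat) (j : Z) : bool := ((- Z.of_nat n <=? j) && (j <? Z.of_nat n))%Z%bool.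

Definition mask (p : Z -> bool) (x : lseq) : lseq := fun j => if p j then x j else 0%C.

Lemma in_win_true n j : in_win n j = true <-> (- Z.of_nat n <= j < Z.of_nat n)%Z.
Proof. unfold in_win. rewrite Bool.andb_true_iff, Z.leb_le, Z.ltb_lt. tauto. Qed.

Lemma in_win_false n j : in_win n j = false <-> (j < - Z.of_nat n \/ Z.of_nat n <= j)%Z.
Proof. unfold in_win. rewrite Bool.andb_false_iff, Z.leb_gt, Z.ltb_ge. tauto. Qed.

Lemma mask_ball P p a x : ball_family P -> P a x -> P a (mask p x).
Proof.
  intros HP. apply (ball_dom P HP). intros j. unfold mask.
  destruct (p j); [lra|]. rewrite Cmod_0. apply Cmod_ge_0.
Qed.

Lemma wsum_tail x n m : wsum (fun j => Cmod (lsub x (mask (in_win n) x) j)) m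
  <= Rmax 0 (wsum (fun j => Cmod (x j)) m - wsum (fun j => Cmod (x j)) n).
Proof.
  destruct (Nat.le_gt_cases m n) as [h|h].
  - eapply Rle_trans; [|apply Rmax_l].
    rewrite (wsum_ext _ (fun _ => 0 * 0)), wsum_scal; [lra|].
    intros j hj. unfold lsub, mask. rewrite (proj2 (in_win_true n j)) by lia.
    replace (x j - x j)%C with (RtoC 0) by ring. rewrite Cmod_0. ring.
  - eapply Rle_trans; [|apply Rmax_r].
    apply Nat.lt_le_incl in h. induction h.
    + rewrite (wsum_ext _ (fun _ => 0 * 0)), wsum_scal; [lra|].
      intros j hj. unfold lsub, mask. rewrite (proj2 (in_win_true n j)) by lia.
      replace (x j - x j)%C with (RtoC 0) by ring. rewrite Cmod_0. ring.
    + assert (K : forall j, (j < - Z.of_nat n \/ Z.of_nat n <= j)%Z ->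
        Cmod (lsub x (mask (in_win n) x) j) = Cmod (x j)).
      { intros j hj. unfold lsub, mask. rewrite (proj2 (in_win_false n j)) by lia.
        f_equal. ring. }
      simpl. rewrite !K by lia. lra.
Qed.

(** Density of Laurent polynomials in the Wiener algebra, the basis of the truncation arguments
    below. The partial sums increase to a limit, and the tail is what is missing from it. *)
Lemma l1_tail B x eps : l1 B x -> 0 < eps ->
  exists n, forall m, (n <= m)%nat -> l1 eps (lsub x (mask (in_win m) x)).
Proof.
  intros H he.
  assert (Hpos : forall j, 0 <= Cmod (x j)) by (intros; apply Cmod_ge_0).
  destruct (ex_finite_lim_seq_incr (wsum (fun j => Cmod (x j))) B) as [l hl].
  - intros n. apply wsum_mono; auto.
  - apply H.
  - assert (ub : forall n, wsum (fun j => Cmod (x j)) n <= l).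
    { intros n. apply (is_lim_seq_incr_compare _ _ hl). intros k. apply wsum_mono; auto. }
    apply is_lim_seq_spec in hl. destruct (hl (mkposreal eps he)) as [n hn]. simpl in hn.
    exists n. intros m hm k. eapply Rle_trans; [apply wsum_tail|].
    apply Rmax_lub; [lra|]. specialize (hn m hm). apply Rabs_def2 in hn.
    specialize (ub k). lra.
Qed.

Lemma l1_vanish B f eps : l1 B f -> 0 < eps ->
  exists n, forall j, (Z.of_nat n <= j \/ j < - Z.of_nat n)%Z -> Cmod (f j) <= eps.
Proof.
  intros H he. destruct (l1_tail B f eps H he) as [n hn]. exists n. intros j hj.
  specialize (hn n (le_n _)). pose proof (ball_point _ l1_ball _ _ j hn) as hp.
  unfold lsub, mask in hp. rewrite (proj2 (in_win_false n j)) in hp by lia.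
  replace (f j - 0)%C with (f j) in hp by ring. auto.
Qed.

(** A unit shift changes a window sum by two boundary terms, which tend to zero for a summable
    sequence. *)
Lemma zsumC_shift1 B f : l1 B f -> zsumC (fun k => f (k - 1)%Z) = zsumC f.
Proof.
  intros H. apply zsumC_eq with B; [apply (ball_shift1 _ l1_ball); auto|].
  apply Cv_ext with (fun n => csum f n + (f (- Z.of_nat n - 1)%Z - f (Z.of_nat n - 1)%Z))%C.
  { intros n. rewrite csum_shift1. ring. }
  replace (zsumC f) with (zsumC f + 0)%C by ring. apply Cv_plus; [eapply l1_Cv; eauto|].
  intros eps he. destruct (l1_vanish B f (eps/2) H) as [n hn]; [lra|].
  exists (S n). intros m hm.
  replace (f (- Z.of_nat m - 1)%Z - f (Z.of_nat m - 1)%Z - 0)%C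
    with (f (- Z.of_nat m - 1)%Z - f (Z.of_nat m - 1)%Z)%C by ring.
  eapply Rle_trans; [apply Cmod_sub_le|].
  pose proof (hn (- Z.of_nat m - 1)%Z ltac:(lia)). pose proof (hn (Z.of_nat m - 1)%Z ltac:(lia)). lra.
Qed.

Lemma zsumC_ext (f f' : Z -> C) : (forall k, f k = f' k) -> zsumC f = zsumC f'.
Proof. intros H. f_equal. apply functional_extensionality. auto. Qed.

Lemma zsumC_shift B f k : l1 B f -> zsumC (fun i => f (i - k)%Z) = zsumC f.
Proof.
  intros H. revert k. apply Z.bi_induction.
  - intros ? ? ->. tauto.
  - apply zsumC_ext. intros i. f_equal. lia.
  - intros k.
    assert (E : zsumC (fun i => f (i - Z.succ k)%Z) = zsumC (fun i => f (i - k)%Z)).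
    { rewrite <- (zsumC_shift1 B (fun i => f (i - k)%Z)); [|apply (ball_lshift _ k _ _ l1_ball H)].
      apply zsumC_ext. intros i. f_equal. lia. }
    rewrite E. tauto.
Qed.

Lemma l1_reflect B f : l1 B f -> l1 B (fun k => f (- k - 1)%Z).
Proof.
  intros H n. eapply Rle_trans; [|apply (H n)]. right.
  induction n; simpl; [auto|]. rewrite IHn.
  replace (- (- Z.of_nat n - 1) - 1)%Z with (Z.of_nat n) by lia. ring.
Qed.

(** The map [k -> j - k] is the reflection [k -> -k-1], which preserves every window sum exactly,
    composed with a shift by [j + 1]. *)
Lemma zsumC_flip B f j : l1 B f -> zsumC (fun k => f (j - k)%Z) = zsumC f.
Proof.
  intros H.
  rewrite <- (zsumC_eq B (fun k => f (- k - 1)%Z) (zsumC f)).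
  - rewrite <- (zsumC_shift B (fun k => f (- k - 1)%Z) (j + 1)); [|apply l1_reflect; auto].
    apply zsumC_ext. intros k. f_equal. lia.
  - apply l1_reflect; auto.
  - apply Cv_ext with (csum f); [intros; now rewrite csum_reflect|]. eapply l1_Cv; eauto.
Qed.

Lemma csum_stable (f : Z -> C) n m : (forall j, in_win n j = false -> f j = 0%C) ->
  (n <= m)%nat -> csum f m = csum f n.
Proof.
  intros H. induction 1; auto. simpl. rewrite IHle.
  rewrite !H by (apply in_win_false; lia). ring.
Qed.

Lemma l1_finite (f : Z -> C) n : (forall j, in_win n j = false -> f j = 0%C) ->
  l1 (wsum (fun j => Cmod (f j)) n) f.
Proof.
  intros H m. destruct (Nat.le_gt_cases m n).
  - apply wsum_mono; auto. intros; apply Cmod_ge_0.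
  - apply Nat.lt_le_incl in H0. induction H0; [lra|]. simpl.
    rewrite !H by (apply in_win_false; lia). rewrite Cmod_0. lra.
Qed.

Lemma zsumC_finite (f : Z -> C) n : (forall j, in_win n j = false -> f j = 0%C) ->
  zsumC f = csum f n.
Proof.
  intros H. eapply zsumC_eq; [apply l1_finite; eauto|].
  apply Cv_eventually with n. intros; apply csum_stable; auto.
Qed.

Lemma zsumC_single (f : Z -> C) j : (forall i, i <> j -> f i = 0%C) -> zsumC f = f j.
Proof.
  intros H. pose (n := S (Z.to_nat (Z.abs j))).
  rewrite (zsumC_finite f n).
  - apply csum_single; auto. lia.
  - intros i hi. apply H. apply in_win_false in hi. lia.
Qed.

(** * Convolution *)

Lemma conv_summand A B x y j : l1 A x -> linf B y ->
  l1 (A * B) (fun k => x k * y (j - k)%Z)%C.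
Proof.
  intros Hx Hy n. assert (hB := ball_nonneg _ _ _ linf_ball Hy).
  apply Rle_trans with (B * wsum (fun k => Cmod (x k)) n).
  - rewrite <- wsum_scal. apply wsum_le. intros k _. rewrite Cmod_mult, (Rmult_comm B).
    apply Rmult_le_compat_l; [apply Cmod_ge_0|apply Hy].
  - rewrite Rmult_comm. apply Rmult_le_compat_r; auto.
Qed.

(** Cutting off only the first factor leaves a finite linear combination of shifts of [y], to which
    the ball axioms apply directly. *)
Definition pconv (x y : lseq) (n : nat) : lseq := fun j => csum (fun k => x k * y (j - k)%Z)%C n.

Lemma pconv_Cv A B x y j : l1 A x -> linf B y ->
  Cv (fun n => pconv x y n j) (mult_op x y j).
Proof. intros Hx Hy. eapply l1_Cv. eapply conv_summand; eauto. Qed.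

Lemma pconv_S x y n : pconv x y (S n) =
  ladd (pconv x y n) (ladd (lscal (x (Z.of_nat n)) (lshift (Z.of_nat n) y))
    (lscal (x (- Z.of_nat n - 1)%Z) (lshift (- Z.of_nat n - 1) y))).
Proof. reflexivity. Qed.

Lemma pconv_ball P B x y n : ball_family P -> P B y ->
  P (wsum (fun j => Cmod (x j)) n * B) (pconv x y n).
Proof.
  intros HP Hy. induction n.
  - simpl. rewrite Rmult_0_l. apply (ball_zero P HP).
  - rewrite pconv_S. simpl. rewrite !Rmult_plus_distr_r.
    apply (ball_add P HP); auto.
    apply (ball_add P HP); apply (ball_scal P HP); apply ball_lshift; auto.
Qed.

(** Young's inequality: the partial convolutions are combinations of shifts of [y] with coefficients
    of total size at most [A], and [ball_lim] passes to the limit. *)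
Lemma conv_ball P A B x y : ball_family P -> l1 A x -> P B y -> P (A * B) (mult_op x y).
Proof.
  intros HP Hx Hy. assert (hB := ball_nonneg _ _ _ HP Hy).
  apply (ball_lim P HP _ (fun n => pconv x y n)).
  - intros n. apply (ball_weaken P HP) with (wsum (fun j => Cmod (x j)) n * B); [|apply pconv_ball; auto].
    apply Rmult_le_compat_r; auto.
  - intros j. apply pconv_Cv with A B; auto. eapply ball_linf; eauto.
Qed.

Lemma conv_comm A B x y : l1 A x -> linf B y -> mult_op y x = mult_op x y.
Proof.
  intros Hx Hy. apply functional_extensionality. intros j. unfold mult_op.
  rewrite <- (zsumC_flip (A * B) (fun k => x k * y (j - k)%Z)%C j); [|apply conv_summand; auto].
  apply zsumC_ext. intros k. replace (j - (j - k))%Z with k by lia. ring.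
Qed.

Lemma conv_add_r A B D x y z : l1 A x -> linf B y -> linf D z ->
  mult_op x (ladd y z) = ladd (mult_op x y) (mult_op x z).
Proof.
  intros Hx Hy Hz. apply functional_extensionality. intros j.
  apply Cv_unique with (fun n => pconv x (ladd y z) n j).
  - apply pconv_Cv with A (B + D); auto. apply (ball_add _ linf_ball); auto.
  - apply Cv_ext with (fun n => pconv x y n j + pconv x z n j)%C.
    + intros n. unfold pconv. rewrite <- csum_plus. apply csum_ext. intros; unfold ladd; ring.
    + apply Cv_plus; eapply pconv_Cv; eauto.
Qed.

Lemma conv_scal_r A B c x y : l1 A x -> linf B y ->
  mult_op x (lscal c y) = lscal c (mult_op x y).
Proof.
  intros Hx Hy. apply functional_extensionality. intros j.
  apply Cv_unique with (fun n => pconv x (lscal c y) n j).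
  - apply pconv_Cv with A (Cmod c * B); auto. apply (ball_scal _ linf_ball); auto.
  - apply Cv_ext with (fun n => c * pconv x y n j)%C.
    + intros n. unfold pconv. rewrite <- csum_scal. apply csum_ext. intros; unfold lscal; ring.
    + apply Cv_scale; eapply pconv_Cv; eauto.
Qed.

Lemma conv_add_l A B D x y z : l1 A x -> l1 B y -> linf D z ->
  mult_op (ladd x y) z = ladd (mult_op x z) (mult_op y z).
Proof.
  intros Hx Hy Hz. apply functional_extensionality. intros j.
  apply Cv_unique with (fun n => pconv (ladd x y) z n j).
  - apply pconv_Cv with (A + B) D; auto. apply (ball_add _ l1_ball); auto.
  - apply Cv_ext with (fun n => pconv x z n j + pconv y z n j)%C.
    + intros n. unfold pconv. rewrite <- csum_plus. apply csum_ext. intros; unfold ladd; ring.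
    + apply Cv_plus; eapply pconv_Cv; eauto.
Qed.

Lemma conv_scal_l A B c x y : l1 A x -> linf B y ->
  mult_op (lscal c x) y = lscal c (mult_op x y).
Proof.
  intros Hx Hy. apply functional_extensionality. intros j.
  apply Cv_unique with (fun n => pconv (lscal c x) y n j).
  - apply pconv_Cv with (Cmod c * A) B; auto. apply (ball_scal _ l1_ball); auto.
  - apply Cv_ext with (fun n => c * pconv x y n j)%C.
    + intros n. unfold pconv. rewrite <- csum_scal. apply csum_ext. intros; unfold lscal; ring.
    + apply Cv_scale; eapply pconv_Cv; eauto.
Qed.

Lemma lsub_ladd x y : lsub x y = ladd x (lscal (-(1)) y).
Proof. apply functional_extensionality. intros j. unfold lsub, ladd, lscal. ring. Qed.

Lemma conv_sub_r A B D x y z : l1 A x -> linf B y -> linf D z ->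
  mult_op x (lsub y z) = lsub (mult_op x y) (mult_op x z).
Proof.
  intros Hx Hy Hz. rewrite !lsub_ladd, (conv_add_r A B (Cmod (-(1)) * D)), (conv_scal_r A D); auto.
  apply (ball_scal _ linf_ball); auto.
Qed.

Lemma conv_sub_l A B D x y z : l1 A x -> l1 B y -> linf D z ->
  mult_op (lsub x y) z = lsub (mult_op x z) (mult_op y z).
Proof.
  intros Hx Hy Hz. rewrite !lsub_ladd, (conv_add_l A (Cmod (-(1)) * B) D), (conv_scal_l B D); auto.
  apply (ball_scal _ l1_ball); auto.
Qed.

Lemma conv_shift_r k x y : mult_op x (lshift k y) = lshift k (mult_op x y).
Proof.
  apply functional_extensionality. intros j. unfold mult_op, lshift. apply zsumC_ext.
  intros i. f_equal. f_equal. lia.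
Qed.

Lemma conv_shift_l A B k x y : l1 A x -> linf B y ->
  mult_op (lshift k x) y = lshift k (mult_op x y).
Proof.
  intros Hx Hy. apply functional_extensionality. intros j. unfold mult_op, lshift.
  rewrite <- (zsumC_shift (A * B) (fun i => x i * y (j - k - i)%Z)%C k); [|apply conv_summand; auto].
  apply zsumC_ext. intros i. do 2 f_equal. lia.
Qed.

Lemma conv_delta_l y : mult_op delta0 y = y.
Proof.
  apply functional_extensionality. intros j. unfold mult_op.
  rewrite (zsumC_single _ 0%Z).
  - unfold delta0. simpl. replace (j - 0)%Z with j by lia. ring.
  - intros i hi. unfold delta0. rewrite (proj2 (Z.eqb_neq i 0)) by auto. ring.
Qed.

Lemma l1_delta0 : l1 1 delta0.
Proof.
  apply (ball_weaken _ l1_ball (wsum (fun j => Cmod (delta0 j)) 1)).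
  - simpl. unfold delta0. simpl. rewrite Cmod_0, Cmod_1. lra.
  - apply l1_finite. intros j hj. apply in_win_false in hj. unfold delta0.
    rewrite (proj2 (Z.eqb_neq j 0)) by lia. auto.
Qed.

Lemma conv_mask_win x y n : mult_op (mask (in_win n) x) y = pconv x y n.
Proof.
  apply functional_extensionality. intros j. unfold mult_op, pconv.
  rewrite (zsumC_finite _ n).
  - apply csum_ext. intros k hk. unfold mask. rewrite (proj2 (in_win_true n k)) by auto. auto.
  - intros k hk. unfold mask. rewrite hk. ring.
Qed.

Lemma conv_pconv_assoc A B D x y z n : l1 A x -> l1 B y -> linf D z ->
  mult_op (pconv x y n) z = pconv x (mult_op y z) n.
Proof.
  intros Hx Hy Hz. induction n.
  - apply functional_extensionality. intros j. unfold pconv. simpl. unfold mult_op.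
    rewrite (zsumC_finite _ 0); [auto|]. intros; ring.
  - rewrite !pconv_S.
    assert (Hs : forall k, l1 B (lshift k y)) by (intros; apply ball_lshift; auto using l1_ball).
    rewrite (conv_add_l (wsum (fun j => Cmod (x j)) n * B) (Cmod (x (Z.of_nat n)) * B
       + Cmod (x (- Z.of_nat n - 1)%Z) * B) D); auto.
    + rewrite (conv_add_l (Cmod (x (Z.of_nat n)) * B) (Cmod (x (- Z.of_nat n - 1)%Z) * B) D);
        auto; try (apply (ball_scal _ l1_ball); auto).
      rewrite !(conv_scal_l B D), !(conv_shift_l B D), IHn; auto.
    + apply pconv_ball; auto using l1_ball.
    + apply (ball_add _ l1_ball); apply (ball_scal _ l1_ball); auto.
Qed.

(* Truncating [x] reduces associativity to the covariance of convolution under shifts. *)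
Lemma conv_assoc A B D x y z : l1 A x -> l1 B y -> linf D z ->
  mult_op (mult_op x y) z = mult_op x (mult_op y z).
Proof.
  intros Hx Hy Hz. apply functional_extensionality. intros j.
  assert (Hyz : linf (B * D) (mult_op y z)) by (eapply conv_ball; eauto using linf_ball).
  apply Cv_unique with (fun n => mult_op (pconv x y n) z j).
  - assert (hB := ball_nonneg _ _ _ l1_ball Hy). assert (hD := ball_nonneg _ _ _ linf_ball Hz).
    intros eps he.
    destruct (l1_tail A x (eps / (B * D + 1)) Hx) as [n0 h].
    { apply Rdiv_lt_0_compat; nra. }
    exists n0. intros n hn. specialize (h n hn). rewrite <- conv_mask_win, Cmod_sub_sym.
    assert (Hm : l1 A (mask (in_win n) x)) by (apply mask_ball; auto using l1_ball).
    assert (H1 : l1 (eps / (B * D + 1) * B) (lsub (mult_op x y) (mult_op (mask (in_win n) x) y))).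
    { rewrite <- (conv_sub_l A A B); auto using (ball_linf _ _ _ l1_ball Hy).
      apply conv_ball; auto using l1_ball. }
    assert (H2 : linf (eps / (B * D + 1) * B * D)
       (lsub (mult_op (mult_op x y) z) (mult_op (mult_op (mask (in_win n) x) y) z))).
    { assert (Hl : forall w, l1 A w -> l1 (A * B) (mult_op w y))
        by (intros; apply conv_ball; auto using l1_ball).
      rewrite <- (conv_sub_l (A * B) (A * B) D); auto.
      apply conv_ball; auto using linf_ball. }
    eapply Rle_trans; [apply H2|].
    replace eps with (eps / (B * D + 1) * (B * D + 1)) at 2 by (field; nra).
    rewrite Rmult_assoc. apply Rmult_le_compat_l; [|lra].
    apply Rlt_le, Rdiv_lt_0_compat; nra.
  - apply Cv_ext with (fun n => pconv x (mult_op y z) n j).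
    + intros n. rewrite (conv_pconv_assoc A B D); auto.
    + apply pconv_Cv with A (B * D); auto.
Qed.

(** Convolution by a summable sequence respects bounded pointwise convergence: a finite part of [x]
    converges term by term, and the tail acts on differences bounded by [2 B]. This is how the
    equation satisfied by a weak limit is obtained. *)
Lemma conv_Cv_pointwise A B x (y : nat -> lseq) z j :
  l1 A x -> (forall n, linf B (y n)) -> (forall i, Cv (fun n => y n i) (z i)) ->
  Cv (fun n => mult_op x (y n) j) (mult_op x z j).
Proof.
  intros Hx Hy L.
  assert (Hz : linf B z) by (apply (ball_lim _ linf_ball _ y); auto).
  assert (hB := ball_nonneg _ _ _ linf_ball Hz).
  intros eps he.
  destruct (l1_tail A x (eps / 2 / (B + B + 1)) Hx) as [m h].
  { apply Rdiv_lt_0_compat; lra. }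
  specialize (h m (le_n _)).
  assert (F : Cv (fun n => pconv x (lsub (y n) z) m j) 0).
  { clear h. unfold pconv. induction m; simpl; [apply Cv_const|].
    replace (RtoC 0) with (0 + (0 + 0))%C by ring.
    assert (K : forall k, Cv (fun n => x k * lsub (y n) z (j - k)%Z)%C 0).
    { intros k. replace (RtoC 0) with (x k * (z (j - k)%Z - z (j-k)%Z))%C by ring.
      apply Cv_scale. unfold lsub. apply Cv_minus; [apply L|apply Cv_const]. }
    apply Cv_plus; auto. apply Cv_plus; auto. }
  destruct (F (eps/2)) as [n0 hn]; [lra|]. exists n0. intros n hn0. specialize (hn n hn0).
  assert (Hd : linf (B + B) (lsub (y n) z)) by (apply ball_sub; auto using linf_ball).
  replace (mult_op x (y n) j - mult_op x z j)%C with (mult_op x (lsub (y n) z) j)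
    by (rewrite (conv_sub_r A B B); auto).
  assert (T : Cmod (mult_op (lsub x (mask (in_win m) x)) (lsub (y n) z) j) <= eps / 2 / (B + B + 1) * (B + B)).
  { apply (conv_ball _ _ _ _ _ linf_ball h Hd). }
  rewrite (conv_sub_l A A (B + B)) in T; auto; [|apply mask_ball; auto using l1_ball].
  rewrite conv_mask_win in T. unfold lsub at 1 in T.
  replace (pconv x (lsub (y n) z) m j - 0)%C with (pconv x (lsub (y n) z) m j) in hn by ring.
  assert (eps / 2 / (B + B + 1) * (B + B) <= eps / 2).
  { replace (eps / 2) with (eps / 2 / (B + B + 1) * (B + B + 1)) at 2 by (field; lra).
    apply Rmult_le_compat_l; [|lra]. apply Rlt_le, Rdiv_lt_0_compat; lra. }
  eapply Rle_trans; [apply (Cmod_le_sub _ (pconv x (lsub (y n) z) m j))|]. lra.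
Qed.


(** * Fourier multipliers *)

Definition cis (x : R) : C := (cos x, sin x).

Lemma cis_0 : cis 0 = 1%C.
Proof. unfold cis. rewrite cos_0, sin_0. reflexivity. Qed.

Lemma cis_plus x y : cis (x + y) = (cis x * cis y)%C.
Proof.
  unfold cis, Cmult. simpl. rewrite cos_plus, sin_plus. f_equal; ring.
Qed.

Lemma cis_conj x : Cconj (cis x) = cis (- x).
Proof. unfold cis, Cconj. simpl. rewrite cos_neg, sin_neg. reflexivity. Qed.

Lemma Cmod_cis x : Cmod (cis x) = 1.
Proof.
  unfold Cmod, cis, fst, snd. rewrite <- sqrt_1. f_equal.
  pose proof (sin2_cos2 x). unfold Rsqr in H. nra.
Qed.

Lemma cis_2PI_mult (j : nat) : cis (INR j * (2 * PI)) = 1%C.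
Proof.
  induction j; [simpl; rewrite Rmult_0_l; apply cis_0|].
  rewrite S_INR, Rmult_plus_distr_r, cis_plus, IHj, Rmult_1_l.
  unfold cis. rewrite cos_2PI, sin_2PI. change (1, 0) with (RtoC 1). ring.
Qed.

Lemma cis_neq1 x : 0 < Rabs x < 2 * PI -> cis x <> 1%C.
Proof.
  intros h E. assert (Ec : cos (Rabs x) = 1).
  { assert (cos x = 1) by (apply (f_equal fst) in E; exact E).
    unfold Rabs. destruct (Rcase_abs x); [rewrite cos_neg|]; auto. }
  replace (Rabs x) with (2 * (Rabs x / 2)) in Ec by field.
  rewrite cos_2a_sin in Ec. assert (0 < sin (Rabs x / 2)) by (apply sin_gt_0; lra).
  nra.
Qed.

Fixpoint nsum (f : nat -> C) (n : nat) : C :=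
  match n with O => 0%C | S k => (nsum f k + f k)%C end.

Lemma nsum_ext f f' n : (forall l, (l < n)%nat -> f l = f' l) -> nsum f n = nsum f' n.
Proof. intros H. induction n; simpl; auto. rewrite IHn, H; auto. Qed.

Lemma nsum_scal c f n : nsum (fun l => c * f l)%C n = (c * nsum f n)%C.
Proof. induction n; simpl; [ring|]. rewrite IHn. ring. Qed.

Lemma nsum_plus f g n : nsum (fun l => f l + g l)%C n = (nsum f n + nsum g n)%C.
Proof. induction n; simpl; [ring|]. rewrite IHn. ring. Qed.

Lemma nsum_csum (f : nat -> Z -> C) n m :
  nsum (fun l => csum (f l) m) n = csum (fun j => nsum (fun l => f l j) n) m.
Proof.
  induction m; simpl.
  - induction n; simpl; auto. rewrite IHn. ring.
  - rewrite nsum_plus, IHm, nsum_plus. reflexivity.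
Qed.

Lemma nsum_const c n : nsum (fun _ => c) n = (RtoC (INR n) * c)%C.
Proof.
  induction n; [simpl; ring|]. simpl nsum. rewrite IHn, S_INR, RtoC_plus. ring.
Qed.

Lemma nsum_geom z n : ((z - 1) * nsum (fun l => z ^ l) n = z ^ n - 1)%C.
Proof.
  induction n; simpl; [ring|]. rewrite Cmult_plus_distr_l, IHn. ring.
Qed.

Lemma cis_pow x n : (cis x ^ n)%C = cis (INR n * x).
Proof.
  induction n; [simpl; rewrite Rmult_0_l, cis_0; auto|].
  rewrite S_INR, Rmult_plus_distr_r, cis_plus, <- IHn, Rmult_1_l. simpl. ring.
Qed.

Definition node (M l : nat) : R := 2 * PI * INR l / INR M.

(** Orthogonality of characters, as a geometric sum with ratio an [M]-th root of unity. The bound on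
    [j] excludes aliasing: it makes the ratio different from 1 unless [j = 0]. *)
Lemma nsum_cis_node M j : (0 < M)%nat -> (Z.abs j < Z.of_nat M)%Z ->
  nsum (fun l => cis (IZR j * node M l)) M = if (j =? 0)%Z then RtoC (INR M) else 0%C.
Proof.
  intros hM hj. assert (hM' : 0 < INR M) by (apply lt_0_INR; auto).
  destruct (Z.eqb_spec j 0) as [->|hj0].
  - rewrite (nsum_ext _ (fun _ => 1%C)), nsum_const; [ring|].
    intros. rewrite Rmult_0_l. apply cis_0.
  - pose (z := cis (IZR j * (2 * PI) / INR M)).
    rewrite (nsum_ext _ (fun l => z ^ l)%C).
    2:{ intros l _. unfold z. rewrite cis_pow. f_equal. unfold node. field. lra. }
    assert (hz : z <> 1%C).
    { apply cis_neq1. unfold Rdiv. rewrite !Rabs_mult, (Rabs_right (/ INR M)), <- abs_IZR.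
      2:{ left. now apply Rinv_0_lt_compat. }
      pose proof PI_RGT_0. rewrite (Rabs_right 2), (Rabs_right PI) by lra.
      assert (0 < IZR (Z.abs j)) by (apply IZR_lt; lia).
      assert (IZR (Z.abs j) < INR M) by (rewrite INR_IZR_INZ; apply IZR_lt; lia).
      split.
      - apply Rmult_lt_0_compat; [nra|now apply Rinv_0_lt_compat].
      - apply Rmult_lt_reg_r with (INR M); auto.
        rewrite Rmult_assoc, Rinv_l by lra. nra. }
    assert (hzM : (z ^ M = 1)%C).
    { unfold z. rewrite cis_pow.
      replace (INR M * (IZR j * (2 * PI) / INR M)) with (IZR j * (2 * PI)) by (field; lra).
      destruct (Z.abs_eq_or_opp j) as [E|E].
      - rewrite <- E, <- (Z2Nat.id (Z.abs j)), <- INR_IZR_INZ by lia. apply cis_2PI_mult.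
      - replace j with (- Z.abs j)%Z by lia. rewrite opp_IZR, Ropp_mult_distr_l_reverse, <- cis_conj.
        rewrite <- (Z2Nat.id (Z.abs j)), <- INR_IZR_INZ by lia. rewrite cis_2PI_mult.
        unfold Cconj, RtoC. simpl. f_equal. ring. }
    pose proof (nsum_geom z M) as G. rewrite hzM in G.
    assert (hz' : (z - 1)%C <> 0%C).
    { intros E. apply hz. replace z with (z - 1 + 1)%C by ring. rewrite E. ring. }
    replace (nsum (fun l => z ^ l)%C M) with (/ (z - 1) * ((z - 1) * nsum (fun l => z ^ l) M))%C
      by (field; auto).
    rewrite G. ring.
Qed.

Lemma csum_conj f n : Cconj (csum f n) = csum (fun j => Cconj (f j)) n.
Proof.
  induction n; simpl.
  - unfold Cconj, RtoC. simpl. f_equal. ring.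
  - rewrite <- IHn. unfold Cconj, Cplus. simpl. f_equal; ring.
Qed.

Lemma csum_RtoC f n : csum (fun j => RtoC (f j)) n = RtoC (wsum f n).
Proof. induction n; simpl; auto. rewrite IHn, !RtoC_plus. reflexivity. Qed.

Lemma csum_mul_r f c n : (csum f n * c = csum (fun j => f j * c) n)%C.
Proof. rewrite Cmult_comm, <- csum_scal. apply csum_ext. intros; ring. Qed.

Lemma Cconj_mult a b : Cconj (a * b) = (Cconj a * Cconj b)%C.
Proof. unfold Cconj, Cmult. simpl. f_equal; ring. Qed.

Definition tpoly (y : lseq) (n : nat) (theta : R) : C :=
  csum (fun j => y j * cis (IZR j * theta))%C n.

(** For a Laurent polynomial the integral over the circle is replaced by equispaced nodes. Two
    indices of [[-n, n)] differ by less than [2 n], so [2 n] nodes separate all the exponentials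
    that occur in [|y|^2]. *)
Lemma parseval y n : (0 < n)%nat ->
  nsum (fun l => RtoC ((Cmod (tpoly y n (node (2 * n) l)))^2)) (2 * n)
  = RtoC (INR (2 * n) * wsum (fun j => (Cmod (y j))^2) n).
Proof.
  intros hn.
  rewrite (nsum_ext _ (fun l => csum (fun j => csum (fun k =>
      y j * Cconj (y k) * cis (IZR (j - k) * node (2 * n) l)) n) n))%C.
  2:{ intros l _. rewrite Cmod2_conj. unfold tpoly at 1. rewrite csum_mul_r. apply csum_ext. intros j _.
      unfold tpoly. rewrite csum_conj, <- csum_scal. apply csum_ext. intros k _.
      rewrite Cconj_mult, cis_conj, minus_IZR.
      replace ((IZR j - IZR k) * node (2 * n) l)
        with (IZR j * node (2 * n) l + - (IZR k * node (2 * n) l)) by ring.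
      rewrite cis_plus. ring. }
  rewrite nsum_csum, RtoC_mult, <- csum_RtoC, <- csum_scal. apply csum_ext. intros j hj.
  rewrite nsum_csum, (csum_single _ j n hj).
  - rewrite nsum_scal, nsum_cis_node by lia. rewrite Z.sub_diag. simpl Z.eqb. cbv iota.
    rewrite Cmod2_conj. ring.
  - intros k hk hkj. rewrite nsum_scal, nsum_cis_node by lia.
    rewrite (proj2 (Z.eqb_neq (j - k) 0)) by lia. ring.
Qed.

Lemma zsumC_scal B c f : l1 B f -> zsumC (fun k => c * f k)%C = (c * zsumC f)%C.
Proof.
  intros H. apply zsumC_eq with (Cmod c * B); [apply (ball_scal _ l1_ball _ _ _ H)|].
  apply Cv_ext with (fun n => c * csum f n)%C; [intros; now rewrite csum_scal|].
  apply Cv_scale. eapply l1_Cv; eauto.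
Qed.

(** The coefficients of a point mass at angle [theta], up to a factor. This bounded sequence is an
    eigenvector of every convolution, and the eigenvalue is the value of the symbol at [theta]. *)
Definition chi (theta : R) : lseq := fun j => cis (- (IZR j * theta)).

Lemma linf_chi theta : linf 1 (chi theta).
Proof. intros j. unfold chi. rewrite Cmod_cis. lra. Qed.

Lemma circ_val_summand A x theta : l1 A x -> l1 A (fun j => x j * cis (IZR j * theta))%C.
Proof. apply (ball_dom _ l1_ball). intros j. rewrite Cmod_mult, Cmod_cis. lra. Qed.

Lemma conv_chi A x theta : l1 A x -> mult_op x (chi theta) = lscal (circ_val x theta) (chi theta).
Proof.
  intros H. apply functional_extensionality. intros j. unfold mult_op, lscal.
  rewrite Cmult_comm. unfold circ_val.
  rewrite <- (zsumC_scal A _ _ (circ_val_summand A x theta H)).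
  apply zsumC_ext. intros k. unfold chi. change (cos (IZR k * theta), sin (IZR k * theta)) with (cis (IZR k * theta)).
  rewrite minus_IZR. replace (- ((IZR j - IZR k) * theta)) with (- (IZR j * theta) + IZR k * theta) by ring.
  rewrite cis_plus. ring.
Qed.

(** Multiplicativity of evaluation is associativity applied to the common eigenvector [chi theta],
    read at index 0. *)
Lemma circ_val_conv A B x y theta : l1 A x -> l1 B y ->
  circ_val (mult_op x y) theta = (circ_val x theta * circ_val y theta)%C.
Proof.
  intros Hx Hy.
  assert (Hxy : l1 (A * B) (mult_op x y)) by (apply conv_ball; auto using l1_ball).
  pose proof (conv_assoc A B 1 x y (chi theta) Hx Hy (linf_chi theta)) as E.
  rewrite (conv_chi _ _ _ Hxy), (conv_chi _ _ _ Hy) in E.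
  rewrite (conv_scal_r A 1), (conv_chi _ _ _ Hx) in E; auto using linf_chi.
  apply (f_equal (fun f => f 0%Z)) in E. unfold lscal, chi in E.
  rewrite Rmult_0_l, Ropp_0, cis_0 in E.
  rewrite !Cmult_1_r in E. rewrite E. ring.
Qed.

Lemma circ_val_le A x theta : l1 A x -> Cmod (circ_val x theta) <= A.
Proof.
  intros H. apply (circ_val_summand A x theta) in H.
  apply (Cv_Cmod_le _ _ A (l1_Cv A _ H)).
  intros n. eapply Rle_trans; [apply Cmod_csum_le|apply H].
Qed.

Lemma circ_val_sub A B x y theta : l1 A x -> l1 B y ->
  circ_val (lsub x y) theta = (circ_val x theta - circ_val y theta)%C.
Proof.
  intros Hx Hy. apply zsumC_eq with (A + B).
  - apply circ_val_summand, ball_sub; auto using l1_ball.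
  - apply Cv_ext with (fun n => tpoly x n theta - tpoly y n theta)%C.
    + intros n. unfold tpoly, lsub. induction n; simpl; [ring|].
      rewrite <- IHn. unfold cis. ring.
    + apply Cv_minus; eapply l1_Cv; apply circ_val_summand; eauto.
Qed.

Lemma circ_val_finite (x : lseq) n theta : (forall j, in_win n j = false -> x j = 0%C) ->
  circ_val x theta = tpoly x n theta.
Proof. intros H. apply zsumC_finite. intros j hj. rewrite H by auto. ring. Qed.

Lemma nsum_RtoC_le (f g : nat -> R) n : (forall l, f l <= g l) ->
  Re (nsum (fun l => RtoC (f l)) n) <= Re (nsum (fun l => RtoC (g l)) n).
Proof.
  intros H. induction n; [simpl; lra|].
  change (Re (nsum (fun l => RtoC (f l)) n) + f n <= Re (nsum (fun l => RtoC (g l)) n) + g n).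
  specialize (H n). lra.
Qed.

Lemma conv_finite_support m n (r x : lseq) :
  (forall j, in_win m j = false -> r j = 0%C) -> (forall j, in_win n j = false -> x j = 0%C) ->
  forall j, in_win (m + n) j = false -> mult_op r x j = 0%C.
Proof.
  intros Hr Hx j hj. unfold mult_op. rewrite (zsumC_finite _ 0); [reflexivity|].
  intros k _. destruct (in_win m k) eqn:E1; [|rewrite Hr by auto; ring].
  destruct (in_win n (j - k)) eqn:E2; [|rewrite Hx by auto; ring].
  apply in_win_true in E1, E2. apply in_win_false in hj. lia.
Qed.

(** The window of size [m + n] contains the supports of both [x] and [r x], so Parseval holds for
    both on the same nodes, and there the product is bounded pointwise. *)
Lemma multiplier_bound_finite rho m n (r x : lseq) :
  (forall j, in_win m j = false -> r j = 0%C) -> (forall j, in_win n j = false -> x j = 0%C) ->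
  (forall theta, Cmod (circ_val r theta) <= rho) ->
  wsum (fun j => (Cmod (mult_op r x j))^2) (m + n) <= rho^2 * wsum (fun j => (Cmod (x j))^2) (m + n).
Proof.
  intros Hr Hx Hrho.
  destruct (Nat.eq_dec (m + n) 0) as [h|h].
  { rewrite h. simpl. lra. }
  assert (Hx' : forall j, in_win (m + n) j = false -> x j = 0%C).
  { intros j hj. apply Hx. apply in_win_false in hj. apply in_win_false. lia. }
  assert (Hc := conv_finite_support m n r x Hr Hx).
  pose proof (parseval x (m + n) ltac:(lia)) as Px.
  pose proof (parseval (mult_op r x) (m + n) ltac:(lia)) as Py.
  assert (hM : 0 < INR (2 * (m + n))) by (apply lt_0_INR; lia).
  apply (f_equal Re) in Px, Py.
  rewrite re_RtoC in Px, Py.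
  apply Rmult_le_reg_l with (INR (2 * (m + n))); auto.
  rewrite <- Py.
  replace (INR (2 * (m + n)) * (rho ^ 2 * wsum (fun j => Cmod (x j) ^ 2) (m + n)))
    with (rho^2 * (INR (2 * (m + n)) * wsum (fun j => Cmod (x j) ^ 2) (m + n))) by ring.
  rewrite <- Px.
  eapply Rle_trans; [apply nsum_RtoC_le with
    (g := fun l => rho^2 * (Cmod (tpoly x (m + n) (node (2 * (m + n)) l)))^2)|].
  - intros l. rewrite <- (circ_val_finite (mult_op r x)), <- (circ_val_finite x) by auto.
    rewrite (circ_val_conv (wsum (fun j => Cmod (r j)) m) (wsum (fun j => Cmod (x j)) n))
      by (apply l1_finite; auto).
    rewrite Cmod_mult, Rpow_mult_distr. apply Rmult_le_compat_r; [apply pow2_ge_0|].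
    apply pow_incr. split; [apply Cmod_ge_0|auto].
  - right. rewrite (nsum_ext _ (fun l => RtoC (rho^2) *
      RtoC ((Cmod (tpoly x (m + n) (node (2 * (m + n)) l)))^2))%C), nsum_scal.
    + unfold RtoC at 1, Re, Cmult, fst, snd. ring.
    + intros. now rewrite RtoC_mult.
Qed.

Lemma mask_win_Cv x j : Cv (fun n => mask (in_win n) x j) (x j).
Proof.
  apply Cv_eventually with (S (Z.to_nat (Z.abs j))). intros n hn. unfold mask.
  rewrite (proj2 (in_win_true n j)) by lia. auto.
Qed.

Lemma mask_win_finite x n j : in_win n j = false -> mask (in_win n) x j = 0%C.
Proof. intros h. unfold mask. now rewrite h. Qed.

Lemma multiplier_bound_finite_l rho B m (r x : lseq) : 0 <= rho ->
  (forall j, in_win m j = false -> r j = 0%C) ->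
  (forall theta, Cmod (circ_val r theta) <= rho) ->
  l2 B x -> l2 (rho * B) (mult_op r x).
Proof.
  intros hrho Hr Hrho Hx. assert (hB := ball_nonneg _ _ _ l2_ball Hx).
  apply (ball_lim _ l2_ball _ (fun n => mult_op r (mask (in_win n) x))).
  - intros n. split; [nra|]. intros k.
    (* The finite bound is available only on a window that holds the support of the product; a
       partial sum of any length [k] is first enlarged to such a window. *)
    apply Rle_trans with (wsum (fun j => (Cmod (mult_op r (mask (in_win n) x) j))^2) (m + (n + k))).
    { apply wsum_mono; [intros; apply pow2_ge_0|lia]. }
    assert (F : forall j, in_win (n + k) j = false -> mask (in_win n) x j = 0%C).
    { intros j hj. apply mask_win_finite. apply in_win_false in hj. apply in_win_false. lia. }
    eapply Rle_trans; [apply (multiplier_bound_finite rho m (n + k)); auto|].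
    rewrite Rpow_mult_distr. apply Rmult_le_compat_l; [apply pow2_ge_0|].
    apply (proj2 (mask_ball l2 (in_win n) B x l2_ball Hx)).
  - intros j. eapply conv_Cv_pointwise.
    + apply l1_finite; eauto.
    + intros n. eapply ball_linf; [apply l2_ball|]. apply mask_ball; [apply l2_ball|apply Hx].
    + apply mask_win_Cv.
Qed.

Lemma is_lim_seq_inv_INR_plus1 : is_lim_seq (fun k => / (INR k + 1)) 0.
Proof.
  apply (is_lim_seq_ext (fun k => / INR (S k))).
  - intros k. now rewrite S_INR.
  - apply (is_lim_seq_incr_1 (fun k => / INR k)).
    apply (is_lim_seq_inv INR p_infty); [apply is_lim_seq_INR|discriminate].
Qed.

Lemma l2_le_of_eps B x : (forall eps, 0 < eps -> l2 (B + eps) x) -> 0 <= B -> l2 B x.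
Proof.
  intros H hB. split; auto. intros n.
  apply (is_lim_seq_le (fun _ => wsum (fun j => (Cmod (x j))^2) n)
    (fun k => (B + / (INR k + 1)) * (B + / (INR k + 1))) (wsum (fun j => (Cmod (x j))^2) n) (B^2)).
  - intros k. assert (h : 0 < / (INR k + 1)) by (apply Rinv_0_lt_compat; pose proof (pos_INR k); lra).
    replace ((B + / (INR k + 1)) * (B + / (INR k + 1))) with ((B + / (INR k + 1))^2) by ring.
    apply (proj2 (H _ h)).
  - apply is_lim_seq_const.
  - replace (B^2) with ((B + 0) * (B + 0)) by ring.
    assert (L : is_lim_seq (fun k => B + / (INR k + 1)) (B + 0)).
    { apply is_lim_seq_plus'; [apply is_lim_seq_const|].
      apply is_lim_seq_inv_INR_plus1. }
    apply is_lim_seq_mult'; auto.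
Qed.

(** Compared with Young's inequality, the sup norm of the symbol replaces the [l1] norm of the
    coefficients. Only this sharper bound makes powers of a symbol with sup norm below 1 decay. *)
Lemma multiplier_bound A B rho r x : l1 A r ->
  (forall theta, Cmod (circ_val r theta) <= rho) ->
  l2 B x -> l2 (rho * B) (mult_op r x).
Proof.
  intros Hr Hrho Hx. assert (hB := ball_nonneg _ _ _ l2_ball Hx).
  assert (h0 : 0 <= rho) by (eapply Rle_trans; [apply Cmod_ge_0|apply (Hrho 0)]).
  apply l2_le_of_eps; [|nra]. intros eps he.
  (* Truncating [r] costs [d] twice: once in the sup norm of the truncated symbol, once for the
     discarded tail, estimated by Young's inequality. *)
  pose (d := eps / (2 * B + 1)). assert (hd : 0 < d) by (apply Rdiv_lt_0_compat; lra).
  destruct (l1_tail A r d Hr hd) as [m h]. specialize (h m (le_n _)).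
  assert (Hm : l1 A (mask (in_win m) r)) by (apply mask_ball; auto using l1_ball).
  assert (Hx' := ball_linf _ _ _ l2_ball Hx).
  assert (E : mult_op r x = ladd (mult_op (mask (in_win m) r) x) (mult_op (lsub r (mask (in_win m) r)) x)).
  { rewrite (conv_sub_l A A B); auto. apply functional_extensionality. intros j.
    unfold ladd, lsub. ring. }
  rewrite E. apply (ball_weaken _ l2_ball ((rho + d) * B + d * B)).
  { replace eps with (d * (2 * B + 1)) by (unfold d; field; lra). nra. }
  apply (ball_add _ l2_ball); [|apply conv_ball; auto using l2_ball].
  apply multiplier_bound_finite_l with m; auto using mask_win_finite; [lra|].
  intros theta.
  assert (E2 : mask (in_win m) r = lsub r (lsub r (mask (in_win m) r))).
  { apply functional_extensionality. intros j. unfold lsub. ring. }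
  rewrite E2, (circ_val_sub A d); auto.
  eapply Rle_trans; [apply Cmod_sub_le|].
  apply Rplus_le_compat; auto. apply circ_val_le; auto.
Qed.


(** * Sobolev weights *)

(** The square root of [hweight], so that a ball of [H^t] becomes an [l2] ball of the weighted
    sequence [lwt t x]. *)
Definition wt (t : R) (j : Z) : R := Rpower (Rmax 1 (IZR (Z.abs j))) t.
Definition lwt (t : R) (x : lseq) : lseq := fun j => (RtoC (wt t j) * x j)%C.

Lemma wt_pos t j : 0 < wt t j.
Proof. apply exp_pos. Qed.

Lemma wt_base_ge1 j : 1 <= Rmax 1 (IZR (Z.abs j)).
Proof. apply Rmax_l. Qed.

Lemma wt_mono s t j : s <= t -> wt s j <= wt t j.
Proof.
  intros h. unfold wt. pose proof (wt_base_ge1 j).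
  apply Rle_Rpower; auto.
Qed.

Lemma wt_0 j : wt 0 j = 1.
Proof. apply Rpower_O. pose proof (wt_base_ge1 j). lra. Qed.

Lemma wt_1 j : wt 1 j = Rmax 1 (IZR (Z.abs j)).
Proof. apply Rpower_1. pose proof (wt_base_ge1 j). lra. Qed.

Lemma hweight_wt s j : hweight s j = (wt s j)^2.
Proof.
  unfold hweight, wt. replace (2 * s) with (s + s) by ring. rewrite Rpower_plus. ring.
Qed.

Lemma Cmod_lwt t x j : Cmod (lwt t x j) = wt t j * Cmod (x j).
Proof.
  unfold lwt. rewrite Cmod_mult, Cmod_R, Rabs_right; auto. left. apply wt_pos.
Qed.

Lemma hs_terms_lwt s u j : hs_terms s u j = (Cmod (lwt s u j))^2.
Proof. unfold hs_terms. rewrite hweight_wt, Cmod_lwt. ring. Qed.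

Lemma in_Hs_l2 t u : in_Hs t u -> exists B, l2 B (lwt t u).
Proof.
  intros H. exists (sqrt (Series (zterms (hs_terms t u)))). split; [apply sqrt_pos|].
  intros n. rewrite <- (wsum_ext (hs_terms t u)) by (intros; apply hs_terms_lwt).
  assert (p : forall j, 0 <= hs_terms t u j) by (intros; rewrite hs_terms_lwt; apply pow2_ge_0).
  assert (ub : forall n, wsum (hs_terms t u) n <= Series (zterms (hs_terms t u))).
  { intros k. apply Rle_trans with (wsum (hs_terms t u) (S k)); [apply wsum_mono; auto|].
    rewrite <- sum_n_zterms.
    apply (is_lim_seq_incr_compare (sum_n (zterms (hs_terms t u)))).
    - apply Series_correct, H.
    - intros i. rewrite !sum_n_zterms. apply wsum_mono; auto. }
  rewrite pow2_sqrt; auto. apply (Rle_trans _ _ _ (wsum_nonneg _ 0 p) (ub 0%nat)).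
Qed.

Lemma l2_in_Hs t u B : l2 B (lwt t u) -> in_Hs t u.
Proof.
  intros [hB H]. destruct (ex_finite_lim_seq_incr (sum_n (zterms (hs_terms t u))) (B^2)) as [l hl].
  - intros n. rewrite !sum_n_zterms. apply wsum_mono; [|lia].
    intros; rewrite hs_terms_lwt; apply pow2_ge_0.
  - intros n. rewrite sum_n_zterms, (wsum_ext _ (fun j => (Cmod (lwt t u j))^2)); auto.
    intros; apply hs_terms_lwt.
  - exists l. exact hl.
Qed.

Lemma Hs_norm_le c s u B : (forall r, 0 < c r) -> l2 B (lwt s u) ->
  Hs_norm c s u <= sqrt (c (Rabs s)) * B.
Proof.
  intros hc H. assert (Hs := l2_in_Hs _ _ _ H). destruct H as [hB H]. unfold Hs_norm.
  apply Rle_trans with (sqrt (c (Rabs s) * B^2)).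
  - apply sqrt_le_1_alt. apply Rmult_le_compat_l; [left; apply hc|].
    apply (is_lim_seq_le (sum_n (zterms (hs_terms s u))) (fun _ => B^2) (zsumR (hs_terms s u)) (B^2)).
    + intros n. rewrite sum_n_zterms, (wsum_ext _ (fun j => (Cmod (lwt s u j))^2)); auto.
      intros; apply hs_terms_lwt.
    + apply Series_correct, Hs.
    + apply is_lim_seq_const.
  - right. rewrite sqrt_mult, sqrt_pow2; auto. left; apply hc. apply pow2_ge_0.
Qed.

(** The induction needs the stronger bound [6 - 4/n]: the two new terms at [p] and [-p-1] are
    dominated by the telescoping [4/p - 4/(p+1)]. Equality at [n = 1], where the sum is 2, fixes the
    constant 6. *)
Lemma inv_wt1_sq_sum n : wsum (fun j => / (wt 1 j)^2) n <= 6.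
Proof.
  assert (K : wsum (fun j => / (wt 1 j)^2) (S n) <= 6 - 4 / INR (S n)).
  { induction n.
    - simpl wsum. rewrite !wt_1. simpl. rewrite !Rmax_left by lra. lra.
    - change (wsum (fun j => / wt 1 j ^ 2) (S n) + (/ (wt 1 (Z.of_nat (S n)))^2
        + / (wt 1 (- Z.of_nat (S n) - 1))^2) <= 6 - 4 / INR (S (S n))).
      set (p := INR (S n)) in *.
      assert (hp : 1 <= p) by (unfold p; rewrite S_INR; pose proof (pos_INR n); lra).
      assert (E1 : wt 1 (Z.of_nat (S n)) = p).
      { rewrite wt_1, Z.abs_eq, <- INR_IZR_INZ by lia. apply Rmax_right; auto. }
      assert (E2 : wt 1 (- Z.of_nat (S n) - 1) = p + 1).
      { rewrite wt_1. replace (Z.abs (- Z.of_nat (S n) - 1)) with (Z.of_nat (S n) + 1)%Z by lia.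
        rewrite plus_IZR, <- INR_IZR_INZ. fold p. apply Rmax_right; lra. }
      rewrite E1, E2. replace (INR (S (S n))) with (p + 1) by (unfold p; rewrite (S_INR (S n)); ring).
      assert (/ p^2 + / (p+1)^2 <= 4/p - 4/(p+1)); [|lra].
      apply Rminus_le.
      replace (/ p^2 + / (p+1)^2 - (4/p - 4/(p+1)))
        with (- ((2 * p * p + 2 * p - 1) / (p^2 * (p+1)^2))) by (field; lra).
      assert (0 <= (2 * p * p + 2 * p - 1) / (p^2 * (p+1)^2)); [|lra].
      apply Rmult_le_pos; [nra|]. apply Rlt_le, Rinv_0_lt_compat.
      apply Rmult_lt_0_compat; apply pow_lt; lra. }
  apply Rle_trans with (wsum (fun j => / (wt 1 j)^2) (S n)).
  - apply wsum_mono; [|lia]. intros j. apply Rlt_le, Rinv_0_lt_compat, pow_lt, wt_pos.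
  - assert (0 < 4 / INR (S n)); [|lra]. apply Rdiv_lt_0_compat; [lra|]. apply lt_0_INR. lia.
Qed.

(** Embedding of [H^1] in the Wiener algebra, by [a <= E/(2 w^2) + w^2 a^2/(2 E)] term by term. The
    two sums are at most [3 E] and [E/2], rounded up to [4 E]. *)
Lemma l1_of_l2_wt1 E x : 0 < E -> l2 E (lwt 1 x) -> l1 (4 * E) x.
Proof.
  intros hE [_ H] n.
  apply Rle_trans with (wsum (fun j => E / 2 * / (wt 1 j)^2 + / (2 * E) * (Cmod (lwt 1 x j))^2) n).
  - apply wsum_le. intros j _. rewrite Cmod_lwt. pose proof (wt_pos 1 j) as hw.
    set (w := wt 1 j) in *. set (a := Cmod (x j)).
    assert (0 <= (E - w^2 * a)^2 / (2 * E * w^2)).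
    { apply Rmult_le_pos; [apply pow2_ge_0|]. apply Rlt_le, Rinv_0_lt_compat.
      apply Rmult_lt_0_compat; [lra|apply pow_lt; auto]. }
    replace ((E - w^2 * a)^2 / (2 * E * w^2))
      with (E / 2 * / w^2 + / (2 * E) * (w * a)^2 - a) in H0 by (field; lra). lra.
  - rewrite wsum_plus, !wsum_scal. specialize (H n). pose proof (inv_wt1_sq_sum n).
    assert (E / 2 * wsum (fun j => / (wt 1 j)^2) n <= E / 2 * 6) by (apply Rmult_le_compat_l; lra).
    assert (/ (2 * E) * wsum (fun j => (Cmod (lwt 1 x j))^2) n <= / (2 * E) * E^2).
    { apply Rmult_le_compat_l; auto. apply Rlt_le, Rinv_0_lt_compat; lra. }
    replace (/ (2 * E) * E^2) with (E / 2) in H2 by (field; lra). lra.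
Qed.

Lemma l2_lwt_mono s t B x : s <= t -> l2 B (lwt t x) -> l2 B (lwt s x).
Proof.
  intros h. apply (ball_dom _ l2_ball). intros j. rewrite !Cmod_lwt.
  apply Rmult_le_compat_r; [apply Cmod_ge_0|]. apply wt_mono; auto.
Qed.

Lemma l2_of_lwt t B x : 0 <= t -> l2 B (lwt t x) -> l2 B x.
Proof.
  intros h. apply (ball_dom _ l2_ball). intros j. rewrite Cmod_lwt, <- (Rmult_1_l (Cmod (x j))) at 1.
  apply Rmult_le_compat_r; [apply Cmod_ge_0|]. rewrite <- (wt_0 j). apply wt_mono; auto.
Qed.

(** Here [t >= 1] puts [g] and [u] in the Wiener algebra. The radius [B + 1] secures the positivity
    required by the embedding. *)
Lemma l1_of_lwt t B x : 1 <= t -> l2 B (lwt t x) -> l1 (4 * (B + 1)) x.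
Proof.
  intros h H. assert (hB := ball_nonneg _ _ _ l2_ball H). apply l1_of_l2_wt1; [lra|].
  apply (ball_weaken _ l2_ball B); [lra|]. apply l2_lwt_mono with t; auto.
Qed.

(** * Approximate inverses in the Wiener algebra *)

Definition labs (x : lseq) : lseq := fun j => RtoC (Cmod (x j)).

Lemma Cmod_labs x j : Cmod (labs x j) = Cmod (x j).
Proof. unfold labs. rewrite Cmod_R. apply Rabs_right, Rle_ge, Cmod_ge_0. Qed.

Lemma labs_ball P a x : ball_family P -> P a x -> P a (labs x).
Proof. intros HP. apply (ball_dom P HP). intros. rewrite Cmod_labs. lra. Qed.

Lemma ball_dom2 P a b x y (z : lseq) : ball_family P ->
  (forall j, Cmod (z j) <= Cmod (x j) + Cmod (y j)) -> P a x -> P b y -> P (a + b) z.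
Proof.
  intros HP H Hx Hy. apply (ball_dom P HP _ _ (ladd (labs x) (labs y))).
  - intros j. unfold ladd, labs. rewrite <- RtoC_plus, Cmod_R, Rabs_right; auto.
    pose proof (Cmod_ge_0 (x j)). pose proof (Cmod_ge_0 (y j)). lra.
  - apply (ball_add P HP); apply labs_ball; auto.
Qed.

(** The operator [z d/dz]. Unlike the weight [wt 1], it obeys the Leibniz rule exactly, so
    derivatives of powers can be estimated with sharp constants. *)
Definition lD (x : lseq) : lseq := fun j => (RtoC (IZR j) * x j)%C.

Lemma Cmod_lD x j : Cmod (lD x j) = IZR (Z.abs j) * Cmod (x j).
Proof. unfold lD. now rewrite Cmod_mult, Cmod_R, abs_IZR. Qed.

Lemma l2_lD_of_lwt1 B x : l2 B (lwt 1 x) -> l2 B (lD x).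
Proof.
  apply (ball_dom _ l2_ball). intros j. rewrite Cmod_lwt, Cmod_lD.
  apply Rmult_le_compat_r; [apply Cmod_ge_0|]. rewrite wt_1. apply Rmax_r.
Qed.

Lemma l2_lwt1_of_lD a b x : l2 a x -> l2 b (lD x) -> l2 (a + b) (lwt 1 x).
Proof.
  apply ball_dom2; [apply l2_ball|]. intros j. rewrite Cmod_lwt, Cmod_lD, wt_1.
  assert (0 <= IZR (Z.abs j)) by (apply IZR_le; lia). pose proof (Cmod_ge_0 (x j)).
  assert (Rmax 1 (IZR (Z.abs j)) <= 1 + IZR (Z.abs j)) by (apply Rmax_lub; lra). nra.
Qed.

Lemma l1_flip B f j : l1 B f -> l1 B (fun k => f (j - k)%Z).
Proof.
  intros H. apply l1_reflect, (ball_lshift _ (j + 1) _ _ l1_ball) in H.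
  apply (ball_dom _ l1_ball _ _ (lshift (j+1) (fun k => f (- k - 1)%Z))); auto.
  intros k. unfold lshift. right. do 2 f_equal. lia.
Qed.

Lemma zsumC_plus A B f g : l1 A f -> l1 B g ->
  zsumC (fun k => f k + g k)%C = (zsumC f + zsumC g)%C.
Proof.
  intros Hf Hg. apply zsumC_eq with (A + B); [apply (ball_add _ l1_ball _ _ _ _ Hf Hg)|].
  apply Cv_ext with (fun n => csum f n + csum g n)%C; [intros; now rewrite csum_plus|].
  apply Cv_plus; eapply l1_Cv; eauto.
Qed.

(** Leibniz rule, from [j = k + (j - k)] under the sum. Each product has its summable factor first,
    because the differentiated factor is only known to be bounded. *)
Lemma lD_conv A B A' B' x y : l1 A x -> l1 B y -> linf A' (lD x) -> linf B' (lD y) ->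
  lD (mult_op x y) = ladd (mult_op y (lD x)) (mult_op x (lD y)).
Proof.
  intros Hx Hy Hx' Hy'. apply functional_extensionality. intros j. unfold ladd.
  rewrite <- (conv_comm B A' y (lD x)) by auto. unfold lD at 1, mult_op.
  assert (S1 : l1 (B * A') (fun k => lD x k * y (j - k)%Z)%C).
  { apply (ball_dom _ l1_ball _ _ (fun k => y (j - k)%Z * lD x (j - (j - k))%Z)%C).
    - intros k. replace (j - (j - k))%Z with k by lia. right. f_equal. ring.
    - apply (l1_flip _ (fun i => y i * lD x (j - i)%Z)%C). apply conv_summand; auto. }
  rewrite <- (zsumC_plus _ _ _ _ S1 (conv_summand _ _ _ _ j Hx Hy')).
  rewrite <- (zsumC_scal (A * B)).
  - apply zsumC_ext. intros k. unfold lD. rewrite minus_IZR, RtoC_minus. ring.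
  - apply conv_summand; auto. eapply ball_linf; eauto using l1_ball.
Qed.

Lemma wsum_reflect f n : wsum (fun j => f (- j - 1)%Z) n = wsum f n.
Proof.
  induction n; simpl; [auto|]. rewrite IHn.
  replace (- (- Z.of_nat n - 1) - 1)%Z with (Z.of_nat n) by lia. ring.
Qed.

Lemma l2_neg B x : l2 B x -> l2 B (fun j => x (- j)%Z).
Proof.
  intros [hB H].
  assert (H' : l2 B (fun j => x (- j - 1)%Z)).
  { split; auto. intros n. rewrite (wsum_reflect (fun j => (Cmod (x j))^2)). auto. }
  apply (ball_shift1 _ l2_ball) in H'. revert H'. apply (ball_dom _ l2_ball).
  intros j. right. do 2 f_equal. lia.
Qed.

Definition lconj (g : lseq) : lseq := fun j => Cconj (g (- j)%Z).

Lemma l1_lconj A g : l1 A g -> l1 A (lconj g).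
Proof.
  intros H. apply (ball_dom _ l1_ball _ _ (fun j => g (0 - j)%Z)); [|apply l1_flip; auto].
  intros j. unfold lconj. rewrite Cmod_conj. right. reflexivity.
Qed.

Lemma l2_lD_lconj B g : l2 B (lD g) -> l2 B (lD (lconj g)).
Proof.
  intros H. apply l2_neg in H. revert H. apply (ball_dom _ l2_ball). intros j.
  rewrite !Cmod_lD. unfold lconj. rewrite Cmod_conj, Z.abs_opp. lra.
Qed.

Lemma Cv_conj s l : Cv s l -> Cv (fun n => Cconj (s n)) (Cconj l).
Proof.
  intros H eps he. destruct (H eps he) as [n0 h]. exists n0. intros n hn.
  replace (Cconj (s n) - Cconj l)%C with (Cconj (s n - l)).
  - rewrite Cmod_conj. auto.
  - unfold Cconj, Cminus, Cplus, Copp. simpl. f_equal. ring.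
Qed.

Lemma circ_val_lconj A g theta : l1 A g -> circ_val (lconj g) theta = Cconj (circ_val g theta).
Proof.
  intros H.
  assert (H1 := circ_val_summand A _ theta (l1_lconj A g H)).
  change (zsumC (fun j => lconj g j * cis (IZR j * theta))%C
    = Cconj (zsumC (fun j => g j * cis (IZR j * theta))%C)).
  rewrite <- (zsumC_flip _ _ 0 H1). apply zsumC_eq with A; [exact (l1_flip A _ 0 H1)|].
  apply Cv_ext with (fun n => Cconj (csum (fun j => g j * cis (IZR j * theta))%C n)).
  - intros n. rewrite csum_conj. apply csum_ext. intros j _. unfold lconj.
    replace (- (0 - j))%Z with j by lia. rewrite Cconj_mult, cis_conj, minus_IZR.
    do 2 f_equal. ring.
  - apply Cv_conj. eapply l1_Cv. apply circ_val_summand; eauto.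
Qed.

Lemma circ_val_delta0 theta : circ_val delta0 theta = 1%C.
Proof.
  unfold circ_val. rewrite (zsumC_single _ 0%Z).
  - unfold delta0. simpl. rewrite Rmult_0_l. fold (cis 0). rewrite cis_0. ring.
  - intros i hi. unfold delta0. rewrite (proj2 (Z.eqb_neq i 0)) by auto. ring.
Qed.

Lemma circ_val_scal A c x theta : l1 A x -> circ_val (lscal c x) theta = (c * circ_val x theta)%C.
Proof.
  intros H. unfold circ_val. rewrite <- (zsumC_scal A _ _ (circ_val_summand A x theta H)).
  apply zsumC_ext. intros k. unfold lscal, cis. ring.
Qed.

Fixpoint lpow (r : lseq) (k : nat) : lseq :=
  match k with O => delta0 | S k => mult_op r (lpow r k) end.

Fixpoint lgeom (r : lseq) (k : nat) : lseq :=
  match k with O => lzero | S k => ladd (lgeom r k) (lpow r k) end.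

Lemma l1_lpow A r k : l1 A r -> l1 (A^k) (lpow r k).
Proof.
  intros H. induction k; simpl; [apply l1_delta0|]. apply conv_ball; auto using l1_ball.
Qed.

Lemma circ_val_lpow A rho r theta k : l1 A r -> Cmod (circ_val r theta) <= rho ->
  Cmod (circ_val (lpow r k) theta) <= rho ^ k.
Proof.
  intros H h. induction k; simpl.
  - rewrite circ_val_delta0, Cmod_1. lra.
  - rewrite (circ_val_conv A (A^k)), Cmod_mult; auto using l1_lpow.
    apply Rmult_le_compat; auto using Cmod_ge_0.
Qed.

Lemma l2_delta0 : l2 1 delta0.
Proof.
  split; [lra|]. intros n. apply Rle_trans with (wsum (fun j => Cmod (delta0 j)) n).
  - apply wsum_le. intros j _. unfold delta0. destruct (j =? 0)%Z; [rewrite Cmod_1|rewrite Cmod_0]; lra.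
  - eapply Rle_trans; [apply l1_delta0|lra].
Qed.

Lemma lgeom_l1 A r k : l1 A r -> exists B, l1 B (lgeom r k).
Proof.
  intros H. induction k; simpl.
  - exists 0. apply (ball_zero _ l1_ball).
  - destruct IHk as [B hB]. exists (B + A^k). apply (ball_add _ l1_ball); auto using l1_lpow.
Qed.

Lemma conv_lgeom A r k : l1 A r ->
  mult_op (lsub delta0 r) (lgeom r k) = lsub delta0 (lpow r k).
Proof.
  intros H.
  assert (H1 : l1 (1 + A) (lsub delta0 r)) by (apply ball_sub; auto using l1_ball, l1_delta0).
  induction k; simpl.
  - apply functional_extensionality. intros j. unfold mult_op, lzero, lsub.
    rewrite (zsumC_finite _ 0); [simpl; ring|]. intros; ring.
  - destruct (lgeom_l1 A r k H) as [B HB].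
    assert (Hp := ball_linf _ _ _ l1_ball (l1_lpow A r k H)).
    rewrite (conv_add_r (1 + A) B (A^k)); auto using (ball_linf _ _ _ l1_ball HB).
    rewrite IHk, (conv_sub_l 1 A (A^k)), conv_delta_l; auto using l1_delta0.
    apply functional_extensionality. intros j. unfold lsub, ladd. ring.
Qed.

(* The derivation property of [lD] gives ||D r^(k+1)|| <= rho^k ||D r|| + rho ||D r^k||. *)
Lemma l2_lD_lpow A D rho sigma r k : l1 A r -> l2 D (lD r) -> rho < sigma ->
  (forall theta, Cmod (circ_val r theta) <= rho) ->
  l2 (D / (sigma - rho) * sigma ^ k) (lD (lpow r k)).
Proof.
  intros H HD hs Hr.
  assert (h0 : 0 <= rho) by (eapply Rle_trans; [apply Cmod_ge_0|apply (Hr 0)]).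
  assert (hD := ball_nonneg _ _ _ l2_ball HD).
  assert (hC : 0 <= D / (sigma - rho)) by (apply Rmult_le_pos; [auto|apply Rlt_le, Rinv_0_lt_compat; lra]).
  induction k.
  - simpl. apply (ball_dom _ l2_ball _ _ lzero).
    + intros j. unfold lD, delta0, lzero. destruct (Z.eqb_spec j 0) as [->|h].
      * right. f_equal. ring.
      * right. f_equal. ring.
    + apply (ball_weaken _ l2_ball 0); [lra|]. apply (ball_zero _ l2_ball).
  - simpl lpow. rewrite (lD_conv A (A^k) D (D / (sigma - rho) * sigma ^ k)); auto using l1_lpow;
      try (eapply ball_linf; eauto using l2_ball).
    apply (ball_weaken _ l2_ball (rho ^ k * D + rho * (D / (sigma - rho) * sigma ^ k))).
    + assert (rho ^ k <= sigma ^ k) by (apply pow_incr; lra).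
      replace (D / (sigma - rho) * sigma ^ (S k))
        with (sigma ^ k * D + rho * (D / (sigma - rho) * sigma ^ k)) by (simpl; field; lra).
      nra.
    + apply (ball_add _ l2_ball).
      * apply multiplier_bound with (A^k); auto using l1_lpow.
        intros theta. apply circ_val_lpow with A; auto.
      * apply multiplier_bound with A; auto.
Qed.

Lemma l2_lpow A rho r k : l1 A r -> (forall theta, Cmod (circ_val r theta) <= rho) ->
  l2 (rho ^ k) (lpow r k).
Proof.
  intros H Hr. induction k; simpl; [apply l2_delta0|].
  apply multiplier_bound with A; auto.
Qed.

(** A spectral radius statement in the Wiener algebra: [r] itself may have [l1] norm above 1, yet
    its powers decay there, because both [r^k] and its derivative decay geometrically in [l2]. *)
Lemma lpow_l1_small A D rho r eps : l1 A r -> l2 D (lD r) -> rho < 1 ->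
  (forall theta, Cmod (circ_val r theta) <= rho) -> 0 < eps ->
  exists k, l1 eps (lpow r k).
Proof.
  intros H HD hr1 Hr he.
  assert (h0 : 0 <= rho) by (eapply Rle_trans; [apply Cmod_ge_0|apply (Hr 0)]).
  assert (hD := ball_nonneg _ _ _ l2_ball HD).
  (* The derivative of [r^k] is of order [k rho^(k-1)]; any rate strictly between [rho] and 1
     absorbs the factor [k]. *)
  pose (sigma := (1 + rho) / 2). assert (hs : rho < sigma) by (unfold sigma; lra).
  pose (K := 1 + D / (sigma - rho)).
  assert (hK : 1 <= K).
  { assert (0 <= D / (sigma - rho)); [|unfold K; lra].
    apply Rmult_le_pos; [auto|apply Rlt_le, Rinv_0_lt_compat; lra]. }
  assert (L : is_lim_seq (fun k => sigma ^ k) 0).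
  { apply is_lim_seq_geom. rewrite Rabs_right; unfold sigma; lra. }
  apply is_lim_seq_spec in L.
  destruct (L (mkposreal (eps / (4 * K)) ltac:(apply Rdiv_lt_0_compat; lra))) as [k hk].
  simpl in hk. specialize (hk k (le_n _)). exists k.
  assert (hsk : 0 < sigma ^ k) by (apply pow_lt; unfold sigma; lra).
  rewrite Rminus_0_r, Rabs_right in hk by lra.
  apply (ball_weaken _ l1_ball (4 * (K * sigma ^ k))).
  { apply Rmult_lt_compat_r with (r := 4 * K) in hk; [|lra].
    replace (eps / (4 * K) * (4 * K)) with eps in hk by (field; lra). lra. }
  apply l1_of_l2_wt1; [apply Rmult_lt_0_compat; lra|].
  apply (ball_weaken _ l2_ball (rho ^ k + D / (sigma - rho) * sigma ^ k)).
  { unfold K. rewrite Rmult_plus_distr_r, Rmult_1_l. apply Rplus_le_compat_r, pow_incr. lra. }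
  apply l2_lwt1_of_lD; [eapply l2_lpow; eauto|]. apply l2_lD_lpow with A; auto.
Qed.

(* With [r = 1 - |g|^2 / A^2] the geometric series in [r], times [conj g / A^2], inverts [g]. *)
Lemma approx_inverse A G g m : l1 A g -> l2 G (lD g) -> 0 < m ->
  (forall theta, m <= Cmod (circ_val g theta)) -> forall eps, 0 < eps ->
  exists (n : nat) (q : lseq), (forall j, in_win n j = false -> q j = 0%C) /\
    l1 eps (lsub (mult_op q g) delta0).
Proof.
  intros Hg HG hm Hm eps he.
  assert (hmA : m <= A).
  { eapply Rle_trans; [apply (Hm 0)|apply circ_val_le; auto]. }
  pose (kap := RtoC (/ A^2)). pose (gs := lconj g).
  assert (Hgs : l1 A gs) by (apply l1_lconj; auto).
  pose (r := lsub delta0 (lscal kap (mult_op gs g))).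
  assert (Hgg : l1 (A * A) (mult_op gs g)) by (apply conv_ball; auto using l1_ball).
  pose (A2 := 1 + Cmod kap * (A * A)).
  assert (Hr : l1 A2 r).
  { apply ball_sub; auto using l1_ball, l1_delta0. apply (ball_scal _ l1_ball); auto. }
  (* On the circle [m <= |g| <= A], so the values of [r] lie between 0 and [1 - m^2/A^2]. *)
  pose (rho := 1 - m^2 / A^2).
  assert (hA2 : 0 < A^2) by (apply pow_lt; lra).
  assert (hkm : 0 < m^2 / A^2) by (apply Rdiv_lt_0_compat; auto; apply pow_lt; auto).
  assert (Hrho : forall theta, Cmod (circ_val r theta) <= rho).
  { intros theta. unfold r.
    rewrite (circ_val_sub 1 (Cmod kap * (A * A))); auto using l1_delta0.
    2:{ apply (ball_scal _ l1_ball); auto. }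
    rewrite (circ_val_scal (A * A)), (circ_val_conv A A), circ_val_delta0 by auto.
    unfold gs. rewrite (circ_val_lconj A) by auto.
    rewrite (Cmult_comm (Cconj _)), <- Cmod2_conj.
    unfold kap. rewrite <- RtoC_mult, <- RtoC_minus, Cmod_R.
    pose proof (Hm theta) as h1. pose proof (circ_val_le A g theta Hg) as h2.
    set (a := Cmod (circ_val g theta)) in *.
    assert (a^2 <= A^2) by (apply pow_incr; lra).
    assert (m^2 <= a^2) by (apply pow_incr; lra).
    assert (/ A^2 * a^2 <= 1).
    { apply Rmult_le_reg_l with (A^2); auto. rewrite <- Rmult_assoc, Rinv_r by lra. lra. }
    assert (/ A^2 * m^2 <= / A^2 * a^2).
    { apply Rmult_le_compat_l; auto. apply Rlt_le, Rinv_0_lt_compat; auto. }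
    rewrite Rabs_right by lra. unfold rho. lra. }
  assert (HGs : l2 G (lD gs)) by (apply l2_lD_lconj; auto).
  assert (HDr : exists D, l2 D (lD r)).
  { exists (Cmod (- kap) * (A * G + A * G)).
    apply (ball_dom _ l2_ball _ _ (lscal (- kap) (lD (mult_op gs g)))).
    - intros j. right. f_equal. unfold lD, r, lscal, lsub, delta0.
      destruct (Z.eqb_spec j 0) as [->|h]; ring.
    - apply (ball_scal _ l2_ball). rewrite (lD_conv A A G G); auto;
        try (eapply ball_linf; eauto using l2_ball).
      apply (ball_add _ l2_ball); apply conv_ball; auto using l2_ball. }
  destruct HDr as [D HD].
  destruct (lpow_l1_small A2 D rho r (eps / 2) Hr HD) as [k hk]; auto; [unfold rho; lra|lra|].
  destruct (lgeom_l1 A2 r k Hr) as [B HB].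
  pose (q := mult_op (lgeom r k) (lscal kap gs)).
  assert (Hks : l1 (Cmod kap * A) (lscal kap gs)) by (apply (ball_scal _ l1_ball); auto).
  assert (Hq : l1 (B * (Cmod kap * A)) q) by (apply conv_ball; auto using l1_ball).
  assert (Eq : mult_op q g = lsub delta0 (lpow r k)).
  { unfold q. rewrite (conv_assoc B (Cmod kap * A) A); auto using (ball_linf _ _ _ l1_ball Hg).
    rewrite (conv_scal_l A A); auto using (ball_linf _ _ _ l1_ball Hg).
    replace (lscal kap (mult_op gs g)) with (lsub delta0 r).
    2:{ apply functional_extensionality. intros j. unfold r, lsub. ring. }
    rewrite (conv_comm (1 + A2) B).
    - apply conv_lgeom with A2; auto.
    - apply ball_sub; auto using l1_ball, l1_delta0.
    - eapply ball_linf; eauto using l1_ball. }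
  (* Before truncation [q g = 1 - r^k]. Cutting [q] down to a Laurent polynomial adds an error of at
     most [eps / (2 A)] times the norm [A] of [g]; the other half of [eps] is spent on [r^k]. *)
  destruct (l1_tail _ q (eps / 2 / A) Hq) as [n hn]; [apply Rdiv_lt_0_compat; lra|].
  specialize (hn n (le_n _)). exists n, (mask (in_win n) q).
  split; [apply mask_win_finite|].
  assert (Hmq : l1 (B * (Cmod kap * A)) (mask (in_win n) q)) by (apply mask_ball; auto using l1_ball).
  apply (ball_weaken _ l1_ball (eps / 2 / A * A + eps / 2)); [right; field; lra|].
  replace (lsub (mult_op (mask (in_win n) q) g) delta0)
    with (lscal (-(1)) (ladd (mult_op (lsub q (mask (in_win n) q)) g) (lpow r k))).
  - replace (eps / 2 / A * A + eps / 2) with (Cmod (-(1)) * (eps / 2 / A * A + eps / 2))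
      by (rewrite Cmod_m1; ring).
    apply (ball_scal _ l1_ball), (ball_add _ l1_ball); auto. apply conv_ball; auto using l1_ball.
  - rewrite (conv_sub_l (B * (Cmod kap * A)) (B * (Cmod kap * A)) A), Eq;
      auto using (ball_linf _ _ _ l1_ball Hg).
    apply functional_extensionality. intros j. unfold lscal, ladd, lsub. ring.
Qed.


(** * Kernels of the half-line Toeplitz operators *)

(** From [|j| <= |k| + |j - k|], which is at most twice the larger of the two bases; the power of
    the larger is below the sum of powers. *)
Lemma wt_subadd t j k : 0 <= t -> wt t j <= Rpower 2 t * (wt t k + wt t (j - k)).
Proof.
  intros ht. unfold wt.
  set (a := Rmax 1 (IZR (Z.abs k))). set (b := Rmax 1 (IZR (Z.abs (j - k)))).
  assert (ha : 1 <= a) by apply Rmax_l. assert (hb : 1 <= b) by apply Rmax_l.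
  assert (h : Rmax 1 (IZR (Z.abs j)) <= 2 * Rmax a b).
  { apply Rmax_lub.
    - pose proof (Rmax_l a b). lra.
    - apply Rle_trans with (IZR (Z.abs k + Z.abs (j - k))); [apply IZR_le; lia|].
      rewrite plus_IZR.
      assert (IZR (Z.abs k) <= a) by apply Rmax_r.
      assert (IZR (Z.abs (j - k)) <= b) by apply Rmax_r.
      pose proof (Rmax_l a b). pose proof (Rmax_r a b). lra. }
  apply Rle_trans with (Rpower (2 * Rmax a b) t).
  - apply Rle_Rpower_l; auto. split; auto. pose proof (Rmax_l 1 (IZR (Z.abs j))). lra.
  - rewrite <- Rpower_mult_distr; [|lra|pose proof (Rmax_l a b); lra].
    apply Rmult_le_compat_l; [left; apply exp_pos|].
    assert (0 < Rpower a t) by apply exp_pos. assert (0 < Rpower b t) by apply exp_pos.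
    destruct (Rmax_case_strong a b (fun z => Rpower z t <= Rpower a t + Rpower b t)); intros; lra.
Qed.

Lemma Cmod_pconv_labs x y n j :
  Cmod (pconv (labs x) (labs y) n j) = wsum (fun k => Cmod (x k) * Cmod (y (j - k)%Z)) n.
Proof.
  unfold pconv, labs.
  rewrite (csum_ext _ (fun k => RtoC (Cmod (x k) * Cmod (y (j - k)%Z)))), csum_RtoC.
  - rewrite Cmod_R, Rabs_right; auto. apply Rle_ge, wsum_nonneg. intros k.
    apply Rmult_le_pos; apply Cmod_ge_0.
  - intros. now rewrite RtoC_mult.
Qed.

(** A tame product estimate: in each term one factor is measured in [H^t] and the other only in
    [l1]. Hence a factor small in [l1] but large in [H^t] still gives a small coefficient in front
    of the [H^t] norm of the other. Absolute values let the weight be split inside the sum. *)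
Lemma l2_lwt_conv t A B A' B' x y : 0 <= t -> l1 A x -> l1 B y ->
  l2 A' (lwt t x) -> l2 B' (lwt t y) ->
  l2 (Rpower 2 t * (B * A' + A * B')) (lwt t (mult_op x y)).
Proof.
  intros ht Hx Hy Hx' Hy'.
  assert (hB' := ball_nonneg _ _ _ l2_ball Hy').
  apply (ball_lim _ l2_ball _ (fun n => lwt t (pconv x y n))).
  2:{ intros j. unfold lwt. apply Cv_scale. eapply pconv_Cv; eauto.
      eapply ball_linf; eauto using l1_ball. }
  intros n.
  assert (H1 : l2 (B * A') (pconv (labs (lwt t x)) (labs y) n)).
  { assert (Hl : l2 A' (mask (in_win n) (labs (lwt t x))))
      by (apply mask_ball; [|apply labs_ball]; auto using l2_ball).
    assert (Hb : l1 B (labs y)) by (apply labs_ball; auto using l1_ball).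
    rewrite <- conv_mask_win, (conv_comm B A'); auto.
    - apply conv_ball; auto using l2_ball.
    - eapply ball_linf; eauto using l2_ball. }
  assert (H2 : l2 (A * B') (pconv (labs x) (labs (lwt t y)) n)).
  { apply (ball_weaken _ l2_ball (wsum (fun j => Cmod (labs x j)) n * B')).
    - apply Rmult_le_compat_r; auto.
      rewrite (wsum_ext _ (fun j => Cmod (x j))) by (intros; apply Cmod_labs). auto.
    - apply pconv_ball; auto using l2_ball. apply labs_ball; auto using l2_ball. }
  assert (h2 : 0 < Rpower 2 t) by apply exp_pos.
  replace (Rpower 2 t * (B * A' + A * B'))
    with (Cmod (RtoC (Rpower 2 t)) * (B * A') + Cmod (RtoC (Rpower 2 t)) * (A * B')).
  2:{ rewrite Cmod_R, Rabs_right by lra. ring. }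
  refine (ball_dom2 _ _ _ _ _ _ l2_ball _ (ball_scal _ l2_ball _ _ _ H1) (ball_scal _ l2_ball _ _ _ H2)).
  intros j. unfold lscal. rewrite !Cmod_mult, !Cmod_pconv_labs, Cmod_R, Rabs_right, Cmod_lwt by lra.
  apply Rle_trans with (wt t j * wsum (fun k => Cmod (x k) * Cmod (y (j - k)%Z)) n).
  - apply Rmult_le_compat_l; [left; apply wt_pos|].
    eapply Rle_trans; [apply Cmod_csum_le|]. right. apply wsum_ext. intros; apply Cmod_mult.
  - rewrite <- Rmult_plus_distr_l, <- wsum_plus, <- !wsum_scal. apply wsum_le. intros k _.
    rewrite !Cmod_lwt. pose proof (wt_subadd t j k ht).
    replace (Rpower 2 t * (wt t k * Cmod (x k) * Cmod (y (j - k)%Z)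
       + Cmod (x k) * (wt t (j - k) * Cmod (y (j - k)%Z))))
      with (Rpower 2 t * (wt t k + wt t (j - k)) * (Cmod (x k) * Cmod (y (j - k)%Z))) by ring.
    apply Rmult_le_compat_r; auto. apply Rmult_le_pos; apply Cmod_ge_0.
Qed.

Lemma l2_finite (x : lseq) n : (forall j, in_win n j = false -> x j = 0%C) ->
  l2 (sqrt (wsum (fun j => (Cmod (x j))^2) n)) x.
Proof.
  intros H.
  assert (p : forall k, 0 <= wsum (fun j => (Cmod (x j))^2) k)
    by (intros; apply wsum_nonneg; intros; apply pow2_ge_0).
  split; [apply sqrt_pos|].
  intros k. rewrite pow2_sqrt; auto. destruct (Nat.le_gt_cases k n) as [h|h].
  - apply wsum_mono; auto. intros; apply pow2_ge_0.
  - apply Nat.lt_le_incl in h. induction h; [lra|]. simpl wsum.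
    rewrite !H by (apply in_win_false; lia). rewrite Cmod_0. simpl in IHh. lra.
Qed.

Lemma lwt_lsub t x y : lwt t (lsub x y) = lsub (lwt t x) (lwt t y).
Proof. apply functional_extensionality. intros j. unfold lwt, lsub. ring. Qed.

Lemma lwt_ladd t x y : lwt t (ladd x y) = ladd (lwt t x) (lwt t y).
Proof. apply functional_extensionality. intros j. unfold lwt, ladd. ring. Qed.

Lemma lwt_mask t p x : lwt t (mask p x) = mask p (lwt t x).
Proof.
  apply functional_extensionality. intros j. unfold lwt, mask. destruct (p j); ring.
Qed.

Lemma l2_lwt_delta0 t : l2 1 (lwt t delta0).
Proof.
  apply (ball_dom _ l2_ball _ _ delta0); [|apply l2_delta0]. intros j.
  rewrite Cmod_lwt. unfold delta0. destruct (Z.eqb_spec j 0) as [->|h].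
  - rewrite Cmod_1. unfold wt. simpl. rewrite Rmax_left by lra.
    unfold Rpower. rewrite ln_1, Rmult_0_r, exp_0. lra.
  - rewrite Cmod_0. lra.
Qed.

Lemma half_pow_small B d : 0 <= B -> 0 < d ->
  exists k0, forall k, (k0 <= k)%nat -> B * (1/2)^k <= d.
Proof.
  intros hB hd.
  assert (L : is_lim_seq (fun k => (1/2) ^ k) 0).
  { apply is_lim_seq_geom. rewrite Rabs_right; lra. }
  apply is_lim_seq_spec in L.
  destruct (L (mkposreal (d / (B + 1)) ltac:(apply Rdiv_lt_0_compat; lra))) as [k0 hk0].
  simpl in hk0. exists k0. intros k hk. specialize (hk0 k hk).
  assert (hp : 0 < (1/2)^k) by (apply pow_lt; lra).
  rewrite Rminus_0_r, Rabs_right in hk0 by lra.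
  apply Rle_trans with ((B + 1) * (d / (B + 1))); [nra|]. right. field. lra.
Qed.

Fixpoint picard (f e : lseq) (n : nat) : lseq :=
  match n with
  | O => lzero
  | S n => lsub f (mask (fun j => j <? 0)%Z (mult_op e (picard f e n)))
  end.

Lemma conv_support_ge (q p : lseq) n j :
  (forall k, in_win n k = false -> q k = 0%C) -> (forall k, (k < 0)%Z -> p k = 0%C) ->
  (j < - Z.of_nat n)%Z -> mult_op q p j = 0%C.
Proof.
  intros Hq Hp hj. unfold mult_op. rewrite (zsumC_finite _ 0); [reflexivity|].
  intros k _. destruct (in_win n k) eqn:E; [|rewrite Hq by auto; ring].
  apply in_win_true in E. rewrite Hp by lia. ring.
Qed.

(* If [q g = 1 + e] with [e] small in [l1], then [w] is the fixed point of [x |-> f - P_-(e x)]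
   with [f = P_-(q g w)] a Laurent polynomial, and the iterates stay bounded in [H^t]. *)
Lemma kernel_regularity t A G B m g w : 1 <= t -> l1 A g -> l2 G (lwt t g) -> 0 < m ->
  (forall theta, m <= Cmod (circ_val g theta)) -> l2 B w ->
  (forall j, (0 <= j)%Z -> w j = 0%C) -> (forall j, (j < 0)%Z -> mult_op g w j = 0%C) ->
  exists B', l2 B' (lwt t w).
Proof.
  intros ht Hg HG hm Hm Hw Hw0 Hgw.
  assert (h2t : 1 <= Rpower 2 t).
  { rewrite <- (Rpower_O 2) by lra. apply Rle_Rpower; lra. }
  (* The factor [2^t] of the product estimate times [eps] is [1/2], which makes the iteration
     contract in the [H^t] term. *)
  pose (eps := / (2 * Rpower 2 t)).
  assert (he : 0 < eps) by (apply Rinv_0_lt_compat; lra).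
  assert (he2 : Rpower 2 t * eps = 1 / 2) by (unfold eps; field; lra).
  assert (he3 : eps <= 1 / 2) by nra.
  destruct (approx_inverse A G g m Hg) with (eps := eps) as (n & q & Hq & He); auto.
  { apply l2_lD_of_lwt1, l2_lwt_mono with t; auto. }
  set (e := lsub (mult_op q g) delta0) in *.
  assert (Hq1 := l1_finite q n Hq). set (Q := wsum (fun j => Cmod (q j)) n) in *.
  assert (Hq2 : l2 (sqrt (wsum (fun j => (Cmod (lwt t q j))^2) n)) (lwt t q)).
  { apply l2_finite. intros j hj. unfold lwt. rewrite Hq by auto. ring. }
  set (Q2 := sqrt (wsum (fun j => (Cmod (lwt t q j))^2) n)) in *.
  pose (E := Rpower 2 t * (A * Q2 + Q * G) + 1).
  assert (HE : l2 E (lwt t e)).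
  { unfold e. rewrite lwt_lsub. apply ball_sub; auto using l2_ball, l2_lwt_delta0.
    apply l2_lwt_conv; auto; lra. }
  (* [g w] starts at index 0 and [q] at [-n], so the negative part of their product occupies
     finitely many indices and lies in every [H^t]. *)
  pose (f := mask (fun j => j <? 0)%Z (mult_op q (mult_op g w))).
  assert (Hf : forall j, in_win n j = false -> f j = 0%C).
  { intros j hj. unfold f, mask. destruct (Z.ltb_spec j 0); auto.
    apply in_win_false in hj. apply conv_support_ge with n; auto. lia. }
  assert (Hf1 := l1_finite f n Hf). set (F := wsum (fun j => Cmod (f j)) n) in *.
  assert (Hf2 : l2 (sqrt (wsum (fun j => (Cmod (lwt t f j))^2) n)) (lwt t f)).
  { apply l2_finite. intros j hj. unfold lwt. rewrite Hf by auto. ring. }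
  set (F2 := sqrt (wsum (fun j => (Cmod (lwt t f j))^2) n)) in *.
  assert (hF := ball_nonneg _ _ _ l1_ball Hf1).
  assert (hF2 := ball_nonneg _ _ _ l2_ball Hf2).
  assert (hE := ball_nonneg _ _ _ l2_ball HE).
  assert (Hwi := ball_linf _ _ _ l2_ball Hw).
  assert (hB := ball_nonneg _ _ _ l2_ball Hw).
  assert (Eqw : w = lsub f (mask (fun j => j <? 0)%Z (mult_op e w))).
  { apply functional_extensionality. intros j. unfold lsub at 1, f, mask.
    destruct (Z.ltb_spec j 0) as [hj|hj]; [|rewrite Hw0 by auto; ring].
    unfold e. rewrite (conv_sub_l (Q * A) 1 B), conv_delta_l; auto using l1_delta0.
    - rewrite (conv_assoc Q A B); auto. unfold lsub. ring.
    - apply conv_ball; auto using l1_ball. }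
  (* A uniform [l1] bound comes first, since it multiplies the possibly large [H^t] norm [E] of [e]
     in the next estimate. *)
  assert (P1 : forall k, l1 (2 * F) (picard f e k)).
  { intros k. induction k; simpl.
    - apply (ball_weaken _ l1_ball 0); [lra|apply (ball_zero _ l1_ball)].
    - apply (ball_weaken _ l1_ball (F + eps * (2 * F))); [nra|].
      apply ball_sub; auto using l1_ball. apply mask_ball; [apply l1_ball|].
      apply conv_ball; auto using l1_ball. }
  (* The solution of [Wb = F2 + 2^t (2 F E + eps Wb)], the bound that one iteration step
     reproduces. *)
  pose (Wb := 2 * (F2 + Rpower 2 t * (2 * F * E))).
  assert (hWb : 0 <= Wb).
  { assert (0 <= 2 * F * E) by nra. unfold Wb. nra. }
  assert (P2 : forall k, l2 Wb (lwt t (picard f e k))).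
  { intros k. induction k; simpl.
    - apply (ball_dom _ l2_ball _ _ lzero).
      + intros j. unfold lwt, lzero. rewrite Cmult_0_r. lra.
      + apply (ball_weaken _ l2_ball 0); [auto|apply (ball_zero _ l2_ball)].
    - rewrite lwt_lsub, lwt_mask.
      apply (ball_weaken _ l2_ball (F2 + Rpower 2 t * (2 * F * E + eps * Wb))).
      + rewrite Rmult_plus_distr_l, <- (Rmult_assoc _ eps), he2. unfold Wb. lra.
      + apply ball_sub; auto using l2_ball. apply mask_ball; [apply l2_ball|].
        apply l2_lwt_conv; auto. lra. }
  (* The iterates converge to the given [w], not just to some fixed point, because [w] is already in
     [l2], where the map halves distances. *)
  assert (P3 : forall k, l2 (B * (1/2)^k) (lsub w (picard f e k))).
  { intros k. induction k.
    - simpl. rewrite Rmult_1_r. revert Hw. apply (ball_dom _ l2_ball). intros j.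
      unfold lsub, lzero. right. f_equal. ring.
    - apply (ball_dom _ l2_ball _ _ (mask (fun j => j <? 0)%Z (mult_op e (lsub w (picard f e k))))).
      + intros j. rewrite Eqw at 1. rewrite (conv_sub_r eps B (2 * F)); auto.
        2:{ apply (ball_linf _ _ _ l1_ball (P1 k)). }
        simpl picard. unfold lsub, mask. destruct (j <? 0)%Z.
        * rewrite <- (Cmod_opp (_ - _ - _)). right. f_equal. ring.
        * right. f_equal. ring.
      + apply mask_ball; [apply l2_ball|].
        apply (ball_weaken _ l2_ball (eps * (B * (1/2)^k))).
        * assert (0 <= B * (1/2)^k) by (apply (ball_nonneg _ _ _ l2_ball IHk)).
          simpl pow. nra.
        * apply conv_ball; auto using l2_ball. }
  exists Wb. apply (ball_lim _ l2_ball _ (fun k => lwt t (picard f e k))); auto.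
  intros j. unfold lwt. apply Cv_scale. intros d hd.
  destruct (half_pow_small B d hB hd) as [k0 hk0]. exists k0. intros k hk.
  rewrite Cmod_sub_sym. eapply Rle_trans; [apply (ball_point _ l2_ball _ _ j (P3 k))|]. auto.
Qed.

(** Given [w] in the kernel, [v = u + w - g w] solves the same problem: [C^- v = C^- u - w] and
    [C^+ v = C^+ u - g w], so the two changes cancel. Regularity puts [v] in [H^t], and uniqueness
    gives [w = g w], whose two sides live on disjoint half-lines. *)
Lemma kernel_minus_trivial t A G B m g u w : 1 <= t -> l1 A g -> l2 G (lwt t g) -> 0 < m ->
  (forall theta, m <= Cmod (circ_val g theta)) -> in_Hs t u -> RHP_sol g u ->
  (forall v, in_Hs t v -> RHP_sol g v -> forall j, v j = u j) -> l2 B w ->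
  (forall j, (0 <= j)%Z -> w j = 0%C) -> (forall j, (j < 0)%Z -> mult_op g w j = 0%C) ->
  forall j, w j = 0%C.
Proof.
  intros ht Hg HG hm Hm Hu Hsol Huniq Hw Hw0 Hgw.
  destruct (kernel_regularity t A G B m g w) as [B' HB']; auto.
  destruct (in_Hs_l2 t u Hu) as [U HU].
  pose (p := mult_op g w). pose (v := ladd u (lsub w p)).
  assert (Hv : l2 (U + (B' + Rpower 2 t * (4 * (B' + 1) * G + A * B'))) (lwt t v)).
  { unfold v. rewrite lwt_ladd, lwt_lsub. apply (ball_add _ l2_ball); auto.
    apply ball_sub; auto using l2_ball. apply l2_lwt_conv; auto; [lra|].
    apply l1_of_lwt with t; auto. }
  assert (Hvs : RHP_sol g v).
  { split.
    - apply l2_in_Hs with (U + (B' + Rpower 2 t * (4 * (B' + 1) * G + A * B'))).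
      apply l2_lwt_mono with t; auto. lra.
    - intros j. destruct Hsol as [_ Hs]. rewrite <- Hs.
      assert (Em : Cauchy_minus v = lsub (Cauchy_minus u) w).
      { apply functional_extensionality. intros i. unfold Cauchy_minus, v, ladd, lsub.
        destruct (Z.ltb_spec i 0).
        - unfold p. rewrite Hgw by auto. ring.
        - rewrite Hw0 by auto. ring. }
      assert (Hui : linf U u) by (apply (ball_linf _ _ _ l2_ball), l2_of_lwt with t; auto; lra).
      rewrite Em, (conv_sub_r A U B); auto.
      + fold p. unfold lsub, Cauchy_plus, v, ladd.
        destruct (Z.leb_spec 0 j).
        * unfold lsub. rewrite Hw0 by auto. ring.
        * unfold p. rewrite Hgw by auto. ring.
      + apply (ball_dom _ linf_ball _ _ u); auto. intros i. unfold Cauchy_minus.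
        destruct (i <? 0)%Z; [rewrite Cmod_opp; lra|rewrite Cmod_0; apply Cmod_ge_0].
      + apply (ball_linf _ _ _ l2_ball Hw). }
  intros j. destruct (Z_lt_le_dec j 0) as [hj|hj]; [|auto].
  pose proof (Huniq v (l2_in_Hs _ _ _ Hv) Hvs j) as E. unfold v, ladd, lsub, p in E.
  rewrite Hgw in E by auto.
  replace (w j) with (u j + (w j - 0) - u j)%C by ring. rewrite E. ring.
Qed.

Lemma small_eigen_trivial B e x : l1 (1/2) e -> linf B x ->
  (forall j, x j = (- mult_op e x j)%C) -> forall j, x j = 0%C.
Proof.
  intros He Hx H j.
  assert (hB := ball_nonneg _ _ _ linf_ball Hx).
  assert (P : forall k, linf (B * (1/2)^k) x).
  { induction k; [simpl; rewrite Rmult_1_r; auto|].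
    intros i. rewrite H, Cmod_opp.
    apply Rle_trans with (1/2 * (B * (1/2)^k)); [|right; simpl; ring].
    apply (conv_ball _ _ _ _ _ linf_ball He IHk). }
  apply Cmod_eq0_eps. intros d hd.
  destruct (half_pow_small B d hB hd) as [k0 hk0].
  eapply Rle_trans; [apply (P k0)|]. auto.
Qed.

(** Formal power series have no zero divisors. With [k] the lowest index where [b] is nonzero, the
    coefficient of the product at [k + n] reduces to [b_k v_n] once the earlier [v] vanish. All sums
    are finite, so no decay of [v] enters. *)
Lemma conv_half_line_domain (b v : lseq) :
  (forall j, (j < 0)%Z -> b j = 0%C) -> (forall j, (j < 0)%Z -> v j = 0%C) ->
  (forall j, mult_op b v j = 0%C) -> (exists j, b j <> 0%C) -> forall j, v j = 0%C.
Proof.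
  intros Hb Hv H [j0 hj0].
  assert (exists k : nat, b (Z.of_nat k) <> 0%C /\ forall i, (i < k)%nat -> b (Z.of_nat i) = 0%C)
    as [k [hk hmin]].
  { assert (hj : (0 <= j0)%Z) by (destruct (Z_lt_le_dec j0 0); auto; exfalso; apply hj0; auto).
    assert (W : forall n, b (Z.of_nat n) <> 0%C ->
      exists k : nat, b (Z.of_nat k) <> 0%C /\ forall i, (i < k)%nat -> b (Z.of_nat i) = 0%C).
    { intros n. induction n as [n IH] using lt_wf_ind. intros hn.
      destruct (classic (exists i, (i < n)%nat /\ b (Z.of_nat i) <> 0%C)) as [[i [hi hb]]|N].
      - eapply IH; eauto.
      - exists n. split; auto. intros i hi. apply NNPP. intros hb. apply N. eauto. }
    apply (W (Z.to_nat j0)). rewrite Z2Nat.id; auto. }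
  assert (K : forall n : nat, v (Z.of_nat n) = 0%C).
  { intros n. induction n as [n IH] using lt_wf_ind.
    pose proof (H (Z.of_nat k + Z.of_nat n)%Z) as E. unfold mult_op in E.
    rewrite (zsumC_single _ (Z.of_nat k)) in E.
    - replace (Z.of_nat k + Z.of_nat n - Z.of_nat k)%Z with (Z.of_nat n) in E by lia.
      replace (v (Z.of_nat n)) with (/ b (Z.of_nat k) * (b (Z.of_nat k) * v (Z.of_nat n)))%C
        by (field; auto).
      rewrite E. ring.
    - intros i hi. destruct (Z_lt_le_dec i 0); [rewrite Hb by auto; ring|].
      destruct (Z_lt_le_dec i (Z.of_nat k)).
      + rewrite <- (Z2Nat.id i), hmin by lia. ring.
      + destruct (Z_lt_le_dec (Z.of_nat k + Z.of_nat n - i) 0) as [h|h]; [rewrite (Hv _ h); ring|].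
        rewrite <- (Z2Nat.id (Z.of_nat k + Z.of_nat n - i)), IH by lia. ring. }
  intros j. destruct (Z_lt_le_dec j 0); auto.
  rewrite <- (Z2Nat.id j) by auto. apply K.
Qed.

(* With [a = phi^-] and [b = phi^+ = g a], the sequence [a g v = b v] is supported on two
   disjoint half-lines, hence zero. *)
Lemma kernel_plus_trivial A U B Q g u q v : l1 A g -> l1 U u -> l1 Q q -> RHP_sol g u ->
  l1 (1/2) (lsub (mult_op q g) delta0) -> linf B v ->
  (forall j, (j < 0)%Z -> v j = 0%C) -> (forall j, (0 <= j)%Z -> mult_op g v j = 0%C) ->
  forall j, v j = 0%C.
Proof.
  intros Hg Hu Hq [_ Hsol] He Hv Hv0 Hgv.
  pose (a := ladd delta0 (Cauchy_minus u)). pose (b := ladd delta0 (Cauchy_plus u)).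
  assert (Hum : l1 U (Cauchy_minus u)).
  { revert Hu. apply (ball_dom _ l1_ball). intros i. unfold Cauchy_minus.
    destruct (i <? 0)%Z; [rewrite Cmod_opp; lra|rewrite Cmod_0; apply Cmod_ge_0]. }
  assert (Ha : l1 (1 + U) a) by (apply (ball_add _ l1_ball); auto using l1_delta0).
  assert (Hgi := ball_linf _ _ _ l1_ball Hg). assert (Hai := ball_linf _ _ _ l1_ball Ha).
  assert (Eb : mult_op g a = b).
  { unfold a. rewrite (conv_add_r A 1 U); auto.
    - rewrite (conv_comm 1 A delta0 g), conv_delta_l; auto using l1_delta0.
      apply functional_extensionality. intros j. unfold b, ladd.
      pose proof (Hsol j) as E. unfold lsub in E.
      replace (Cauchy_plus u j) with (Cauchy_plus u j - mult_op g (Cauchy_minus u) j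
         + mult_op g (Cauchy_minus u) j)%C by ring.
      rewrite E. ring.
    - apply (ball_linf _ _ _ l1_ball l1_delta0).
    - apply (ball_linf _ _ _ l1_ball Hum). }
  assert (Hb0 : forall j, (j < 0)%Z -> b j = 0%C).
  { intros j hj. unfold b, ladd, delta0, Cauchy_plus.
    rewrite (proj2 (Z.eqb_neq j 0)), (proj2 (Z.leb_gt 0 j)) by lia. ring. }
  assert (Ha0 : forall j, (0 < j)%Z -> a j = 0%C).
  { intros j hj. unfold a, ladd, delta0, Cauchy_minus.
    rewrite (proj2 (Z.eqb_neq j 0)), (proj2 (Z.ltb_ge j 0)) by lia. ring. }
  apply (conv_half_line_domain b v); auto.
  (* Below 0 the product is read as [b v], both factors starting at index 0; from 0 on as [a (g v)],
     with [a] ending at index 0 and [g v] at -1. *)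
  - intros j. destruct (Z_lt_le_dec j 0) as [hj|hj].
    + unfold mult_op. rewrite (zsumC_finite _ 0); [reflexivity|]. intros k _.
      destruct (Z_lt_le_dec k 0); [rewrite Hb0 by auto; ring|].
      rewrite Hv0 by lia. ring.
    + rewrite <- Eb, <- (conv_comm A (1 + U) g a), (conv_assoc (1 + U) A B) by auto.
      unfold mult_op at 1. rewrite (zsumC_finite _ 0); [reflexivity|]. intros k _.
      destruct (Z_lt_le_dec 0 k); [rewrite Ha0 by auto; ring|].
      rewrite Hgv by lia. ring.
  (* If [phi^+] vanished, [g a = 0] would give [a = - e a] with [e] of norm at most [1/2], hence
     [a = 0]; but [a] has constant coefficient 1. *)
  - apply NNPP. intros N.
    assert (Zb : b = lzero).
    { apply functional_extensionality. intros j. apply NNPP. intros h. apply N. exists j. auto. }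
    assert (Za : forall j, a j = 0%C).
    { apply (small_eigen_trivial (1 + U) (lsub (mult_op q g) delta0)); auto.
      intros j. rewrite (conv_sub_l (Q * A) 1 (1 + U)), conv_delta_l; auto using l1_delta0.
      - rewrite (conv_assoc Q A (1 + U)), Eb, Zb; auto. unfold lsub.
        unfold mult_op at 1. rewrite (zsumC_finite _ 0); [simpl; ring|].
        intros; unfold lzero; ring.
      - apply conv_ball; auto using l1_ball. }
    specialize (Za 0%Z). unfold a, ladd, delta0, Cauchy_minus in Za. simpl in Za.
    apply (f_equal fst) in Za. simpl in Za. lra.
Qed.


(** * Weak compactness and stability of the finite sections *)

(** A subsequence is only required to satisfy [k <= psi k]; this preserves limits and is stable
    under composition. The index [psi k] is chosen within [1/(k+1)] of a cluster point. *)
Lemma bounded_subseq (s : nat -> R) : (forall k, Rabs (s k) <= 1) ->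
  exists psi : nat -> nat, (forall k, (k <= psi k)%nat) /\
    exists l : R, is_lim_seq (fun k => s (psi k)) l.
Proof.
  intros H.
  destruct (Bolzano_Weierstrass s (fun x => -1 <= x <= 1)) as [l hl].
  - apply compact_P3.
  - intros n. specialize (H n). apply Rabs_le_between in H. lra.
  - assert (C : forall k : nat, exists p : nat, (k <= p)%nat /\ Rabs (s p - l) < / (INR k + 1)).
    { intros k. assert (h : 0 < / (INR k + 1)) by (apply Rinv_0_lt_compat; pose proof (pos_INR k); lra).
      destruct (hl (disc l (mkposreal _ h)) k) as [p [hp hd]].
      - exists (mkposreal _ h). intros x hx. exact hx.
      - exists p. split; auto. }
    apply functional_choice in C. destruct C as [psi hpsi]. exists psi. split; [apply hpsi|]. exists l.
    apply is_lim_seq_spec. intros [eps he].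
    pose proof is_lim_seq_inv_INR_plus1 as L.
    apply is_lim_seq_spec in L. destruct (L (mkposreal eps he)) as [N hN]. exists N.
    intros n hn. specialize (hN n hn). simpl in *. rewrite Rminus_0_r in hN.
    apply Rabs_def2 in hN. pose proof (proj2 (hpsi n)). lra.
Qed.

Lemma is_lim_seq_reindex (s : nat -> R) l (r : nat -> nat) N :
  (forall k, (N <= k)%nat -> (k <= r k)%nat) -> is_lim_seq s l -> is_lim_seq (fun k => s (r k)) l.
Proof.
  intros hr. apply filterlim_comp. intros P [n hn]. exists (n + N)%nat. intros k hk.
  apply hn. specialize (hr k ltac:(lia)). lia.
Qed.

Lemma diagonal_subseq (f : nat -> nat -> R) : (forall k i, Rabs (f k i) <= 1) ->
  exists phi : nat -> nat, (forall k, (k <= phi k)%nat) /\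
    forall i, exists l : R, is_lim_seq (fun k => f (phi k) i) l.
Proof.
  intros H.
  (* Boundedness is moved into the conclusion so that choice yields an extraction [E] defined on all
     sequences, with which [Phi] can be built by plain recursion. *)
  assert (C : forall s : nat -> R, exists psi : nat -> nat, (forall k, (k <= psi k)%nat) /\
    ((forall k, Rabs (s k) <= 1) -> exists l : R, is_lim_seq (fun k => s (psi k)) l)).
  { intros s. destruct (classic (forall k, Rabs (s k) <= 1)) as [h|h].
    - destruct (bounded_subseq s h) as [psi [h1 h2]]. exists psi. auto.
    - exists (fun k => k). split; [auto|]. tauto. }
  apply functional_choice in C. destruct C as [E HE].
  pose (Phi := fix Phi (i : nat) : nat -> nat :=
    match i with O => (fun k => k) | S i => fun k => Phi i (E (fun k => f (Phi i k) i) k) end).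
  assert (inc : forall i d, exists r : nat -> nat, (forall k, (k <= r k)%nat) /\
     forall k, Phi (d + i)%nat k = Phi i (r k)).
  { intros i d. induction d as [|d [r [hr E1]]].
    - exists (fun k => k). auto.
    - exists (fun k => r (E (fun k => f (Phi (d + i)%nat k) (d + i)%nat) k)). split.
      + intros k. pose proof (proj1 (HE (fun k => f (Phi (d + i)%nat k) (d + i)%nat)) k).
        pose proof (hr (E (fun k => f (Phi (d + i)%nat k) (d + i)%nat) k)). lia.
      + intros k. simpl. apply E1. }
  exists (fun k => Phi k k). split.
  - intros k. destruct (inc 0%nat k) as [r [hr Er]].
    replace (Phi k k) with (Phi (k + 0)%nat k) by (f_equal; lia). rewrite Er. apply hr.
  - intros i.
    destruct (proj2 (HE (fun k => f (Phi i k) i))) as [l hl]; [intros; apply H|].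
    exists l.
    (* From [k = i + 1] on, the diagonal runs inside the subsequence already extracted for
       coordinate [i]; earlier terms are irrelevant to the limit. *)
    assert (R : forall k, exists p, (S i <= k -> k <= p /\ Phi k k = Phi (S i) p)%nat).
    { intros k. destruct (Nat.le_gt_cases (S i) k) as [h|h].
      - destruct (inc (S i) (k - S i)%nat) as [r [hr Er]]. exists (r k). intros _.
        split; [apply hr|]. rewrite <- Er. f_equal. lia.
      - exists 0%nat. lia. }
    apply functional_choice in R. destruct R as [r hr].
    apply is_lim_seq_ext_loc with
      (fun k => f (Phi i (E (fun k => f (Phi i k) i) (r k))) i).
    + exists (S i). intros k hk. now rewrite (proj2 (hr k hk)).
    + apply (is_lim_seq_reindex (fun p => f (Phi i (E (fun k => f (Phi i k) i) p)) i) l r (S i)); auto.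
      intros k hk. apply hr; auto.
Qed.

Definition zdec (n : nat) : Z :=
  if Nat.even n then Z.of_nat (Nat.div2 n) else (- Z.of_nat (Nat.div2 n) - 1)%Z.

Lemma zdec_surj j : exists n, zdec n = j.
Proof.
  unfold zdec. destruct (Z_lt_le_dec j 0).
  - exists (S (2 * Z.to_nat (- j - 1)))%nat.
    rewrite Nat.even_succ, <- Nat.negb_even, Nat.even_mul. simpl negb. cbv iota.
    rewrite Nat.div2_succ_double. lia.
  - exists (2 * Z.to_nat j)%nat. rewrite Nat.even_mul. simpl orb. cbv iota.
    rewrite Nat.div2_double. lia.
Qed.

(** Real and imaginary parts are interleaved as even and odd coordinates, so a single diagonal
    extraction treats all coefficients. *)
Lemma weak_compactness (x : nat -> lseq) : (forall k, linf 1 (x k)) ->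
  exists (phi : nat -> nat) (y : lseq), (forall k, (k <= phi k)%nat) /\
    forall j, Cv (fun k => x (phi k) j) (y j).
Proof.
  intros H.
  destruct (diagonal_subseq (fun k i => if Nat.even i then Re (x k (zdec (Nat.div2 i)))
    else Im (x k (zdec (Nat.div2 i))))) as [phi [hphi hl]].
  - intros k i. specialize (H k (zdec (Nat.div2 i))). destruct (Nat.even i).
    + eapply Rle_trans; [apply re_le_Cmod|auto].
    + eapply Rle_trans; [apply im_le_Cmod|auto].
  - exists phi.
    assert (C : forall j, exists l, Cv (fun k => x (phi k) j) l).
    { intros j. destruct (zdec_surj j) as [n hn].
      destruct (hl (2 * n)%nat) as [a ha]. destruct (hl (S (2 * n))) as [b hb].
      rewrite Nat.even_succ, <- Nat.negb_even in hb.
      rewrite Nat.even_mul, Nat.div2_double in ha. rewrite Nat.even_mul, Nat.div2_succ_double in hb.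
      simpl in ha, hb. rewrite hn in ha, hb. exists (a, b). apply Cv_of_components; auto. }
    apply functional_choice in C. destruct C as [y hy]. exists y. auto.
Qed.

Definition negwin (n : nat) (j : Z) : bool := ((- Z.of_nat n <=? j) && (j <? 0))%Z%bool.

Lemma negwin_true n j : negwin n j = true <-> (- Z.of_nat n <= j < 0)%Z.
Proof. unfold negwin. rewrite Bool.andb_true_iff, Z.leb_le, Z.ltb_lt. tauto. Qed.

Lemma negwin_false n j : negwin n j = false <-> (j < - Z.of_nat n \/ 0 <= j)%Z.
Proof. unfold negwin. rewrite Bool.andb_false_iff, Z.leb_gt, Z.ltb_ge. tauto. Qed.

(* [edge y n m] restricts [y] to the [m] indices on each side of [-n, -1]. *)
Fixpoint edge (y : lseq) (n m : nat) : lseq :=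
  match m with
  | O => lzero
  | S i => ladd (edge y n i)
      (ladd (lscal (y (Z.of_nat i)) (lshift (Z.of_nat i) delta0))
        (lscal (y (- Z.of_nat n - 1 - Z.of_nat i)%Z) (lshift (- Z.of_nat n - 1 - Z.of_nat i) delta0)))
  end.

(** The [l1] norm of [edge], which dominates its [l2] norm. The factors [* 1] are the norms of the
    shifted [delta0], kept so that the bound matches the ball axioms as written. *)
Fixpoint edge_size (y : lseq) (n m : nat) : R :=
  match m with
  | O => 0
  | S i => edge_size y n i + (Cmod (y (Z.of_nat i)) * 1 + Cmod (y (- Z.of_nat n - 1 - Z.of_nat i)%Z) * 1)
  end.

Lemma edge_l2 y n m : l2 (edge_size y n m) (edge y n m).
Proof.
  induction m; simpl; [apply (ball_zero _ l2_ball)|].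
  apply (ball_add _ l2_ball); auto. apply (ball_add _ l2_ball);
  apply (ball_scal _ l2_ball), ball_lshift; auto using l2_ball, l2_delta0.
Qed.

Lemma lshift_delta0 k j : lshift k delta0 j = if (j =? k)%Z then 1%C else 0%C.
Proof.
  unfold lshift, delta0. destruct (Z.eqb_spec j k).
  - subst. now rewrite Z.sub_diag.
  - rewrite (proj2 (Z.eqb_neq (j - k) 0)) by lia. auto.
Qed.

Lemma edge_in_iff y n m j :
  ((0 <= j < Z.of_nat m \/ - Z.of_nat n - Z.of_nat m <= j < - Z.of_nat n)%Z ->
     edge y n m j = y j) /\
  (~ (0 <= j < Z.of_nat m \/ - Z.of_nat n - Z.of_nat m <= j < - Z.of_nat n)%Z ->
     edge y n m j = 0%C).
Proof.
  induction m as [|m [IH1 IH2]]; simpl edge.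
  - split; intros h; [lia|reflexivity].
  - unfold ladd, lscal. rewrite !lshift_delta0.
    destruct (Z.eqb_spec j (Z.of_nat m)) as [->|h1].
    + rewrite (proj2 (Z.eqb_neq (Z.of_nat m) (- Z.of_nat n - 1 - Z.of_nat m))) by lia.
      rewrite IH2 by lia. split; intros; [ring|lia].
    + destruct (Z.eqb_spec j (- Z.of_nat n - 1 - Z.of_nat m)) as [->|h2].
      * rewrite IH2 by lia. split; intros; [ring|lia].
      * split; intros h; [rewrite IH1 by lia|rewrite IH2 by lia]; ring.
Qed.

(** On the section, [v = q (g v) - e v], and [q] reaches at most [m] places. So [g v] enters only
    through its part on the section, of size [B], and its values at the two edges; the last term
    costs [1/2]. *)
Lemma section_estimate A Q m n (g q v : lseq) B : l1 A g -> l1 Q q ->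
  (forall j, in_win m j = false -> q j = 0%C) ->
  l1 (1/2) (lsub (mult_op q g) delta0) ->
  (forall j, negwin n j = false -> v j = 0%C) -> l2 1 v ->
  l2 B (mask (negwin n) (mult_op g v)) ->
  l2 (1/2 * 1 + (Q * B + Q * edge_size (mult_op g v) n m)) v.
Proof.
  intros Hg Hq Hqs He Hvs Hv HB. set (y := mult_op g v) in *.
  assert (Hvi := ball_linf _ _ _ l2_ball Hv).
  assert (Hy : linf (A * 1) y) by (apply conv_ball; auto using linf_ball).
  set (e := lsub (mult_op q g) delta0) in *.
  assert (HQy : linf B (mask (negwin n) y)) by (apply (ball_linf _ _ _ l2_ball HB)).
  assert (Hed := edge_l2 y n m). assert (Hedi := ball_linf _ _ _ l2_ball Hed).
  apply (ball_dom _ l2_ball _ _ (mask (negwin n) (lsub (ladd (mult_op q (mask (negwin n) y))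
     (mult_op q (edge y n m))) (mult_op e v)))).
  - intros j. unfold mask at 1. destruct (negwin n j) eqn:hj.
    2:{ rewrite Hvs by auto. rewrite Cmod_0. lra. }
    right. f_equal.
    assert (E1 : mult_op q y = ladd (mult_op e v) v).
    { unfold y, e. rewrite (conv_sub_l (Q * A) 1 1), conv_delta_l, (conv_assoc Q A 1);
        auto using l1_delta0; [|apply conv_ball; auto using l1_ball].
      apply functional_extensionality. intros i. unfold ladd, lsub. ring. }
    assert (E2 : mult_op q (lsub y (ladd (mask (negwin n) y) (edge y n m))) j = 0%C).
    { unfold mult_op. rewrite (zsumC_finite _ 0); [reflexivity|]. intros k _.
      destruct (in_win m k) eqn:hk; [|rewrite Hqs by auto; ring].
      apply in_win_true in hk. apply negwin_true in hj.
      unfold lsub, ladd, mask. destruct (negwin n (j - k)) eqn:hjk.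
      - apply negwin_true in hjk. rewrite (proj2 (edge_in_iff y n m (j - k))) by lia. ring.
      - apply negwin_false in hjk. rewrite (proj1 (edge_in_iff y n m (j - k))) by lia. ring. }
    rewrite (conv_sub_r Q (A * 1) (B + edge_size y n m)) in E2; auto.
    2:{ apply (ball_add _ linf_ball); auto. }
    rewrite (conv_add_r Q B (edge_size y n m)) in E2; auto.
    rewrite E1 in E2. unfold lsub, ladd in *.
    match type of E2 with ?d = _ => transitivity (v j - d)%C; [rewrite E2; ring|ring] end.
  - apply mask_ball; [apply l2_ball|].
    rewrite (Rplus_comm (1/2 * 1)). apply ball_sub; auto using l2_ball.
    + apply (ball_add _ l2_ball); apply (conv_ball l2); auto using l2_ball.
    + apply (conv_ball l2); auto using l2_ball.
Qed.

Lemma inv_INR_small eps : 0 < eps -> exists N, forall k, (N <= k)%nat -> / (INR k + 1) <= eps.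
Proof.
  intros he. destruct (nfloor_ex (/ eps)) as [N hN]; [left; apply Rinv_0_lt_compat; auto|].
  exists N. intros k hk. apply le_INR in hk.
  rewrite <- (Rinv_inv eps). apply Rinv_le_contravar; [apply Rinv_0_lt_compat; auto|lra].
Qed.

Lemma edge_size_vanish (y : nat -> lseq) (n : nat -> nat) m :
  (forall i, (0 <= i)%Z -> Cv (fun k => y k i) 0) ->
  (forall i, (i < 0)%Z -> Cv (fun k => y k (i - Z.of_nat (n k))%Z) 0) ->
  forall eps, 0 < eps -> exists N, forall k, (N <= k)%nat -> edge_size (y k) (n k) m <= eps.
Proof.
  intros H1 H2. induction m; intros eps he; simpl.
  - exists 0%nat. intros. lra.
  - destruct (IHm (eps / 2)) as [N hN]; [lra|].
    destruct (H1 (Z.of_nat m) ltac:(lia) (eps / 4)) as [N1 hN1]; [lra|].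
    destruct (H2 (- 1 - Z.of_nat m)%Z ltac:(lia) (eps / 4)) as [N2 hN2]; [lra|].
    exists (N + N1 + N2)%nat. intros k hk.
    specialize (hN k ltac:(lia)). specialize (hN1 k ltac:(lia)). specialize (hN2 k ltac:(lia)).
    replace (- 1 - Z.of_nat m - Z.of_nat (n k))%Z with (- Z.of_nat (n k) - 1 - Z.of_nat m)%Z in hN2 by lia.
    unfold Cminus in hN1, hN2. rewrite Copp_0, Cplus_0_r in hN1, hN2. lra.
Qed.

(* A failing sequence of unit vectors would have weak limits at both ends of the section;
   these lie in the two kernels, hence vanish, which contradicts [section_estimate]. *)
Lemma finite_section_stability A Q m g q : l1 A g -> l1 Q q ->
  (forall j, in_win m j = false -> q j = 0%C) ->
  l1 (1/2) (lsub (mult_op q g) delta0) ->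
  (forall B w, l2 B w -> (forall j, (0 <= j)%Z -> w j = 0%C) ->
    (forall j, (j < 0)%Z -> mult_op g w j = 0%C) -> forall j, w j = 0%C) ->
  (forall B w, linf B w -> (forall j, (j < 0)%Z -> w j = 0%C) ->
    (forall j, (0 <= j)%Z -> mult_op g w j = 0%C) -> forall j, w j = 0%C) ->
  exists (K : R) (n0 : nat), 0 <= K /\ forall n (v : lseq) B, (n0 <= n)%nat ->
    (forall j, negwin n j = false -> v j = 0%C) ->
    l2 B (mask (negwin n) (mult_op g v)) -> l2 (K * B) v.
Proof.
  intros Hg Hq Hqs He K1 K2. apply NNPP. intros N.
  assert (hQ := ball_nonneg _ _ _ l1_ball Hq).
  (* Failure of the claim with constant [k + 1] and threshold [k], after normalization. The norm is
     recorded as an equality because [l2 1] is only an upper bound and could not contradict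
     anything. *)
  assert (C : forall k : nat, exists p : nat * lseq, (k <= fst p)%nat /\
    (forall j, negwin (fst p) j = false -> snd p j = 0%C) /\ l2 1 (snd p) /\
    wsum (fun j => (Cmod (snd p j))^2) (fst p) = 1 /\
    l2 (/ (INR k + 1)) (mask (negwin (fst p)) (mult_op g (snd p)))).
  { intros k. pose proof (pos_INR k) as hk. apply NNPP. intros Nk. apply N.
    exists (INR k + 1), k. split; [lra|]. intros n v B hn Hvs HB.
    assert (hB := ball_nonneg _ _ _ l2_ball HB).
    assert (Hvw : forall j, in_win n j = false -> v j = 0%C).
    { intros j hj. apply Hvs. apply in_win_false in hj. apply negwin_false. lia. }
    assert (Hl := l2_finite v n Hvw). set (nv := sqrt (wsum (fun j => (Cmod (v j))^2) n)) in *.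
    destruct (Rle_lt_dec nv ((INR k + 1) * B)) as [h|h].
    { apply (ball_weaken _ l2_ball nv); auto. }
    exfalso. apply Nk. assert (hnv : 0 < nv) by nra.
    assert (hc : Cmod (RtoC (/ nv)) = / nv).
    { rewrite Cmod_R, Rabs_right; auto. left. apply Rinv_0_lt_compat; auto. }
    exists (n, lscal (RtoC (/ nv)) v). simpl. split; auto. split; [|split; [|split]].
    - intros j hj. unfold lscal. rewrite Hvs by auto. ring.
    - replace 1 with (Cmod (RtoC (/ nv)) * nv) by (rewrite hc; field; lra).
      apply (ball_scal _ l2_ball); auto.
    - change (wsum (fun j => (Cmod (lscal (RtoC (/ nv)) v j))^2) n = 1).
      rewrite (wsum_ext _ (fun j => (/ nv)^2 * (Cmod (v j))^2)), wsum_scal.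
      2:{ intros j _. unfold lscal. rewrite Cmod_mult, hc. ring. }
      replace (wsum (fun j => (Cmod (v j))^2) n) with (nv^2); [field; lra|].
      unfold nv. rewrite pow2_sqrt; auto. apply wsum_nonneg. intros; apply pow2_ge_0.
    - rewrite (conv_scal_r A nv); auto using (ball_linf _ _ _ l2_ball Hl).
      apply (ball_weaken _ l2_ball (Cmod (RtoC (/ nv)) * B)).
      + rewrite hc. apply Rmult_le_reg_l with (nv * (INR k + 1)); [apply Rmult_lt_0_compat; lra|].
        replace (nv * (INR k + 1) * (/ nv * B)) with ((INR k + 1) * B) by (field; lra).
        replace (nv * (INR k + 1) * / (INR k + 1)) with nv by (field; lra). lra.
      + apply (ball_dom _ l2_ball _ _ (lscal (RtoC (/ nv)) (mask (negwin n) (mult_op g v)))).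
        * intros j. unfold mask, lscal. destruct (negwin n j); [lra|].
          rewrite Cmult_0_r. lra.
        * apply (ball_scal _ l2_ball); auto. }
  apply functional_choice in C. destruct C as [p hp].
  pose (n := fun k => fst (p k)). pose (v := fun k => snd (p k)).
  assert (Hn : forall k, (k <= n k)%nat) by (intros k; apply (hp k)).
  assert (Hvs : forall k j, negwin (n k) j = false -> v k j = 0%C) by (intros k; apply (hp k)).
  assert (Hv : forall k, l2 1 (v k)) by (intros k; apply (hp k)).
  assert (Hv1 : forall k, wsum (fun j => (Cmod (v k j))^2) (n k) = 1) by (intros k; apply (hp k)).
  assert (Hgv : forall k, l2 (/ (INR k + 1)) (mask (negwin (n k)) (mult_op g (v k))))
    by (intros k; apply (hp k)).
  clearbody n v. clear hp p N.
  assert (Hvi : forall k, linf 1 (v k)) by (intros k; apply (ball_linf _ _ _ l2_ball (Hv k))).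
  assert (Hsm : forall k j, negwin (n k) j = true -> Cmod (mult_op g (v k) j) <= / (INR k + 1)).
  { intros k j hj. pose proof (ball_point _ l2_ball _ _ j (Hgv k)) as h.
    unfold mask in h. rewrite hj in h. auto. }
  (* This limit keeps the indices and sees the end of the section at -1. The next one, along a
     further subsequence, is taken after a shift by [n], which brings the other end [-n] to 0. *)
  destruct (weak_compactness v Hvi) as (phi1 & w & hphi1 & Hw).
  destruct (weak_compactness (fun k => lshift (Z.of_nat (n (phi1 k))) (v (phi1 k)))) as (phi2 & w' & hphi2 & Hw').
  { intros k. apply ball_lshift; auto using linf_ball. }
  pose (phi := fun k => phi1 (phi2 k)).
  assert (hphi : forall k, (k <= phi k)%nat).
  { intros k. unfold phi. pose proof (hphi2 k). pose proof (hphi1 (phi2 k)). lia. }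
  assert (Lw : forall j, Cv (fun k => v (phi k) j) (w j)).
  { intros j. apply (Cv_subseq (fun k => v (phi1 k) j) (w j) phi2); auto. }
  assert (Lw' : forall j, Cv (fun k => lshift (Z.of_nat (n (phi k))) (v (phi k)) j) (w' j)) by auto.
  assert (Lg : forall j, Cv (fun k => mult_op g (v (phi k)) j) (mult_op g w j)).
  { intros j. apply conv_Cv_pointwise with A 1; auto. }
  assert (Lg' : forall j, Cv (fun k => mult_op g (v (phi k)) (j - Z.of_nat (n (phi k)))%Z) (mult_op g w' j)).
  { intros j. apply Cv_ext with (fun k => mult_op g (lshift (Z.of_nat (n (phi k))) (v (phi k))) j).
    - intros k. rewrite conv_shift_r. reflexivity.
    - apply conv_Cv_pointwise with A 1; auto. intros k. apply ball_lshift; auto using linf_ball. }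
  assert (small : forall eps, 0 < eps -> exists N, forall k, (N <= k)%nat -> / (INR (phi k) + 1) <= eps).
  { intros eps he. destruct (inv_INR_small eps he) as [N h]. exists N. intros k hk. apply h.
    specialize (hphi k). lia. }
  assert (Zw : forall j, w j = 0%C).
  { apply (K1 1).
    - apply (ball_lim _ l2_ball _ (fun k => v (phi k))); auto.
    - intros j hj. apply Cv_unique with (fun k => v (phi k) j); auto.
      apply Cv_eventually with 0%nat. intros k _. apply Hvs. apply negwin_false. lia.
    - intros j hj. apply Cv_unique with (fun k => mult_op g (v (phi k)) j); auto.
      intros eps he. destruct (small eps he) as [N h]. exists (N + Z.to_nat (- j))%nat.
      intros k hk. unfold Cminus. rewrite Copp_0, Cplus_0_r.
      eapply Rle_trans; [apply Hsm|apply h; lia].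
      apply negwin_true. pose proof (Hn (phi k)). pose proof (hphi k). lia. }
  assert (Zw' : forall j, w' j = 0%C).
  { apply (K2 1).
    - apply (ball_lim _ linf_ball _ (fun k => lshift (Z.of_nat (n (phi k))) (v (phi k)))); auto.
      intros k. apply ball_lshift; auto using linf_ball.
    - intros j hj. apply Cv_unique with (fun k => lshift (Z.of_nat (n (phi k))) (v (phi k)) j); auto.
      apply Cv_eventually with 0%nat. intros k _. apply Hvs. apply negwin_false. lia.
    - intros j hj. apply Cv_unique with (fun k => mult_op g (v (phi k)) (j - Z.of_nat (n (phi k)))%Z); auto.
      intros eps he. destruct (small eps he) as [N h]. exists (N + S (Z.to_nat j))%nat.
      intros k hk. unfold Cminus. rewrite Copp_0, Cplus_0_r.
      eapply Rle_trans; [apply Hsm|apply h; lia].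
      apply negwin_true. pose proof (Hn (phi k)). pose proof (hphi k). lia. }
  assert (conv0 : forall z : lseq, (forall j, z j = 0%C) -> forall j, mult_op g z j = 0%C).
  { intros z hz j. unfold mult_op. rewrite (zsumC_finite _ 0); [reflexivity|].
    intros i _. rewrite hz. ring. }
  (* As both limits vanish, [g v] tends to zero at each place beyond either end. With the threshold
     [1/(8 (Q+1))] the section estimate gives [1/2 + 1/8 + 1/8 = 3/4], below the norm 1. *)
  destruct (edge_size_vanish (fun k => mult_op g (v (phi k))) (fun k => n (phi k)) m)
    with (eps := / (8 * (Q + 1))) as [N1 hN1].
  { intros i _. rewrite <- (conv0 w Zw i). auto. }
  { intros i _. rewrite <- (conv0 w' Zw' i). auto. }
  { apply Rinv_0_lt_compat. lra. }
  destruct (small (/ (8 * (Q + 1)))) as [N2 hN2].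
  { apply Rinv_0_lt_compat. lra. }
  specialize (hN1 (N1 + N2)%nat ltac:(lia)). specialize (hN2 (N1 + N2)%nat ltac:(lia)).
  set (k := phi (N1 + N2)%nat) in *.
  pose proof (section_estimate A Q m (n k) g q (v k) (/ (INR k + 1)) Hg Hq Hqs He (Hvs k) (Hv k) (Hgv k)) as F.
  assert (h8 : Q * / (8 * (Q + 1)) <= 1 / 8).
  { apply Rmult_le_reg_r with (8 * (Q + 1)); [lra|]. rewrite Rmult_assoc, Rinv_l by lra. lra. }
  assert (F' : l2 (3/4) (v k)).
  { apply (ball_weaken _ l2_ball _ (3/4)) in F; auto.
    assert (Q * / (INR k + 1) <= Q * / (8 * (Q + 1))) by (apply Rmult_le_compat_l; auto).
    assert (Q * edge_size (mult_op g (v k)) (n k) m <= Q * / (8 * (Q + 1))) by (apply Rmult_le_compat_l; auto).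
    lra. }
  destruct F' as [_ F']. specialize (F' (n k)). rewrite Hv1 in F'. lra.
Qed.


(** * Invertibility on the range of P_N *)

Definition skip (p i : nat) : nat := if (i <? p)%nat then i else S i.

Lemma nsum_skip f n p : (p <= n)%nat ->
  nsum f (S n) = (f p + nsum (fun i => f (skip p i)) n)%C.
Proof.
  induction n; intros hp.
  - replace p with 0%nat by lia. simpl. ring.
  - destruct (Nat.eq_dec p (S n)) as [->|h].
    + rewrite (nsum_ext (fun i => f (skip (S n) i)) f).
      * simpl. ring.
      * intros l hl. unfold skip. now rewrite (proj2 (Nat.ltb_lt l (S n))) by lia.
    + change (nsum f (S (S n))) with (nsum f (S n) + f (S n))%C.
      rewrite IHn by lia. simpl nsum. unfold skip at 3.
      rewrite (proj2 (Nat.ltb_ge n p)) by lia. ring.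
Qed.

(** Gaussian elimination by induction. If the last equation has a nonzero coefficient, its unknown
    is eliminated from the others; if not, the last unknown is set to 0. *)
Lemma homogeneous_system n : forall M : nat -> nat -> C, exists x : nat -> C,
  (exists i, (i <= n)%nat /\ x i <> 0%C) /\
  forall r, (r < n)%nat -> nsum (fun i => M r i * x i)%C (S n) = 0%C.
Proof.
  induction n; intros M.
  - exists (fun _ => 1%C). split; [|lia]. exists 0%nat. split; auto. apply C1_nz.
  - destruct (classic (exists p, (p <= S n)%nat /\ M n p <> 0%C)) as [[p [hp hM]]|N].
    + destruct (IHn (fun r i => M r (skip p i) - M r p * (M n (skip p i) / M n p))%C)
        as [x [[i0 [hi0 hx]] Hx]].
      pose (y := (- nsum (fun i => M n (skip p i) * x i) (S n) / M n p)%C).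
      pose (z := fun k => if (k =? p)%nat then y else x (if (k <? p)%nat then k else pred k)).
      assert (zp : z p = y) by (unfold z; now rewrite Nat.eqb_refl).
      assert (zs : forall i, z (skip p i) = x i).
      { intros i. unfold z, skip. destruct (Nat.ltb_spec i p).
        - rewrite (proj2 (Nat.eqb_neq i p)), (proj2 (Nat.ltb_lt i p)) by lia. auto.
        - rewrite (proj2 (Nat.eqb_neq (S i) p)), (proj2 (Nat.ltb_ge (S i) p)) by lia. auto. }
      exists z. split.
      * exists (skip p i0). rewrite zs. split; auto. unfold skip. destruct (i0 <? p)%nat; lia.
      * intros r hr. rewrite (nsum_skip _ (S n) p hp), zp.
        rewrite (nsum_ext _ (fun i => M r (skip p i) * x i)%C) by (intros; now rewrite zs).
        destruct (Nat.eq_dec r n) as [->|h].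
        { unfold y. field. auto. }
        specialize (Hx r ltac:(lia)).
        rewrite (nsum_ext _ (fun i => M r (skip p i) * x i
          + (- M r p / M n p) * (M n (skip p i) * x i))%C) in Hx.
        2:{ intros; field; auto. }
        rewrite nsum_plus, nsum_scal in Hx. rewrite <- Hx. unfold y. field. auto.
    + destruct (IHn M) as [x [[i0 [hi0 hx]] Hx]].
      exists (fun i => if (i =? S n)%nat then RtoC 0 else x i). split.
      * exists i0. rewrite (proj2 (Nat.eqb_neq i0 (S n))) by lia. auto.
      * intros r hr. change (nsum ?f (S (S n))) with (nsum f (S n) + f (S n))%C.
        destruct (Nat.eq_dec r n) as [->|h].
        { assert (Z : forall i, (i <= S n)%nat -> M n i = 0%C).
          { intros i hi. apply NNPP. intros h. apply N. eauto. }
          rewrite (nsum_ext _ (fun _ => 0%C)), nsum_const by (intros; rewrite Z by lia; ring).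
          rewrite Z by lia. ring. }
        rewrite (nsum_ext _ (fun i => M r i * x i)%C).
        { rewrite Hx by lia. rewrite Nat.eqb_refl. ring. }
        intros i hi. rewrite (proj2 (Nat.eqb_neq i (S n))) by lia. auto.
Qed.

Definition nneg (j : Z) : bool := (0 <=? j)%Z.

Lemma in_window_true N j : in_window N j = true <->
  (- Z.of_nat (N / 2) <= j <= Z.of_nat ((N - 1) / 2))%Z.
Proof.
  unfold in_window, Nminus, Nplus. rewrite Bool.andb_true_iff, !Z.leb_le. tauto.
Qed.

Lemma in_window_index N i : (i < N)%nat -> in_window N (Z.of_nat i - Z.of_nat (N / 2)) = true.
Proof.
  intros h. apply in_window_true.
  pose proof (Nat.div_mod_eq N 2). pose proof (Nat.mod_upper_bound N 2 ltac:(lia)).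
  pose proof (Nat.div_mod_eq (N-1) 2). pose proof (Nat.mod_upper_bound (N-1) 2 ltac:(lia)). lia.
Qed.

Lemma in_window_index_inv N j : in_window N j = true -> (0 < N)%nat ->
  exists i, (i < N)%nat /\ j = (Z.of_nat i - Z.of_nat (N / 2))%Z.
Proof.
  intros h hN. apply in_window_true in h. exists (Z.to_nat (j + Z.of_nat (N / 2))).
  pose proof (Nat.div_mod_eq N 2). pose proof (Nat.mod_upper_bound N 2 ltac:(lia)).
  pose proof (Nat.div_mod_eq (N-1) 2). pose proof (Nat.mod_upper_bound (N-1) 2 ltac:(lia)). lia.
Qed.

Lemma negwin_in_window N j : negwin (N / 2) j = (in_window N j && (j <? 0)%Z)%bool.
Proof.
  apply Bool.eq_iff_eq_true.
  rewrite Bool.andb_true_iff, negwin_true, in_window_true, Z.ltb_lt. lia.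
Qed.

Lemma PN_mask N x : PN N x = mask (in_window N) x.
Proof. reflexivity. Qed.

Lemma mask_ladd p x y : mask p (ladd x y) = ladd (mask p x) (mask p y).
Proof.
  apply functional_extensionality. intros j. unfold mask, ladd. destruct (p j); ring.
Qed.

Lemma mask_lsub p x y : mask p (lsub x y) = lsub (mask p x) (mask p y).
Proof.
  apply functional_extensionality. intros j. unfold mask, lsub. destruct (p j); ring.
Qed.

Lemma mask_lscal p c x : mask p (lscal c x) = lscal c (mask p x).
Proof.
  apply functional_extensionality. intros j. unfold mask, lscal. destruct (p j); ring.
Qed.

(** The minus sign in [Cauchy_minus] turns the difference into a sum, and the triangular structure
    becomes visible: the negative indices of the output involve only the Toeplitz section of length
    [N / 2]. *)
Lemma trunc_op_eq A B N g v : l1 A g -> linf B v ->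
  trunc_op N g v = ladd (mask nneg v)
    (mask (in_window N) (mult_op g (mask (negwin (N / 2)) v))).
Proof.
  intros Hg Hv. unfold trunc_op, MN. rewrite !PN_mask.
  replace (mask (in_window N) (Cauchy_minus v)) with (lscal (-(1)) (mask (negwin (N / 2)) v)).
  - rewrite (conv_scal_r A B), mask_lscal by (auto; apply mask_ball; auto using linf_ball).
    apply functional_extensionality. intros j.
    unfold ladd, lsub, lscal, Cauchy_plus, mask, nneg. ring.
  - apply functional_extensionality. intros j. unfold lscal, mask, Cauchy_minus.
    rewrite negwin_in_window. destruct (in_window N j), (j <? 0)%Z; simpl; ring.
Qed.

Lemma trunc_op_ladd A B D N g v w : l1 A g -> linf B v -> linf D w ->
  trunc_op N g (ladd v w) = ladd (trunc_op N g v) (trunc_op N g w).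
Proof.
  intros Hg Hv Hw.
  assert (Hm : forall p a x, linf a x -> linf a (mask p x)) by (intros; apply mask_ball; auto using linf_ball).
  rewrite (trunc_op_eq A B N g v), (trunc_op_eq A D N g w), (trunc_op_eq A (B + D)); auto.
  2:{ apply (ball_add _ linf_ball); auto. }
  rewrite !mask_ladd, (conv_add_r A B D), mask_ladd; auto.
  apply functional_extensionality. intros j. unfold ladd. ring.
Qed.

Lemma trunc_op_lscal A B N c g v : l1 A g -> linf B v ->
  trunc_op N g (lscal c v) = lscal c (trunc_op N g v).
Proof.
  intros Hg Hv.
  assert (Hm : forall p a x, linf a x -> linf a (mask p x)) by (intros; apply mask_ball; auto using linf_ball).
  rewrite (trunc_op_eq A B N g v), (trunc_op_eq A (Cmod c * B)); auto.
  2:{ apply (ball_scal _ linf_ball); auto. }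
  rewrite !mask_lscal, (conv_scal_r A B), mask_lscal; auto.
  apply functional_extensionality. intros j. unfold ladd, lscal. ring.
Qed.

Lemma trunc_op_lsub A B D N g v w : l1 A g -> linf B v -> linf D w ->
  trunc_op N g (lsub v w) = lsub (trunc_op N g v) (trunc_op N g w).
Proof.
  intros Hg Hv Hw. rewrite !lsub_ladd, (trunc_op_ladd A B (Cmod (-(1)) * D)), (trunc_op_lscal A D); auto.
  apply (ball_scal _ linf_ball); auto.
Qed.

Lemma trunc_op_outside N g v j : in_ranPN N v -> in_window N j = false -> trunc_op N g v j = 0%C.
Proof.
  intros Hv hj. unfold trunc_op, lsub, MN, PN, Cauchy_plus. rewrite hj, Hv by auto.
  destruct (0 <=? j)%Z; ring.
Qed.

Lemma in_ranPN_linf N v : in_ranPN N v -> exists B, linf B v.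
Proof.
  intros H. eexists. apply (ball_linf l1), (l1_finite v (S N)); auto using l1_ball.
  intros j hj. apply H. apply Bool.not_true_is_false. intros h.
  apply in_window_true in h. apply in_win_false in hj.
  pose proof (Nat.div_mod_eq N 2). pose proof (Nat.div_mod_eq (N-1) 2). lia.
Qed.

Fixpoint lcomb (E : nat -> lseq) (x : nat -> C) (n : nat) : lseq :=
  match n with O => lzero | S n => ladd (lcomb E x n) (lscal (x n) (E n)) end.

Lemma lcomb_val E x n j : lcomb E x n j = nsum (fun i => x i * E i j)%C n.
Proof. induction n; simpl; auto. unfold ladd, lscal. now rewrite IHn. Qed.

Lemma lcomb_linf E x n : (forall i, linf 1 (E i)) -> exists B, linf B (lcomb E x n).
Proof.
  intros H. induction n as [|n [B hB]]; simpl.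
  - exists 0. apply (ball_zero _ linf_ball).
  - exists (B + Cmod (x n) * 1). apply (ball_add _ linf_ball); auto. apply (ball_scal _ linf_ball); auto.
Qed.

Lemma trunc_op_lcomb A N g E x n j : l1 A g -> (forall i, linf 1 (E i)) ->
  trunc_op N g (lcomb E x n) j = nsum (fun i => x i * trunc_op N g (E i) j)%C n.
Proof.
  intros Hg HE. induction n; simpl.
  - rewrite (trunc_op_eq A 0); auto; [|apply (ball_zero _ linf_ball)].
    unfold ladd, mask, mult_op. rewrite (zsumC_finite _ 0).
    + unfold lzero. simpl. destruct (nneg j), (in_window N j); ring.
    + intros k _. unfold lzero. destruct (negwin _ _); ring.
  - destruct (lcomb_linf E x n HE) as [B hB].
    rewrite (trunc_op_ladd A B (Cmod (x n) * 1)); auto; [|apply (ball_scal _ linf_ball); auto].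
    rewrite (trunc_op_lscal A 1); auto. unfold ladd, lscal. now rewrite IHn.
Qed.

(** Dimension count: the [N] equations [sum x_i T_N(z^i) = x_N w] in [N + 1] unknowns have a
    nontrivial solution. By injectivity [x_N] is nonzero, and dividing by it solves for [w]. *)
Lemma trunc_op_surjective A N g : (0 < N)%nat -> l1 A g ->
  (forall v, in_ranPN N v -> (forall j, trunc_op N g v j = 0%C) -> forall j, v j = 0%C) ->
  forall w, in_ranPN N w -> exists v, in_ranPN N v /\ forall j, trunc_op N g v j = w j.
Proof.
  intros hN Hg Hinj w Hw.
  pose (ix := fun i : nat => (Z.of_nat i - Z.of_nat (N / 2))%Z).
  pose (E := fun i : nat => lshift (ix i) delta0).
  assert (HE : forall i, linf 1 (E i)).
  { intros i. apply ball_lshift; auto using linf_ball. apply (ball_linf _ _ _ l2_ball l2_delta0). }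
  destruct (homogeneous_system N (fun r i => if (i =? N)%nat then - w (ix r)
     else trunc_op N g (E i) (ix r))%C) as [x [[i0 [hi0 hx]] Hx]].
  pose (v := lcomb E x N).
  assert (Hv : in_ranPN N v).
  { intros j hj. unfold v. rewrite lcomb_val, (nsum_ext _ (fun _ => 0%C)), nsum_const; [ring|].
    intros i hi. unfold E. rewrite lshift_delta0. destruct (Z.eqb_spec j (ix i)) as [->|h]; [|ring].
    unfold ix in hj. rewrite in_window_index in hj by auto. discriminate. }
  assert (Hvx : forall i, (i < N)%nat -> v (ix i) = x i).
  { intros i hi. unfold v. rewrite lcomb_val. destruct N as [|N']; [lia|].
    rewrite (nsum_skip _ N' i) by lia. rewrite (nsum_ext _ (fun _ => 0%C)), nsum_const.
    - unfold E. rewrite lshift_delta0, Z.eqb_refl. ring.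
    - intros l hl. unfold E. rewrite lshift_delta0.
      rewrite (proj2 (Z.eqb_neq (ix i) (ix (skip i l)))); [ring|].
      unfold ix, skip. destruct (Nat.ltb_spec l i); lia. }
  assert (HT : forall j, trunc_op N g v j = (x N * w j)%C).
  { intros j. destruct (in_window N j) eqn:hj.
    - destruct (in_window_index_inv N j hj hN) as [r [hr ->]]. fold (ix r).
      specialize (Hx r hr).
      change (nsum ?f (S N)) with (nsum f N + f N)%C in Hx. cbv beta in Hx.
      rewrite Nat.eqb_refl in Hx.
      unfold v. rewrite (trunc_op_lcomb A); auto.
      rewrite (nsum_ext _ (fun i => x i * trunc_op N g (E i) (ix r))%C) in Hx.
      2:{ intros l hl. rewrite (proj2 (Nat.eqb_neq l N)) by lia. ring. }
      match type of Hx with (?s + _)%C = _ =>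
        replace s with (s + - w (ix r) * x N + x N * w (ix r))%C by ring end.
      rewrite Hx. ring.
    - rewrite trunc_op_outside, Hw by auto. ring. }
  assert (hxN : x N <> 0%C).
  { intros E0. apply hx. destruct (Nat.eq_dec i0 N) as [->|h]; auto.
    rewrite <- Hvx by lia. apply Hinj; auto. intros j. rewrite HT, E0. ring. }
  exists (lscal (/ x N) v). split.
  - intros j hj. unfold lscal. rewrite Hv by auto. ring.
  - intros j. destruct (in_ranPN_linf N v Hv) as [B hB].
    rewrite (trunc_op_lscal A B) by auto. unfold lscal. rewrite HT. field. auto.
Qed.

(** Back substitution in the triangular system: the negative part of [v] is at most [K B], and the
    rest is the nonnegative part of [T_N v] minus that of [P_N (g v_-)], at most [B + A K B]. *)
Lemma trunc_op_bounded_below A K N B g v : l1 A g -> in_ranPN N v ->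
  (forall (w : lseq) D, (forall j, negwin (N / 2) j = false -> w j = 0%C) ->
    l2 D (mask (negwin (N / 2)) (mult_op g w)) -> l2 (K * D) w) ->
  l2 B (trunc_op N g v) -> l2 ((K + 1 + A * K) * B) v.
Proof.
  intros Hg Hv HK HB.
  destruct (in_ranPN_linf N v Hv) as [D HD].
  set (vm := mask (negwin (N / 2)) v).
  assert (ET := trunc_op_eq A D N g v Hg HD). fold vm in ET.
  assert (Hvm : l2 (K * B) vm).
  { apply HK.
    - intros j hj. unfold vm, mask. now rewrite hj.
    - apply (ball_dom _ l2_ball _ _ (trunc_op N g v)); auto. intros j. rewrite ET.
      unfold mask at 1. destruct (negwin (N / 2) j) eqn:hj; [|rewrite Cmod_0; apply Cmod_ge_0].
      assert (hj' := hj). rewrite negwin_in_window in hj'. apply andb_prop in hj'.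
      destruct hj' as [h1 h2]. apply Z.ltb_lt in h2.
      unfold ladd, mask, nneg. rewrite h1, (proj2 (Z.leb_gt 0 j)) by auto.
      right. f_equal. ring. }
  replace v with (ladd vm (lsub (mask nneg (trunc_op N g v))
    (mask nneg (mask (in_window N) (mult_op g vm))))).
  - replace ((K + 1 + A * K) * B) with (K * B + (B + A * (K * B))) by ring.
    apply (ball_add _ l2_ball); auto. apply ball_sub; auto using l2_ball.
    + apply mask_ball; auto using l2_ball.
    + apply mask_ball; [apply l2_ball|]. apply mask_ball; [apply l2_ball|].
      apply conv_ball; auto using l2_ball.
  - rewrite ET. apply functional_extensionality. intros j. set (z := mult_op g vm).
    unfold ladd, lsub, vm, mask, nneg. rewrite negwin_in_window.
    destruct (in_window N j) eqn:hj; simpl.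
    + destruct (Z.ltb_spec j 0).
      * rewrite (proj2 (Z.leb_gt 0 j)) by lia. ring.
      * rewrite (proj2 (Z.leb_le 0 j)) by lia. ring.
    + rewrite Hv by auto. destruct (0 <=? j)%Z; ring.
Qed.

(** * Truncation error, inverse inequality and consistency *)

(** The window is asymmetric for even [N]: the index [N/2] is excluded while [-N/2] is kept, and
    there equality holds. *)
Lemma outside_window_ge N j : in_window N j = false -> INR N / 2 <= IZR (Z.abs j).
Proof.
  intros h. assert (h' : (Z.of_nat N <= 2 * Z.abs j)%Z).
  { apply Z.nlt_ge. intros c. rewrite (proj2 (in_window_true N j)) in h; [discriminate|].
    pose proof (Nat.div_mod_eq N 2). pose proof (Nat.mod_upper_bound N 2 ltac:(lia)).
    pose proof (Nat.div_mod_eq (N-1) 2). pose proof (Nat.mod_upper_bound (N-1) 2 ltac:(lia)). lia. }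
  apply IZR_le in h'. rewrite mult_IZR, <- INR_IZR_INZ in h'. lra.
Qed.

Lemma wt_outside_window s t N j : s <= t -> (0 < N)%nat -> in_window N j = false ->
  wt s j <= Rpower (INR N / 2) (s - t) * wt t j.
Proof.
  intros hst hN hj. apply outside_window_ge in hj. apply lt_0_INR in hN.
  unfold wt. set (b := Rmax 1 (IZR (Z.abs j))).
  assert (hb : INR N / 2 <= b) by (eapply Rle_trans; [apply hj|apply Rmax_r]).
  replace s with ((s - t) + t) at 1 by ring. rewrite Rpower_plus.
  apply Rmult_le_compat_r; [left; apply exp_pos|].
  replace (s - t) with (- (t - s)) by ring. rewrite !Rpower_Ropp.
  apply Rinv_le_contravar; [apply exp_pos|]. apply Rle_Rpower_l; lra.
Qed.

Lemma wt_inside_window s N j : 0 <= s -> (0 < N)%nat -> in_window N j = true ->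
  wt s j <= Rpower (INR N) s.
Proof.
  intros hs hN hj. apply in_window_true in hj. unfold wt.
  assert (1 <= INR N) by (apply (le_INR 1); lia).
  apply Rle_Rpower_l; auto. split.
  - pose proof (Rmax_l 1 (IZR (Z.abs j))). lra.
  - apply Rmax_lub; auto. rewrite INR_IZR_INZ. apply IZR_le.
    pose proof (Nat.div_mod_eq N 2). pose proof (Nat.div_mod_eq (N-1) 2). lia.
Qed.

Lemma l2_tail_window s t U N u : s <= t -> (0 < N)%nat -> l2 U (lwt t u) ->
  l2 (Rpower (INR N / 2) (s - t) * U) (lwt s (lsub u (PN N u))).
Proof.
  intros hst hN HU.
  assert (hp : 0 < Rpower (INR N / 2) (s - t)) by apply exp_pos.
  replace (Rpower (INR N / 2) (s - t) * U) with (Cmod (RtoC (Rpower (INR N / 2) (s - t))) * U)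
    by (rewrite Cmod_R, Rabs_right; lra).
  apply (ball_dom _ l2_ball _ _ (lscal (RtoC (Rpower (INR N / 2) (s - t))) (lwt t u)));
    [|apply (ball_scal _ l2_ball); auto].
  intros j. unfold lscal. rewrite Cmod_mult, Cmod_R, Rabs_right, !Cmod_lwt by lra.
  unfold lsub, PN. destruct (in_window N j) eqn:hj.
  - replace (u j - u j)%C with (RtoC 0) by ring. rewrite Cmod_0, Rmult_0_r.
    apply Rmult_le_pos; [lra|]. apply Rmult_le_pos; [left; apply wt_pos|apply Cmod_ge_0].
  - replace (u j - 0)%C with (u j) by ring. rewrite <- Rmult_assoc.
    apply Rmult_le_compat_r; [apply Cmod_ge_0|]. apply wt_outside_window; auto.
Qed.

(** Bernstein's inequality. It allows stability to be proved in [l2] alone: the loss [N^s] combines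
    with a defect of order [N^(-t)] into the optimal rate. *)
Lemma l2_inverse_inequality s N B v : 0 <= s -> (0 < N)%nat -> in_ranPN N v -> l2 B v ->
  l2 (Rpower (INR N) s * B) (lwt s v).
Proof.
  intros hs hN Hv HB. assert (hp : 0 < Rpower (INR N) s) by apply exp_pos.
  replace (Rpower (INR N) s * B) with (Cmod (RtoC (Rpower (INR N) s)) * B)
    by (rewrite Cmod_R, Rabs_right; lra).
  apply (ball_dom _ l2_ball _ _ (lscal (RtoC (Rpower (INR N) s)) v));
    [|apply (ball_scal _ l2_ball); auto].
  intros j. unfold lscal. rewrite Cmod_mult, Cmod_R, Rabs_right, Cmod_lwt by lra.
  destruct (in_window N j) eqn:hj.
  - apply Rmult_le_compat_r; [apply Cmod_ge_0|]. apply wt_inside_window; auto.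
  - rewrite Hv, Cmod_0 by auto. lra.
Qed.

(** Projecting the exact equation and subtracting [T_N (P_N u)], the nonnegative parts of [u] cancel
    inside the window, and only the discarded negative tail, multiplied by [g], remains. *)
Lemma trunc_op_error A U N g u uN : l1 A g -> linf U u -> RHP_sol g u -> in_ranPN N uN ->
  (forall j, trunc_op N g uN j = PN N (lsub g delta0) j) ->
  trunc_op N g (lsub uN (PN N u))
  = mask (in_window N) (mult_op g (mask (fun j => j <? 0)%Z (lsub u (PN N u)))).
Proof.
  intros Hg Hu [_ Hsol] HuN HT.
  destruct (in_ranPN_linf N uN HuN) as [D HD].
  assert (HP : linf U (PN N u)) by (apply (mask_ball linf); auto using linf_ball).
  rewrite (trunc_op_lsub A D U) by auto.
  apply functional_extensionality in HT. rewrite HT.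
  rewrite (trunc_op_eq A U) by auto. rewrite !PN_mask.
  replace (mask (negwin (N / 2)) (mask (in_window N) u))
    with (mask (fun j => j <? 0)%Z (mask (in_window N) u)).
  2:{ apply functional_extensionality. intros j. unfold mask. rewrite negwin_in_window.
      destruct (in_window N j), (j <? 0)%Z; reflexivity. }
  assert (Hm : forall p a x, linf a x -> linf a (mask p x)) by (intros; apply mask_ball; auto using linf_ball).
  rewrite (mask_lsub (fun j => j <? 0)%Z), (conv_sub_r A U U); auto.
  assert (Es : lsub g delta0 = ladd (mask nneg u) (mult_op g (mask (fun j => j <? 0)%Z u))).
  { apply functional_extensionality. intros j. rewrite <- Hsol.
    replace (Cauchy_minus u) with (lscal (-(1)) (mask (fun j => j <? 0)%Z u)).
    - rewrite (conv_scal_r A U); auto.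
      unfold lsub, ladd, lscal, Cauchy_plus, mask, nneg. ring.
    - apply functional_extensionality. intros i. unfold lscal, mask, Cauchy_minus.
      destruct (i <? 0)%Z; ring. }
  rewrite Es. apply functional_extensionality. intros j.
  set (z := mult_op g (mask (fun j => j <? 0)%Z u)).
  set (z' := mult_op g (mask (fun j => j <? 0)%Z (mask (in_window N) u))).
  unfold lsub, ladd, mask. destruct (nneg j), (in_window N j); ring.
Qed.

Theorem theoremt (c : R -> R) (hc : forall r, 0 < c r)
  (t : R) (g u : lseq)
  (ht : 1 <= t) (hg : in_Hs t g)
  (hmin : exists m, 0 < m /\ forall theta, m <= Cmod (circ_val g theta))
  (hu : in_Hs t u) (hsol : RHP_sol g u)
  (huniq : forall v, in_Hs t v -> RHP_sol g v -> forall j, v j = u j) :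
  forall s : R, (s = 0 \/ 1/2 < s) -> 0 <= 2 * s -> 2 * s < t ->
  exists C : R, exists N0 : R, 0 < N0 /\
    forall N : nat, N0 < INR N ->
      invertible_on_ranPN N g /\
      forall uN : lseq, in_ranPN N uN ->
        (forall j, trunc_op N g uN j = PN N (lsub g delta0) j) ->
        Hs_norm c s (lsub u uN) <= C * Rpower (INR N) (s - t).
Proof.
  intros s _ hs hst.
  destruct hmin as [m [hm Hm]].
  destruct (in_Hs_l2 t g hg) as [G HG]. destruct (in_Hs_l2 t u hu) as [U HU].
  assert (Hg := l1_of_lwt t G g ht HG). set (A := 4 * (G + 1)) in *.
  assert (Hu1 := l1_of_lwt t U u ht HU).
  assert (Hui : linf U u) by (apply (ball_linf _ _ _ l2_ball), l2_of_lwt with t; auto; lra).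
  destruct (approx_inverse A G g m Hg) with (eps := 1/2) as (k & q & Hqs & He); auto; [|lra|].
  { apply l2_lD_of_lwt1, l2_lwt_mono with t; auto. }
  assert (Hq := l1_finite q k Hqs). set (Q := wsum (fun j => Cmod (q j)) k) in *.
  destruct (finite_section_stability A Q k g q) as (K & n0 & hK & Hst); auto.
  { intros B w Hw H1 H2. apply (kernel_minus_trivial t A G B m g u w); auto. }
  { intros B w Hw H1 H2. apply (kernel_plus_trivial A (4 * (U + 1)) B Q g u q w); auto. }
  set (K' := K + 1 + A * K).
  (* The first term is the [H^s] error of [P_N u], the second is stability [K'] times the [l2] size
     of the consistency defect. The powers of 2 arise because discarded frequencies are only known
     to be at least [N / 2]. *)
  exists (sqrt (c (Rabs s)) * (Rpower 2 (t - s) * U + K' * (A * (Rpower 2 t * U)))).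
  (* The section has length [N / 2], which must reach the stability threshold [n0]; the extra 2
     keeps the bound positive when [n0 = 0]. *)
  exists (INR (2 * n0 + 2)). split; [apply lt_0_INR; lia|].
  intros N hN. apply INR_lt in hN. assert (hN0 : (0 < N)%nat) by lia.
  assert (hn : (n0 <= N / 2)%nat) by (apply Nat.div_le_lower_bound; lia).
  assert (Hbb : forall v B, in_ranPN N v -> l2 B (trunc_op N g v) -> l2 (K' * B) v).
  { intros v B Hv HB. apply (trunc_op_bounded_below A K N B g v); auto.
    intros w D hw hD. apply Hst with (N / 2)%nat; auto. }
  assert (Hinj : forall v, in_ranPN N v -> (forall j, trunc_op N g v j = 0%C) -> forall j, v j = 0%C).
  { intros v Hv H0 j.
    assert (Hl : l2 (K' * 0) v).
    { apply Hbb; auto. apply (ball_dom _ l2_ball _ _ lzero); [|apply (ball_zero _ l2_ball)].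
      intros i. rewrite H0. right. reflexivity. }
    apply Cmod_eq_0. pose proof (ball_point _ l2_ball _ _ j Hl). pose proof (Cmod_ge_0 (v j)). lra. }
  split; [split|].
  - apply trunc_op_surjective with A; auto.
  - intros v1 v2 H1 H2 E j.
    destruct (in_ranPN_linf N v1 H1) as [B1 hB1]. destruct (in_ranPN_linf N v2 H2) as [B2 hB2].
    assert (Z : lsub v1 v2 j = 0%C).
    { apply Hinj.
      - intros i hi. unfold lsub. rewrite H1, H2 by auto. ring.
      - intros i. rewrite (trunc_op_lsub A B1 B2) by auto. unfold lsub. rewrite E. ring. }
    unfold lsub in Z. replace (v1 j) with (v1 j - v2 j + v2 j)%C by ring. rewrite Z. ring.
  - intros uN HuN HT.
    set (y := lsub u (PN N u)).
    assert (Hy0 : l2 (Rpower (INR N / 2) (0 - t) * U) y).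
    { apply l2_of_lwt with 0; [lra|]. apply l2_tail_window; auto. lra. }
    assert (Hys : l2 (Rpower (INR N / 2) (s - t) * U) (lwt s y)).
    { apply l2_tail_window; auto. lra. }
    assert (HeN : in_ranPN N (lsub uN (PN N u))).
    { intros j hj. unfold lsub, PN. rewrite hj, HuN by auto. ring. }
    assert (Hl : l2 (K' * (A * (Rpower (INR N / 2) (0 - t) * U))) (lsub uN (PN N u))).
    { apply Hbb; auto. rewrite (trunc_op_error A U) by auto.
      apply mask_ball; [apply l2_ball|]. apply conv_ball; auto using l2_ball.
      apply mask_ball; auto using l2_ball. }
    apply (l2_inverse_inequality s N) in Hl; auto; [|lra].
    assert (Hf := ball_sub _ _ _ _ _ l2_ball Hys Hl). rewrite <- lwt_lsub in Hf.
    replace (lsub y (lsub uN (PN N u))) with (lsub u uN) in Hf.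
    2:{ apply functional_extensionality. intros j. unfold y, lsub. ring. }
    eapply Rle_trans; [apply Hs_norm_le; [auto|apply Hf]|].
    right. rewrite Rmult_assoc. f_equal.
    assert (hNR : 0 < INR N) by (apply lt_0_INR; lia).
    (* Separates the powers of [N] from constants, so that both error terms carry exactly
       [N^(s-t)]. *)
    assert (P : forall z, Rpower (INR N / 2) z = Rpower (INR N) z * Rpower 2 (- z)).
    { intros z. unfold Rdiv. rewrite <- Rpower_mult_distr by lra.
      f_equal. rewrite Rpower_Ropp, <- (Rinv_inv 2) at 1.
      unfold Rpower. rewrite ln_Rinv by lra.
      rewrite <- exp_Ropp. f_equal. rewrite Rinv_inv. ring. }
    rewrite !P. replace (- (s - t)) with (t - s) by ring. replace (- (0 - t)) with t by ring.
    replace (Rpower (INR N) (s - t)) with (Rpower (INR N) s * Rpower (INR N) (0 - t)).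
    2:{ rewrite <- Rpower_plus. f_equal. ring. }
    ring.
Qed.
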